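(* Let $m\ge 4$ be an even integer. In $\mathbb{R}^3$ with coordinates $(x,y,t)$, let $$X=\frac{\partial}{\partial x},\qquad Y=\frac{\partial}{\partial y}-m x^{m-1}\frac{\partial}{\partial t},\qquad L=X^2+Y^2 .$$ Then the differential operator $L$ is not analytic hypoelliptic.
   Context: A differential operator $L$ on $\mathbb{R}^3$ is called analytic hypoelliptic if, for every open set $U\subset\mathbb{R}^3$ and every (complex-valued) distribution $u$ on $U$ such that $Lu$ is real-analytic in $U$, the distribution $u$ is itself (given by) a real-analytic function in $U$. Here $X^2=X\circ X$ and $Y^2=Y\circ Y$ denote compositions of first-order differential operators. *)

(* Defs.v *)
From HB Require Import structures.
From mathcomp Require Import all_boot all_order all_algebra.
From mathcomp Require Import complex.
From mathcomp Require Import all_classical all_reals all_analysis.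

Set Implicit Arguments.
Unset Strict Implicit.
Unset Printing Implicit Defensive.

Import Order.TTheory GRing.Theory Num.Theory.
Import ComplexField.Normc.
Import numFieldNormedType.Exports.

Local Open Scope classical_set_scope.
Local Open Scope ring_scope.

(* The point (x, y, t) is ((x, y), t); the topology is that of the normed
   product, i.e. of the sup norm. *)
Notation space3 R := (R * R * R)%type.

Section Space.
Context {R : realType}.

Definition ix : 'I_3 := @Ordinal 3 0 isT.
Definition iy : 'I_3 := @Ordinal 3 1 isT.
Definition it : 'I_3 := @Ordinal 3 2 isT.

Definition axis (i : 'I_3) : space3 R :=
  ((i == ix)%:R, (i == iy)%:R, (i == it)%:R).

End Space.

Notation lebesgue3 R :=
  ((@lebesgue_measure R \x @lebesgue_measure R) \x @lebesgue_measure R)%E.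

Section ComplexFunctions.
Context {R : realType}.
Implicit Types (f g : space3 R -> R[i]) (U K : set (space3 R)).

(* R[i] carries no normed R-module structure: continuity, differentiability
   and integrals are taken on real and imaginary parts. *)
Definition ccontinuous f : Prop :=
  continuous (fun p => complex.Re (f p)) /\ continuous (fun p => complex.Im (f p)).

Definition cderivable f (i : 'I_3) : Prop := forall p,
  derivable (fun q => complex.Re (f q)) p (axis i) /\
  derivable (fun q => complex.Im (f q)) p (axis i).

Definition partial (i : 'I_3) f : space3 R -> R[i] := fun p =>
  ('D_(axis i) (fun q => complex.Re (f q)) p +i* 'D_(axis i) (fun q => complex.Im (f q)) p)%C.

Definition cintegral f : R[i] :=
  (Rintegral (lebesgue3 R) setT (fun p => complex.Re (f p)) +i*
   Rintegral (lebesgue3 R) setT (fun p => complex.Im (f p)))%C.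

(* The word i_1 ... i_k stands for d_{i_1} ... d_{i_k}. *)
Definition partials (w : seq 'I_3) f : space3 R -> R[i] := foldr partial f w.

Definition smooth f : Prop := forall w : seq 'I_3,
  ccontinuous (partials w f) /\ forall i, cderivable (partials w f) i.

(* C^oo functions with support in K, for a closed set K. *)
Definition smooth_in K f : Prop :=
  smooth f /\ forall p, ~ K p -> f p = 0.

Definition test_function U f : Prop :=
  exists K, [/\ compact K, K `<=` U & smooth_in K f].

(* Sum of the sup norms of all partial derivatives of order at most N; a
   multi-index occurs once for each of its orderings. *)
Definition CN_norm (N : nat) f : R :=
  \sum_(k < N.+1) \sum_(w : k.-tuple 'I_3)
    sup (range (fun p => normc (partials w f p))).

(* Sum over a, b, d < N of c_abd h1^a h2^b h3^d. *)
Definition psum (c : nat -> nat -> nat -> R[i]) (h : space3 R) (N : nat) : R[i] :=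
  \sum_(a < N) \sum_(b < N) \sum_(d < N)
    c a b d * (h.1.1 ^+ a * h.1.2 ^+ b * h.2 ^+ d)%:C%C.

Definition psum_abs (c : nat -> nat -> nat -> R[i]) (h : space3 R) (N : nat) : R :=
  \sum_(a < N) \sum_(b < N) \sum_(d < N)
    normc (c a b d * (h.1.1 ^+ a * h.1.2 ^+ b * h.2 ^+ d)%:C%C).

(* f is, near each point p of U, the sum of an absolutely convergent power
   series in q - p. *)
Definition real_analytic U f : Prop := forall p, U p ->
  exists (c : nat -> nat -> nat -> R[i]) (r : R), 0 < r /\
    forall q, ball p r q ->
      cvgn (psum_abs c (q - p)) /\
      normc (psum c (q - p) N - f q) @[N --> \oo] --> (0 : R).

End ComplexFunctions.

(* Functionals are total functions on space3 R -> R[i]; only their values on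
   test functions matter. *)
Notation functional R := ((space3 R -> R[i]) -> R[i]).

Section Distributions.
Context {R : realType}.
Implicit Types (u v : functional R) (U K : set (space3 R)).

(* Linearity on test functions, and continuity on C^oo_K for each compact K
   contained in U. *)
Definition distribution_on U u : Prop :=
  (forall (a : R[i]) (f g : space3 R -> R[i]),
     test_function U f -> test_function U g ->
     u (fun p => a * f p + g p) = a * u f + u g) /\
  (forall K, compact K -> K `<=` U ->
     exists (C : R) (N : nat), forall f, smooth_in K f ->
       normc (u f) <= C * CN_norm N f).

Definition eq_on U u v : Prop :=
  forall f, test_function U f -> u f = v f.

(* The integral is over the whole space since the test function vanishes
   outside the open set under consideration. *)
Definition regular (g : space3 R -> R[i]) : functional R :=
  fun f => cintegral (fun p => g p * f p).

Definition is_analytic_on U u : Prop :=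
  exists2 g, real_analytic U g & eq_on U u (regular g).

(* Operations on distributions are the transposes of those on test functions. *)
Definition d_partial (i : 'I_3) u : functional R :=
  fun f => - u (partial i f).

(* Multiplication by a smooth real-valued function. *)
Definition d_mul (a : space3 R -> R) u : functional R :=
  fun f => u (fun p => (a p)%:C%C * f p).

Definition d_add u v : functional R := fun f => u f + v f.

Definition d_sub u v : functional R := fun f => u f - v f.

(* A differential operator is given by its action on distributions. *)
Definition analytic_hypoelliptic (P : functional R -> functional R) : Prop :=
  forall (U : set (space3 R)) (u : functional R),
    open U -> distribution_on U u ->
    is_analytic_on U (P u) -> is_analytic_on U u.

Definition Xop u : functional R := d_partial ix u.

Definition Yop (m : nat) u : functional R :=
  d_sub (d_partial iy u)
        (d_mul (fun p => m%:R * p.1.1 ^+ m.-1) (d_partial it u)).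

Definition Lop (m : nat) u : functional R :=
  d_add (Xop (Xop u)) (Yop m (Yop m u)).

End Distributions.

(* Main.v *)
(* Write m = n + 1, with n odd. If f'' = (z - m s^n)^2 f, then
   e^{i r^m t} e^{i r z y} f(r x) is annihilated by L, for complex z.

   Some nonzero f stays below e^{2 T^{2m}} on [-T^n, T^n], for a suitable z with
   |z| <= T^{2n}: two independent solutions give a connection determinant D(z),
   even in z, which vanishes iff some f vanishes at both ends. If (a polynomial
   truncation of) D had no root in that disc, Harnack's inequality for log |D|
   would bound D(m T^n) / D(0), whereas a WKB lower bound for real z makes D(m T^n)
   larger than that. When f is small at both ends, convexity of |f|^2 for
   |s| >= T^2 reduces its size to that on [-T^2, T^2], where the power series of f
   has an explicit majorant.

   With T_l = 2^l T_0, r_l = T_l^n and A_l = r_l^3, let v_l be the resulting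
   solution, multiplied by e^{-4 A_l}. The series of the v_l converges uniformly on
   the unit cube, and its sum u satisfies L u = 0. If u were analytic near 0, its
   k-th difference quotients in t, k = 20 A_j, with step pi / r_j^m, divided by 2^k,
   would be O(2^-k), as polynomials of degree < k are killed. But this operation
   preserves the size of v_j, which is at least e^{-5 A_j} somewhere close to 0,
   multiplies the v_l with l < j by at most 2^-k, and the v_l with l > j sum up to
   O(e^{-10 A_j}); a contradiction for large j. *)
Require Import Defs.
From HB Require Import structures.
From mathcomp Require Import all_boot all_order all_algebra.
From mathcomp Require Import complex.
From mathcomp Require Import all_classical all_reals all_analysis.
From mathcomp Require Import measurable_realfun.
From mathcomp Require Import zify ring lra.

Set Implicit Arguments.
Unset Strict Implicit.
Unset Printing Implicit Defensive.

Import Order.TTheory GRing.Theory Num.Theory.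
Import ComplexField.Normc.
Import numFieldNormedType.Exports.

Local Open Scope classical_set_scope.
Local Open Scope ring_scope.

(** * Complex numbers *)

Section ComplexNumbers.
Context {R : realType}.
Implicit Types (z w : R[i]).

(** The wave v_l oscillates in t at frequency r_l^m, but near 0 its size is still at least e^{-5
    r_l^3}; in an analytic sum such components would decay exponentially in r_l^m. As m >= 4, the
    stencil of k steps has length O(r_l^3 / r_l^m), which tends to 0. The cube in A_l comes from |r
    z y| <= r T^{2n} = r^3; the growth e^{2 T^{2m}} of f fits in because 2m <= 3n.

    The small value of D is forced by a narrow margin. Write tau = T^n. The upper bound for log |D|
    on |z| <= tau^2 and the WKB lower bound at 0 share the term 2 tau^m, so they differ by O(tau^3).
    As D is even, Harnack applies in the variable z^2 and gains the factor (m tau / tau^2)^2 = m^2 /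
    tau^2, which leaves O(tau); in the variable z it would leave O(tau^2). At z = m tau the turning
    point is T, and WKB yields the extra term n T tau, which wins once T is large. The bound |D(z)|
    <= 1/2 already makes some normalized solution at most 1 at both ends. *)

Lemma cReD z w : complex.Re (z + w) = complex.Re z + complex.Re w.
Proof. by case: z w => a b [c d]. Qed.

Lemma cImD z w : complex.Im (z + w) = complex.Im z + complex.Im w.
Proof. by case: z w => a b [c d]. Qed.

Lemma cReN z : complex.Re (- z) = - complex.Re z.
Proof. by case: z. Qed.

Lemma cImN z : complex.Im (- z) = - complex.Im z.
Proof. by case: z. Qed.

Lemma cReM z w : complex.Re (z * w) =
  complex.Re z * complex.Re w - complex.Im z * complex.Im w.
Proof. by case: z w => a b [c d]. Qed.

Lemma cImM z w : complex.Im (z * w) =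
  complex.Re z * complex.Im w + complex.Im z * complex.Re w.
Proof. by case: z w => a b [c d]. Qed.

Definition cE := (cReD, cImD, cReN, cImN, cReM, cImM).

Lemma complex_ext z w :
  complex.Re z = complex.Re w -> complex.Im z = complex.Im w -> z = w.
Proof. by case: z w => a b [c d] /= -> ->. Qed.

Lemma Re_sum (I : Type) (s : seq I) (P : pred I) (F : I -> R[i]) :
  complex.Re (\sum_(i <- s | P i) F i) = \sum_(i <- s | P i) complex.Re (F i).
Proof. by apply: (big_morph _ cReD). Qed.

Lemma Im_sum (I : Type) (s : seq I) (P : pred I) (F : I -> R[i]) :
  complex.Im (\sum_(i <- s | P i) F i) = \sum_(i <- s | P i) complex.Im (F i).
Proof. by apply: (big_morph _ cImD). Qed.

Lemma cnormE z : normc z = Num.sqrt (complex.Re z ^+ 2 + complex.Im z ^+ 2).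
Proof. by case: z. Qed.

Lemma normc_ge0 z : 0 <= normc z.
Proof. by rewrite cnormE sqrtr_ge0. Qed.

Lemma cnormsq z : normc z ^+ 2 = complex.Re z ^+ 2 + complex.Im z ^+ 2.
Proof. by rewrite cnormE sqr_sqrtr// addr_ge0// sqr_ge0. Qed.

Lemma normr_Re z : `|complex.Re z| <= normc z.
Proof. by rewrite cnormE -sqrtr_sqr ler_wsqrtr// lerDl sqr_ge0. Qed.

Lemma normr_Im z : `|complex.Im z| <= normc z.
Proof. by rewrite cnormE -sqrtr_sqr ler_wsqrtr// lerDr sqr_ge0. Qed.

Lemma normc_le z : normc z <= `|complex.Re z| + `|complex.Im z|.
Proof.
rewrite cnormE -(@ler_pXn2r _ 2)// ?nnegrE ?sqrtr_ge0 ?addr_ge0//.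
rewrite sqr_sqrtr ?addr_ge0 ?sqr_ge0// -!(real_normK (num_real (_ z))).
by have := normr_ge0 (complex.Re z); have := normr_ge0 (complex.Im z); nra.
Qed.

Lemma normcX z k : normc (z ^+ k) = normc z ^+ k.
Proof. by elim: k => [|k IH]; rewrite ?expr0 ?normc1// !exprS normcM IH. Qed.

Lemma normc_real (x : R) : normc x%:C%C = `|x|.
Proof. by rewrite cnormE /= expr0n addr0 sqrtr_sqr. Qed.

Lemma normcB z w : normc (z - w) = normc (w - z).
Proof. by rewrite -normcN opprB. Qed.

Lemma ler_normcB z w : normc (z - w) <= normc z + normc w.
Proof. by rewrite -(normcN w) le_normcD. Qed.

Lemma normc_sum (I : Type) (s : seq I) (P : pred I) (F : I -> R[i]) :
  normc (\sum_(i <- s | P i) F i) <= \sum_(i <- s | P i) normc (F i).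
Proof.
elim/big_rec2: _ => [|i y x _ h]; first by rewrite normc0.
by apply: le_trans (le_normcD _ _) _; rewrite lerD2l.
Qed.

Lemma normc_prod (I : Type) (s : seq I) (F : I -> R[i]) :
  normc (\prod_(i <- s) F i) = \prod_(i <- s) normc (F i).
Proof. exact: (big_morph _ (@normcM R) (@normc1 R)). Qed.

Lemma normc_gt0 z : (0 < normc z) = (z != 0).
Proof.
rewrite lt_neqAle normc_ge0 andbT; apply/idP/idP => [|z0].
  by apply: contra => /eqP ->; rewrite normc0.
by apply: contra z0 => /eqP h; apply/eqP/eq0_normc.
Qed.

Lemma normc_nat k : normc (k%:R : R[i]) = k%:R.
Proof. by rewrite -(rmorph_nat (real_complex R)) normc_real ger0_norm. Qed.

Definition expi (t : R) : R[i] := (cos t +i* sin t)%C.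

Lemma expiD s t : expi (s + t) = expi s * expi t.
Proof.
by rewrite /expi; apply: complex_ext => /=; rewrite ?cosD ?sinD// addrC mulrC [X in _ + X]mulrC addrC.
Qed.

Lemma expi0 : expi 0 = 1.
Proof. by rewrite /expi cos0 sin0. Qed.

Lemma expiX (t : R) k : expi t ^+ k = expi (k%:R * t).
Proof.
elim: k => [|k IH]; first by rewrite mul0r expi0 expr0.
by rewrite exprS IH -expiD -natr1 mulrDl mul1r addrC.
Qed.

Lemma normc_expi t : normc (expi t) = 1.
Proof. by rewrite cnormE /= cos2Dsin2 sqrtr1. Qed.

Lemma expi_pi : expi pi = -1.
Proof. by apply: complex_ext; rewrite /= ?cospi ?sinpi ?oppr0. Qed.

Lemma expi_2pi : expi (2 * pi) = 1.
Proof.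
by rewrite mulr_natl; apply: complex_ext; rewrite /= ?cos2pi ?sin2pi.
Qed.

Lemma expi_neq1 (t : R) : 0 < t < 2 * pi -> expi t != 1.
Proof.
move=> /andP[t0 tpi]; apply/eqP => /(congr1 (@complex.Re R)) /=.
have -> : t = (t / 2) *+ 2 by rewrite -mulr_natr; field.
rewrite cos_mulr2n cos2sin2.
have : 0 < sin (t / 2) by apply: sin_gt0_pi; apply/andP; split; lra.
move=> s0; rewrite -mulr_natl.
set x := sin _; rewrite (_ : 2%:R * _ - 1 = 1 - 2 * x ^+ 2); last by ring.
move/eqP; rewrite eq_sym -subr_eq0 opprB addrC subrK mulf_eq0 pnatr_eq0 /=.
by rewrite sqrf_eq0 gt_eqF.
Qed.

(** |e^{it} - 1| = 2 |sin (t/2)|, and |sin s| <= |s| by the mean value theorem. *)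
Lemma normc_expiB1 (t : R) : normc (expi t - 1) <= `|t|.
Proof.
have -> : t = 2 * (t / 2) by field.
move: (t / 2) => s.
have -> : expi (2 * s) - 1 = (2 * sin s)%:C%C * (- sin s +i* cos s)%C.
  rewrite (mulr_natl s 2); apply: complex_ext; rewrite !cE /= ?cos_mulr2n ?sin_mulr2n.
    by rewrite (cos2sin2 s) -(mulr_natl _ 2); ring.
  by rewrite -(mulr_natl _ 2); ring.
rewrite normcM normc_real (cnormE (_ +i* _)%C) /= sqrrN addrC cos2Dsin2 sqrtr1 mulr1.
rewrite !normrM ler_wpM2l//.
wlog s0 : s / 0 <= s => [wl|].
  by have [/wl//|s0] := leP 0 s; rewrite -(normrN (sin s)) -sinN -[leRHS]normrN wl// oppr_ge0 ltW.
have [->|s0'] := eqVneq s 0; first by rewrite sin0.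
have sp : 0 < s by rewrite lt_neqAle eq_sym s0'.
have [c _] := MVT sp (fun x _ => is_derive_sin x)
   (continuous_subspaceT (@continuous_sin R)).
rewrite sin0 !subr0 => ->; rewrite normrM ler_piMl//; exact: cos_max.
Qed.

End ComplexNumbers.

(** * One-variable differential calculus *)

Section Derivatives.
Context {R : realType}.
Implicit Types (f g : R -> R) (x a b : R).

(** Absorbs the algebra left by the derivation rules: composed rules produce a function and a value,
    and both are then matched with the wanted ones. *)
Lemma der_ext f g x a b : is_derive x 1 f a -> f =1 g -> a = b -> is_derive x 1 g b.
Proof. by move=> + /funext fg <-; rewrite fg. Qed.

Lemma derD f g x a b : is_derive x 1 f a -> is_derive x 1 g b ->
  is_derive x 1 (fun t => f t + g t) (a + b).
Proof. exact: is_deriveD. Qed.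

Lemma derN f x a : is_derive x 1 f a -> is_derive x 1 (fun t => - f t) (- a).
Proof. exact: is_deriveN. Qed.

Lemma derB f g x a b : is_derive x 1 f a -> is_derive x 1 g b ->
  is_derive x 1 (fun t => f t - g t) (a - b).
Proof. exact: is_deriveB. Qed.

Lemma derM f g x a b : is_derive x 1 f a -> is_derive x 1 g b ->
  is_derive x 1 (fun t => f t * g t) (a * g x + f x * b).
Proof.
move=> fa gb; have h := is_deriveM fa gb.
by apply: (der_ext h) => //; rewrite addrC mulrC.
Qed.

Lemma der_cst (c : R) x : is_derive x 1 (fun=> c) 0.
Proof. exact: is_derive_cst. Qed.

Lemma der_id x : is_derive x 1 (fun t => t) 1.
Proof. exact: is_derive_id. Qed.

Lemma derZ (c : R) f x a : is_derive x 1 f a -> is_derive x 1 (fun t => c * f t) (c * a).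
Proof.
by move=> h; apply: (der_ext (derM (der_cst c x) h)) => //; rewrite mul0r add0r.
Qed.

Lemma derX f x a n : is_derive x 1 f a ->
  is_derive x 1 (fun t => f t ^+ n) (n%:R * f x ^+ n.-1 * a).
Proof.
move=> h; elim: n => [|n IH].
  by rewrite !mul0r; apply: (der_ext (der_cst 1 x)) => // t; rewrite expr0.
apply: (der_ext (derM h IH)) => [t|]; first by rewrite exprS.
case: n {IH} => [|n]; first by rewrite !mul0r !mulr0 expr0; ring.
by rewrite /= exprS -[n.+2%:R]natr1; ring.
Qed.

Lemma der_pow x n : is_derive x 1 (fun t => t ^+ n) (n%:R * x ^+ n.-1).
Proof. by apply: (der_ext (derX n (der_id x))) => //; rewrite mulr1. Qed.

Lemma der_comp f g x a b : is_derive (g x) 1 f a -> is_derive x 1 g b ->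
  is_derive x 1 (fun t => f (g t)) (a * b).
Proof. exact: is_derive1_comp. Qed.

Lemma der_exp f x a : is_derive x 1 f a ->
  is_derive x 1 (fun t => expR (f t)) (expR (f x) * a).
Proof. exact: der_comp. Qed.

Lemma der_sum n (F : 'I_n -> R -> R) x (A : 'I_n -> R) :
  (forall i, is_derive x 1 (F i) (A i)) ->
  is_derive x 1 (fun t => \sum_(i < n) F i t) (\sum_(i < n) A i).
Proof.
move=> h; have := is_derive_sum h => h'.
by apply: (der_ext h') => // t; rewrite fct_sumE.
Qed.

Lemma der_continuous f x a : is_derive x 1 f a -> {for x, continuous f}.
Proof.
by move=> [df _]; apply: differentiable_continuous; apply/derivable1_diffP.
Qed.

Lemma der_MVT f (f' : R -> R) a b : a <= b ->
  (forall x, a <= x <= b -> is_derive x 1 f (f' x)) ->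
  exists2 c, a <= c <= b & f b - f a = f' c * (b - a).
Proof.
move=> ab h; have [| |c E0 E] := MVT_segment ab (f := f) (df := f').
- by move=> x; rewrite in_itv/= => /andP[ax xb]; apply: h; rewrite !ltW.
- apply: derivable_within_continuous => x; rewrite in_itv/= => xab.
  by case: (h _ xab).
- by exists c => //; move: E0; rewrite in_itv.
Qed.

Lemma der_ge0_le f (f' : R -> R) a b : a <= b ->
  (forall x, a <= x <= b -> is_derive x 1 f (f' x)) ->
  (forall x, a <= x <= b -> 0 <= f' x) -> f a <= f b.
Proof.
move=> ab h h0; have [c cab E] := der_MVT ab h.
by rewrite -subr_ge0 E mulr_ge0 ?h0// subr_ge0.
Qed.

End Derivatives.

(** * Harnack's inequality for polynomials *)

Section RootsOfUnity.
Context {R : realType}.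
Variable K : nat.
Hypothesis K0 : (0 < K)%N.

Let om : R[i] := expi (2 * pi / K%:R).

Lemma root_unityX : om ^+ K = 1.
Proof.
rewrite expiX mulrC divfK ?expi_2pi// pnatr_eq0; by case: K K0.
Qed.

Lemma root_unity_modn e : om ^+ e = om ^+ (e %% K).
Proof. by rewrite {1}(divn_eq e K) exprD mulnC exprM root_unityX expr1n mul1r. Qed.

Lemma normc_root_unity e : normc (om ^+ e) = 1.
Proof. by rewrite normcX normc_expi expr1n. Qed.

Lemma sum_root_unity e : ~~ (K %| e)%N -> \sum_(i < K) om ^+ (i * e) = 0.
Proof.
move=> Ke; set x := om ^+ e.
have x1 : x != 1.
  rewrite /x root_unity_modn expiX; apply: expi_neq1.
  have K0R : 0 < K%:R :> R by rewrite ltr0n.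
  have e0 : (0 < e %% K)%N by rewrite lt0n.
  have pi0 := pi_gt0 R.
  rewrite !mulr_gt0 ?invr_gt0 ?ltr0n//= mulrCA gtr_pMr ?mulr_gt0//.
  by rewrite ltr_pdivrMr// mul1r ltr_nat ltn_mod.
have : (x - 1) * \sum_(i < K) x ^+ i = 0.
  by rewrite -subrX1 /x -exprM mulnC exprM root_unityX expr1n subrr.
move/eqP; rewrite mulf_eq0 subr_eq0 (negPf x1) /= => /eqP x0; rewrite -[RHS]x0.
by apply: eq_bigr => i _; rewrite mulnC exprM.
Qed.

Lemma conj_root_unity e : (e <= K)%N -> ((om ^+ e)^*)%C = om ^+ (K - e).
Proof.
move=> eK; have o0 : om ^+ e != 0.
  by rewrite -normc_gt0 normc_root_unity.
apply: (mulfI o0); rewrite -exprD subnKC// root_unityX.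
apply: complex_ext; rewrite !cE.
  have := cnormsq (om ^+ e); rewrite normc_root_unity expr1n.
  by case: (om ^+ e) => a b /= ->; ring.
by case: (om ^+ e) => a b /=; ring.
Qed.

Lemma sum_Re_root_unity (y : R[i]) e : ~~ (K %| e)%N ->
  \sum_(i < K) complex.Re (y * om ^+ (i * e)) = 0.
Proof. by move=> Ke; rewrite -Re_sum -mulr_sumr sum_root_unity// mulr0. Qed.

(** Re w Re v is half of Re (w v) + Re (conj w v), and the conjugate of om^l is om^(K - l). The
    bound j + l < K excludes aliasing, so only j = l survives. *)
Lemma sum_Re_mul_root_unity (y : R[i]) (j l : nat) :
  (0 < j)%N -> (0 < l)%N -> (j + l < K)%N ->
  \sum_(i < K) complex.Re (om ^+ (i * l)) * complex.Re (y * om ^+ (i * j))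
  = if j == l then K%:R / 2 * complex.Re y else 0.
Proof.
move=> j0 l0 jlK.
have lK : (l <= K)%N by lia.
have -> : \sum_(i < K) complex.Re (om ^+ (i * l)) * complex.Re (y * om ^+ (i * j)) =
   2^-1 * \sum_(i < K) complex.Re (y * om ^+ (i * (j + l))) +
   2^-1 * \sum_(i < K) complex.Re (y * om ^+ (i * (j + (K - l)))).
  rewrite -mulrDr -big_split mulr_sumr; apply: eq_bigr => i _ /=.
  rewrite !mulnDr !exprD.
  have -> : om ^+ (i * (K - l)) = ((om ^+ (i * l))^*)%C.
    by rewrite [in LHS]mulnC [in RHS]mulnC !exprM rmorphXn /= conj_root_unity.
  case: (om ^+ (i * l)) => a b; case: (om ^+ (i * j)) => c d; case: y => p q.
  by rewrite !cE /=; field.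
rewrite sum_Re_root_unity ?mulr0 ?add0r; last by apply/negP => /dvdn_leq; lia.
case: eqP => [->|jl].
  rewrite subnKC// (eq_bigr (fun=> complex.Re y)); last first.
    by move=> i _; rewrite mulnC exprM root_unityX expr1n mulr1.
  by rewrite sumr_const card_ord -(mulr_natl _ K); ring.
rewrite sum_Re_root_unity ?mulr0//; apply/negP => /dvdnP [q qE].
(* The quotient 1 would mean j = l; the quotient 0 and those from 2 on are out of range. *)
case: q qE => [|[|q]]; [lia|lia|].
by rewrite !mulSn; lia.
Qed.

End RootsOfUnity.

Section LogSeries.
Context {R : realType}.
Implicit Types (y z : R[i]).

(** Partial sum of the series of -ln |1 - y|. Along a circle it is a trigonometric polynomial of
    degree J, to which discrete orthogonality applies exactly. *)
Definition logsum y (J : nat) : R := \sum_(j < J) complex.Re (y ^+ j.+1) / j.+1%:R.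

Lemma normc_1B_ge y (t : R) : normc y <= t -> 1 - t <= normc (1 - y).
Proof.
move=> yt; have := le_normcD (1 - y) y; rewrite subrK normc1; lra.
Qed.

(** Along the ray t y the error has derivative -Re ((t y)^J y / (1 - t y)), by the geometric series;
    the mean value theorem on [0, 1] then bounds it. *)
Lemma logsum_bound y (th : R) (J : nat) : normc y <= th -> th < 1 ->
  `|ln (normc (1 - y)) + logsum y J| <= th ^+ J.+1 / (1 - th).
Proof.
move=> yth th1; have th0 : 0 <= th := le_trans (normc_ge0 y) yth.
pose N (t : R) := (1 - t * complex.Re y) ^+ 2 + (t * complex.Im y) ^+ 2.
have NE t : N t = normc (1 - t%:C%C * y) ^+ 2.
  rewrite cnormsq /N; case: (y) => a b; rewrite !cE /=; ring.
have tle t : 0 <= t <= 1 -> normc (t%:C%C * y) <= th.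
  move=> /andP[t0 t1]; rewrite normcM normc_real ger0_norm//.
  by apply: le_trans yth; rewrite ler_piMl// normc_ge0.
have Np t : 0 <= t <= 1 -> 0 < normc (1 - t%:C%C * y).
  move=> /tle/normc_1B_ge; lra.
pose phi (t : R) := 2^-1 * ln (N t) + \sum_(j < J) complex.Re (y ^+ j.+1) / j.+1%:R * t ^+ j.+1.
pose dphi (t : R) := - complex.Re ((t%:C%C * y) ^+ J * y / (1 - t%:C%C * y)).
have dN (t : R) : 0 <= t <= 1 -> is_derive t 1 phi (dphi t).
  move=> t01.
  have N0 : 0 < N t by rewrite NE exprn_gt0// Np.
  have dNt : is_derive t 1 N (- (2 * complex.Re y * (1 - t * complex.Re y))
      + 2 * t * complex.Im y ^+ 2).
    apply: der_ext (derD (derX 2 (derB (der_cst 1 t)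
      (derM (der_id t) (der_cst (complex.Re y) t))))
      (derX 2 (derM (der_id t) (der_cst (complex.Im y) t)))) _ _ => //=.
    by ring.
  have dl := is_derive1_comp (is_derive1_ln N0) dNt.
  have ds : is_derive t 1 (fun t => \sum_(j < J) complex.Re (y ^+ j.+1) / j.+1%:R * t ^+ j.+1)
      (\sum_(j < J) complex.Re (y ^+ j.+1) * t ^+ j).
    apply: der_sum => j; apply: der_ext (derZ _ (der_pow t j.+1)) _ _ => //=.
    by rewrite mulrA divfK.
  have -> : dphi t = 2^-1 * ((N t)^-1 * (- (2 * complex.Re y * (1 - t * complex.Re y))
      + 2 * t * complex.Im y ^+ 2)) + \sum_(j < J) complex.Re (y ^+ j.+1) * t ^+ j.
    set w := t%:C%C * y.
    have w1 : 1 - w != 0 by rewrite -normc_gt0 Np.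
    have -> : \sum_(j < J) complex.Re (y ^+ j.+1) * t ^+ j = complex.Re (y * ((1 - w ^+ J) / (1 - w))).
      have -> : (1 - w ^+ J) / (1 - w) = \sum_(j < J) w ^+ j.
        by apply: (mulIf w1); rewrite divfK// -opprB subrX1 -mulNr opprB mulrC.
      rewrite mulr_sumr Re_sum; apply: eq_bigr => j _.
      rewrite /w exprMn mulrCA -exprS -rmorphXn cReM /= mul0r subr0 mulrC.
      by [].
    rewrite /dphi -/w.
    have -> : 2^-1 * ((N t)^-1 * (- (2 * complex.Re y * (1 - t * complex.Re y))
      + 2 * t * complex.Im y ^+ 2)) = - complex.Re (y / (1 - w)).
      move: N0; rewrite /w /N; case: (y) => a b /=.
      have -> : (1 - (t * a - 0 * b)) ^+ 2 + (0 - (t * b + 0 * a)) ^+ 2 =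
        (1 - t * a) ^+ 2 + (t * b) ^+ 2 by ring.
      by move=> N0; field; rewrite gt_eqF.
    rewrite -cReN -cReN -cReD; congr complex.Re; field.
    by [].
  by apply: derD => //; apply: derZ.
have [c c01 E] := der_MVT ler01 dN.
have -> : ln (normc (1 - y)) + logsum y J = phi 1 - phi 0.
  have -> : phi 0 = 0.
    rewrite /phi NE mul0r subr0 normc1 expr1n ln1 mulr0 add0r.
    by apply: big1 => j _; rewrite expr0n mulr0.
  rewrite subr0 /phi NE mul1r lnXn; last by have := normc_1B_ge yth; lra.
  rewrite -[ln _ *+ 2]mulr_natl mulKf//; congr (_ + _).
  by apply: eq_bigr => j _; rewrite expr1n mulr1.
rewrite E subr0 mulr1 /dphi normrN.
apply: le_trans (normr_Re _) _.
rewrite !normcM normcV normcX exprSr.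
have cth := tle _ c01; have := normc_1B_ge cth => h.
apply: ler_pM; rewrite ?mulr_ge0 ?exprn_ge0 ?invr_ge0 ?normc_ge0//.
  apply: ler_pM; rewrite ?exprn_ge0 ?normc_ge0//.
  by apply: lerXn2r; rewrite ?nnegrE ?normc_ge0.
by rewrite lef_pV2// posrE; lra.
Qed.

End LogSeries.

Section Harnack.
Context {R : realType}.

(* Poisson's kernel, truncated and discretized on the [K]-th roots of unity,
   evaluates a harmonic function at [x] from its values on the circle. *)
Let kernel (K J : nat) (b : R) (i : nat) : R :=
  2 * \sum_(l < J) b ^+ l.+1 *
    complex.Re (expi (2 * pi / K%:R) ^+ (i * l.+1)).

Let kernel_bound K J b i : 0 <= b < 1 -> `|kernel K J b i| <= 2 * b / (1 - b).
Proof.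
move=> /andP[b0 b1]; rewrite /kernel normrM ger0_norm// -[leRHS]mulrA ler_wpM2l//.
apply: (@le_trans _ _ (\sum_(l < J) b ^+ l.+1)).
  apply: le_trans (ler_norm_sum _ _ _) _; apply: ler_sum => l _.
  rewrite normrM ger0_norm ?exprn_ge0// ler_piMr ?exprn_ge0//.
  by apply: le_trans (normr_Re _) _; rewrite normcX normc_expi expr1n.
rewrite ler_pdivlMr ?subr_gt0//.
rewrite (eq_bigr (fun l : 'I_J => b * b ^+ l)); last by move=> l _; rewrite exprS.
rewrite -mulr_sumr -mulrA -[X in _ * (_ * X)]opprB mulrN [X in - X]mulrC -subrX1.
by rewrite ler_piMr// opprB gerBl exprn_ge0.
Qed.

Let sum_kernel K J b : (J < K)%N -> \sum_(i < K) kernel K J b i = 0.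
Proof.
move=> JK; have K0 : (0 < K)%N by lia.
rewrite -mulr_sumr exchange_big big1 ?mulr0// => l _.
rewrite -mulr_sumr (eq_bigr (fun i : 'I_K =>
   complex.Re (1 * expi (2 * pi / K%:R) ^+ (i * l.+1)))); last first.
  by move=> i _; rewrite mul1r.
rewrite sum_Re_root_unity ?mulr0//; apply/negP => /dvdn_leq.
by have := ltn_ord l; lia.
Qed.

Let sum_logsum K J (y : R[i]) : (J < K)%N ->
  \sum_(i < K) logsum (y * expi (2 * pi / K%:R) ^+ i) J = 0.
Proof.
move=> JK; have K0 : (0 < K)%N by lia.
rewrite exchange_big big1// => j _; rewrite -mulr_suml.
rewrite (eq_bigr (fun i : 'I_K =>
   complex.Re (y ^+ j.+1 * expi (2 * pi / K%:R) ^+ (i * j.+1)))); last first.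
  by move=> i _; rewrite exprMn exprM.
rewrite sum_Re_root_unity ?mul0r//; apply/negP => /dvdn_leq.
by have := ltn_ord j; lia.
Qed.

(** J + J < K keeps the sum of any two frequencies below K; the factor 2 of [kernel] cancels the 1/2
    of the orthogonality relation. *)
Let sum_kernel_logsum K J b (y : R[i]) : (J + J < K)%N ->
  \sum_(i < K) kernel K J b i * logsum (y * expi (2 * pi / K%:R) ^+ i) J =
  K%:R * logsum (b%:C%C * y) J.
Proof.
move=> JK; have K0 : (0 < K)%N by lia.
pose om : R[i] := expi (2 * pi / K%:R).
transitivity (\sum_(j < J) \sum_(l < J) 2 * b ^+ l.+1 / j.+1%:R *
   \sum_(i < K) complex.Re (om ^+ (i * l.+1)) * complex.Re (y ^+ j.+1 * om ^+ (i * j.+1))).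
  under eq_bigr => i _.
    rewrite /kernel /logsum mulr_sumr.
    under eq_bigr => j _.
      rewrite mulr_sumr mulr_suml.
      over.
    over.
  rewrite exchange_big /=; apply: eq_bigr => j _.
  rewrite exchange_big /=; apply: eq_bigr => l _.
  rewrite mulr_sumr; apply: eq_bigr => i _.
  by rewrite exprMn -exprM /om; ring.
rewrite /logsum mulr_sumr; apply: eq_bigr => j _.
rewrite (bigD1 j)//= [X in _ + X]big1 ?addr0; last first.
  move=> l lj; rewrite /om sum_Re_mul_root_unity//.
    by rewrite eqSS eq_sym (negPf (lj : val l != val j)) mulr0.
  by have := ltn_ord l; have := ltn_ord j; lia.
rewrite /om sum_Re_mul_root_unity ?eqxx//; last by have := ltn_ord j; lia.
by rewrite exprMn -rmorphXn cReM /= mul0r subr0; field.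
Qed.

(** The product is 1 at 0, so its logarithm has mean 0 over the circle. As [kernel] lacks the
    constant term, its total weight is 0: the value at x is also obtained from ln |P| - L, which is
    nonpositive on the circle, and a bound for the absolute value of the kernel is enough. *)
Lemma harnack (s : seq R[i]) (rho L x : R) : 0 < rho -> 0 <= x < rho ->
  (forall a, a \in s -> normc a * rho < 1) ->
  (forall z, normc z = rho -> ln (normc (\prod_(a <- s) (1 - a * z))) <= L) ->
  ln (normc (\prod_(a <- s) (1 - a * x%:C%C))) <= 2 * (x / rho) / (1 - x / rho) * L.
Proof.
move=> rho0 /andP[x0 xrho] srho sL.
(* Among finitely many factors there is a common bound th < 1, which makes the logarithmic series
   converge uniformly. *)
have [th [th0 th1 thP]] : exists th : R, [/\ 0 <= th, th < 1 &
    forall a, a \in s -> normc (rho%:C%C * a) <= th].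
  elim: s srho {sL} => [_|a s IH srho]; first by exists 0.
  have [|th [th0 th1 H]] := IH.
    by move=> c cs; apply: srho; rewrite inE cs orbT.
  exists (Num.max th (normc a * rho)); split; rewrite ?le_max ?th0// ?gt_max ?th1.
    by rewrite srho// inE eqxx.
  move=> c; rewrite inE => /orP[/eqP->|cs]; rewrite le_max.
    by rewrite normcM normc_real gtr0_norm// mulrC lexx orbT.
  by rewrite H.
set b := x / rho.
have b01 : 0 <= b < 1.
  by rewrite /b divr_ge0 ?(ltW rho0)//= ltr_pdivrMr// mul1r.
set B := 2 * b / (1 - b).
have B0 : 0 <= B by rewrite /B; case/andP: b01 => b0 b1; apply: divr_ge0; lra.
(* [ys] are the inverse roots, rescaled to the unit disc *)
pose H (z : R[i]) := \sum_(a <- s) ln (normc (1 - rho%:C%C * a * z)).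
have HE (z : R[i]) : normc z <= 1 ->
    ln (normc (\prod_(a <- s) (1 - a * (rho%:C%C * z)))) = H z.
  move=> z1; rewrite normc_prod /H.
  have pos (a : R[i]) : a \in s -> 0 < normc (1 - a * (rho%:C%C * z)).
    move=> /thP h; have : normc (rho%:C%C * a * z) <= th.
      by rewrite normcM; apply: le_trans h; rewrite ler_piMr ?normc_ge0.
    by move=> h'; have := normc_1B_ge h'; rewrite mulrCA mulrA; lra.
  elim: (s) pos => [_|a s' IH pos]; first by rewrite !big_nil ln1.
  rewrite !big_cons lnM ?posrE ?pos ?inE ?eqxx//; last first.
    by rewrite big_seq prodr_gt0// => c cs; rewrite pos// inE cs orbT.
  rewrite IH; last by move=> c cs; rewrite pos// inE cs orbT.
  by rewrite mulrCA mulrA.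
have HL (z : R[i]) : normc z = 1 -> H z <= L.
  by move=> z1; rewrite -HE ?z1// sL// normcM z1 mulr1 normc_real gtr0_norm.
have -> : x%:C%C = rho%:C%C * b%:C%C.
  by rewrite -rmorphM /b; congr real_complex_def; rewrite mulrC divfK ?gt_eqF.
rewrite HE; last by case/andP: b01 => b0 b1; rewrite normc_real ger0_norm// ltW.
(* the error of truncating the logarithmic series *)
pose E (J : nat) : R := (size s)%:R * (th ^+ J.+1 / (1 - th)).
pose G (J : nat) (z : R[i]) := - \sum_(a <- s) logsum (rho%:C%C * a * z) J.
have GE J (z : R[i]) : normc z <= 1 -> `|H z - G J z| <= E J.
  move=> z1; rewrite /H /G opprK -big_split /=.
  apply: le_trans (ler_norm_sum _ _ _) _.
  rewrite /E; apply: (@le_trans _ _ (\sum_(a <- s) (th ^+ J.+1 / (1 - th)))).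
    rewrite big_seq [leRHS]big_seq; apply: ler_sum => a /thP h.
    apply: logsum_bound => //; rewrite normcM; apply: le_trans h.
    by rewrite ler_piMr ?normc_ge0.
  by rewrite big_const_seq count_predT iter_addr_0 mulr_natl.
have key J : H b%:C%C <= B * L + (1 + 2 * B) * E J.
  (* The least number of nodes that resolves products of two frequencies up to J. *)
  pose K := (J + J).+1; have K0 : 0 < K%:R :> R by rewrite ltr0n.
  pose om : R[i] := expi (2 * pi / K%:R).
  have om1 i : normc (om ^+ i) = 1 by rewrite normcX normc_expi expr1n.
  have E1 : \sum_(i < K) G J (om ^+ i) = 0.
    rewrite sumrN exchange_big big1 ?oppr0// => a _.
    by rewrite sum_logsum// /K; lia.
  have E2 : \sum_(i < K) kernel K J b i * G J (om ^+ i) = K%:R * G J b%:C%C.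
    rewrite /G (eq_bigr (fun i : 'I_K => - \sum_(a <- s)
        kernel K J b i * logsum (rho%:C%C * a * om ^+ i) J)); last first.
      by move=> i _; rewrite mulrN mulr_sumr.
    rewrite sumrN exchange_big mulrN mulr_sumr; congr (- _).
    by apply: eq_bigr => a _; rewrite sum_kernel_logsum ?(mulrC b%:C%C)// /K; lia.
  have E3 : K%:R * G J b%:C%C <= K%:R * (B * (L + E J) + B * E J).
    rewrite -E2; rewrite (_ : \sum_(i < K) _ =
      \sum_(i < K) (kernel K J b i * (H (om ^+ i) - L)
         + kernel K J b i * (G J (om ^+ i) - H (om ^+ i)))); last first.
      rewrite -[LHS]addr0 -[X in _ + X](mulr0 (- L)) -[X in _ * X](@sum_kernel K J b); last by rewrite /K; lia.
      by rewrite mulr_sumr -big_split; apply: eq_bigr => i _ /=; ring.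
    apply: (@le_trans _ _ (\sum_(i < K) (B * (L - H (om ^+ i)) + B * E J))).
      apply: ler_sum => i _; apply: lerD.
        apply: le_trans (ler_norm _) _; rewrite normrM ler_pM ?kernel_bound//.
        by rewrite distrC ger0_norm// subr_ge0 HL.
      apply: le_trans (ler_norm _) _; rewrite normrM ler_pM ?kernel_bound//.
      by rewrite distrC GE// om1.
    apply: (@le_trans _ _ (\sum_(i < K) (B * (L + E J) + B * E J - B * G J (om ^+ i)))).
      apply: ler_sum => i _; have := GE J (om ^+ i); rewrite om1 lexx => /(_ isT).
      rewrite ler_norml => /andP[h _]; rewrite -subr_ge0.
      set e := E J in h *; set g := G J _ in h *; set hh := H _ in h *.
      have -> : B * (L + e) + B * e - B * g - (B * (L - hh) + B * e) = B * (hh - g + e) by ring.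
      by rewrite mulr_ge0//; lra.
    rewrite sumrB -mulr_sumr E1 mulr0 subr0 sumr_const card_ord.
    by rewrite mulr_natl.
  rewrite ler_pM2l// in E3.
  have := GE J b%:C%C; case/andP: b01 => b0 b1.
  rewrite normc_real ger0_norm// (ltW b1) => /(_ isT); rewrite ler_norml => /andP[_ h].
  have -> : B * L + (1 + 2 * B) * E J = B * (L + E J) + B * E J + E J by ring.
  lra.
have cvgE : (fun J => B * L + (1 + 2 * B) * E J) @ \oo --> B * L.
  rewrite -[X in _ --> X]addr0 -(mulr0 (1 + 2 * B)); apply: cvgD; first exact: cvg_cst.
  apply: cvgMr; rewrite /E -(mulr0 (size s)%:R); apply: cvgMr.
  rewrite -(mul0r (1 - th)^-1); apply: cvgMl.
  rewrite (cvg_shiftS (fun J => th ^+ J)); apply: cvg_expr; rewrite ger0_norm//.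
apply: (ler_cvg_to (cvg_cst _) cvgE); exact: nearW.
Qed.

End Harnack.

(** * The differential equation on the line *)

Section ComplexLimits.
Context {R : realType}.
Implicit Types (u v : nat -> R[i]) (l k : R[i]).

(** Written exactly as the convergence in [real_analytic], to which it unfolds. *)
Definition ccvg u l := (fun N => normc (u N - l)) @ \oo --> (0 : R).

Lemma ccvg_squeeze u l (e : nat -> R) : (forall N, normc (u N - l) <= e N) ->
  e @ \oo --> (0 : R) -> ccvg u l.
Proof.
move=> h e0; apply: (squeeze_cvgr _ (cvg_cst 0) e0).
by apply: nearW => N; rewrite h normc_ge0.
Qed.

Lemma ccvgRI u l : (fun N => complex.Re (u N)) @ \oo --> complex.Re l ->
  (fun N => complex.Im (u N)) @ \oo --> complex.Im l -> ccvg u l.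
Proof.
move=> hr hi; apply: (@ccvg_squeeze _ _ (fun N =>
  `|complex.Re (u N) - complex.Re l| + `|complex.Im (u N) - complex.Im l|)).
  by move=> N; apply: le_trans (normc_le _) _; rewrite !cE.
rewrite -[0]addr0; apply: cvgD.
  by rewrite -(normr0 R) -(subrr (complex.Re l)); apply: cvg_norm; apply: cvgB => //; apply: cvg_cst.
by rewrite -(normr0 R) -(subrr (complex.Im l)); apply: cvg_norm; apply: cvgB => //; apply: cvg_cst.
Qed.

Lemma ccvg_Re u l : ccvg u l -> (fun N => complex.Re (u N)) @ \oo --> complex.Re l.
Proof.
move=> h; apply/cvgrPdist_le => e e0.
move/cvgr0_norm_le : h => /(_ _ e0); apply: filterS => N; rewrite ger0_norm ?normc_ge0//.
by apply: le_trans; rewrite distrC -cReN -cReD normr_Re.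
Qed.

Lemma ccvg_Im u l : ccvg u l -> (fun N => complex.Im (u N)) @ \oo --> complex.Im l.
Proof.
move=> h; apply/cvgrPdist_le => e e0.
move/cvgr0_norm_le : h => /(_ _ e0); apply: filterS => N; rewrite ger0_norm ?normc_ge0//.
by apply: le_trans; rewrite distrC -cImN -cImD normr_Im.
Qed.

Lemma ccvg_le u l e : ccvg u l -> (\forall N \near \oo, normc (u N) <= e) -> normc l <= e.
Proof.
move=> h ue.
have : (fun N => e + normc (u N - l)) @ \oo --> e + 0 by apply: cvgD => //; apply: cvg_cst.
rewrite addr0 => h'; apply: (ler_cvg_to (cvg_cst _) h').
apply: filterS ue => N ue; have := le_normcD (u N) (- (u N - l)).
by rewrite normcN opprB addrC subrK => /le_trans; apply; rewrite lerD2r.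
Qed.

Lemma ccvg_uniq u l k : ccvg u l -> ccvg u k -> l = k.
Proof.
move=> ul uk; apply: complex_ext.
  by rewrite -(cvg_lim _ (ccvg_Re ul))// -(cvg_lim _ (ccvg_Re uk)).
by rewrite -(cvg_lim _ (ccvg_Im ul))// -(cvg_lim _ (ccvg_Im uk)).
Qed.

Lemma ccvg_cst l : ccvg (fun=> l) l.
Proof. by rewrite /ccvg; under eq_fun do rewrite subrr normc0; apply: cvg_cst. Qed.

Lemma ccvgD u v l k : ccvg u l -> ccvg v k -> ccvg (fun N => u N + v N) (l + k).
Proof.
move=> ul vk; apply: (@ccvg_squeeze _ _ (fun N => normc (u N - l) + normc (v N - k))).
  by move=> N; rewrite opprD addrACA le_normcD.
by rewrite -[0]addr0; apply: cvgD.
Qed.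

Lemma ccvgZ u l k : ccvg u l -> ccvg (fun N => k * u N) (k * l).
Proof.
move=> ul; apply: (@ccvg_squeeze _ _ (fun N => normc k * normc (u N - l))).
  by move=> N; rewrite -mulrBr normcM.
by rewrite -(mulr0 (normc k)); apply: cvgMr.
Qed.

Lemma ccvg_shift d u l : ccvg (fun N => u (N + d)%N) l -> ccvg u l.
Proof. by rewrite /ccvg => h; rewrite -(cvg_shiftn d). Qed.

End ComplexLimits.

Section StrongRecursion.
Variables (A : Type) (F : (nat -> A) -> nat -> A) (g : nat -> A).
Hypothesis F_local : forall c d k, (forall j, (j < k)%N -> c j = d j) -> F c k = F d k.

(** Since [F] at [k] looks only below [k], entry [k] of [iter p F g] is stable as soon as p > k;
    hence [k.+1] rounds. *)
Definition strong_rec (k : nat) : A := iter k.+1 F g k.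

Let iter_stable p q k : (k < p)%N -> (k < q)%N -> iter p F g k = iter q F g k.
Proof.
elim: p q k => [//|p IH] [//|q] k kp kq /=.
by apply: F_local => j jk; apply: IH; lia.
Qed.

Lemma strong_recE k : strong_rec k = F strong_rec k.
Proof. by rewrite {1}/strong_rec iterS; apply: F_local => j jk; apply: iter_stable. Qed.

End StrongRecursion.

(** The coefficients of s^d times the series with coefficients [c]. *)
Definition shiftseq (A : nmodType) (d : nat) (c : nat -> A) (k : nat) : A :=
  if (d <= k)%N then c (k - d)%N else 0.

Section Coefficients.
Variable n : nat.

(* The power series solutions [f] of [f'' = (z - n.+1 s ^+ n) ^+ 2 f]. *)
Definition ocoef_step (A : comUnitRingType) (al be z : A) (c : nat -> A) (k : nat) : A :=
  match k with
  | 0 => al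
  | 1 => be
  | k'.+2 => (z ^+ 2 * c k' - 2%:R * n.+1%:R * z * shiftseq n c k'
              + n.+1%:R ^+ 2 * shiftseq (n + n) c k') / (k'.+2 * k'.+1)%:R
  end.

(** The ring varies: complex numbers for the solutions, [{poly R[i]}] with the indeterminate as z
    for truncations that are polynomials in z, and the reals to see that real data give real
    solutions. *)
Definition ocoef (A : comUnitRingType) (al be z : A) : nat -> A :=
  strong_rec (ocoef_step al be z) (fun=> 0).

Lemma ocoefE (A : comUnitRingType) (al be z : A) k :
  ocoef al be z k = ocoef_step al be z (ocoef al be z) k.
Proof.
apply: strong_recE => c d [|[|j]] //= cd; rewrite /shiftseq cd ?leqnSn//.
by rewrite (cd (j - n)%N) ?(cd (j - (n + n))%N)//; lia.
Qed.

Lemma ocoef_morph (A B : comUnitRingType) (phi : {rmorphism A -> B}) (al be z : A) k :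
  (forall j, (j.+1%:R : A) \is a GRing.unit) ->
  phi (ocoef al be z k) = ocoef (phi al) (phi be) (phi z) k.
Proof.
move=> uA; elim/ltn_ind: k => -[|[|k]] IH; rewrite !ocoefE//=.
have ph d : phi (shiftseq d (ocoef al be z) k) = shiftseq d (ocoef (phi al) (phi be) (phi z)) k.
  by rewrite /shiftseq; case: ifP => dk; rewrite ?rmorph0// IH//; lia.
rewrite rmorphM rmorphV; last by rewrite natrM unitrM !uA.
by rewrite rmorph_nat rmorphD rmorphB !rmorphM /= !ph IH ?rmorph_nat ?rmorphXn//; lia.
Qed.

Lemma ocoef_lin (A : comUnitRingType) (a b z : A) k :
  ocoef a b z k = a * ocoef 1 0 z k + b * ocoef 0 1 z k.
Proof.
elim/ltn_ind: k => -[|[|k]] IH; rewrite !ocoefE /=; try by ring.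
have ph d : shiftseq d (ocoef a b z) k =
   a * shiftseq d (ocoef 1 0 z) k + b * shiftseq d (ocoef 0 1 z) k.
  by rewrite /shiftseq; case: ifP => dk; rewrite ?mulr0 ?addr0// IH//; lia.
by rewrite !ph IH; [ring|lia].
Qed.

(** For odd n, replacing s by -s turns (z - m s^n)^2 into (-z - m s^n)^2: reflection exchanges z
    with -z and negates the initial slope. *)
Lemma ocoef_opp (A : comUnitRingType) (a b z : A) k : odd n ->
  ocoef a (- b) (- z) k = (-1) ^+ k * ocoef a b z k.
Proof.
move=> on; elim/ltn_ind: k => -[|[|k]] IH; rewrite !ocoefE /=; try by ring.
have ph d : (d <= k)%N -> shiftseq d (ocoef a (- b) (- z)) k =
   (-1) ^+ k * (-1) ^+ d * shiftseq d (ocoef a b z) k.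
  move=> dk; rewrite /shiftseq dk IH; last by lia.
  congr (_ * _); rewrite -[in RHS](subnK dk) exprD -mulrA -exprD addnn -muln2 mulnC exprM.
  by rewrite sqrrN expr1n expr1n mulr1.
have ph1 : shiftseq n (ocoef a (- b) (- z)) k = - ((-1) ^+ k * shiftseq n (ocoef a b z) k).
  have [nk|nk] := leqP n k; last by rewrite /shiftseq leqNgt nk mulr0 oppr0.
  by rewrite ph// -(signr_odd _ n) on expr1 mulrN1 mulNr.
have ph2 : shiftseq (n + n) (ocoef a (- b) (- z)) k = (-1) ^+ k * shiftseq (n + n) (ocoef a b z) k.
  have [nk|nk] := leqP (n + n) k; last by rewrite /shiftseq leqNgt nk mulr0.
  by rewrite ph// -(signr_odd _ (n + n)) oddD on expr0 mulr1.
have -> : (-1) ^+ k.+2 = (-1) ^+ k :> A by rewrite !exprS; ring.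
by rewrite ph1 ph2 IH//; ring.
Qed.

End Coefficients.

Lemma sum_ord_mono (R : numDomainType) (a : nat -> R) p q :
  (forall k, 0 <= a k) -> (p <= q)%N -> \sum_(k < p) a k <= \sum_(k < q) a k.
Proof.
move=> a0 /subnK <-; elim: (q - p)%N => [|d IH]; first by rewrite add0n.
by rewrite addSn big_ord_recr /=; apply: le_trans IH _; rewrite lerDl.
Qed.

Section ShiftSums.
Variable A : comNzRingType.

Lemma sum_shiftseq (d N : nat) (c : nat -> A) (s : A) :
  \sum_(k < N) shiftseq d c k * s ^+ k = s ^+ d * \sum_(k < N - d) c k * s ^+ k.
Proof.
elim: N => [|N IH]; first by rewrite sub0n !big_ord0 mulr0.
rewrite big_ord_recr /= IH /shiftseq; case: leqP => dN; last first.
  by rewrite mul0r addr0; have -> : (N - d = N.+1 - d)%N by lia.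
rewrite subSn// big_ord_recr /= mulrDr; congr (_ + _).
by rewrite -{2}(subnKC dN) exprD; ring.
Qed.

End ShiftSums.

Section Majorant.
Context {R : realType}.
Variables (n : nat) (r : R).
Hypothesis r0 : 0 <= r.

(* The coefficients of [expR (r * s + s ^+ n.+1)], which solves
   [H' = (r + n.+1 s ^+ n) H], whence [H'' >= (r + n.+1 s ^+ n) ^+ 2 H]
   coefficientwise. *)
Let maj_step (h : nat -> R) (k : nat) : R :=
  if k is k'.+1 then (r * h k' + n.+1%:R * shiftseq n h k') / k'.+1%:R else 1.

Definition maj : nat -> R := strong_rec maj_step (fun=> 0).

Let majE k : maj k = maj_step maj k.
Proof.
apply: strong_recE => c d [|j] //= cd; rewrite /shiftseq cd//.
by rewrite (cd (j - n)%N)//; lia.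
Qed.

Let majS k : k.+1%:R * maj k.+1 = r * maj k + n.+1%:R * shiftseq n maj k.
Proof. by rewrite majE /= mulrC divfK. Qed.

Lemma maj_ge0 k : 0 <= maj k.
Proof.
elim/ltn_ind: k => -[|k] IH; rewrite majE//=.
rewrite divr_ge0// addr_ge0// mulr_ge0// ?IH// /shiftseq; case: ifP => // _.
by rewrite IH//; lia.
Qed.

Let shift_maj_ge0 d k : 0 <= shiftseq d maj k.
Proof. by rewrite /shiftseq; case: ifP => // _; exact: maj_ge0. Qed.

Lemma maj0 : maj 0 = 1.
Proof. by rewrite majE. Qed.

Lemma maj1_ge : r <= maj 1.
Proof. by rewrite majE /= divr1 maj0 mulr1 lerDl mulr_ge0. Qed.

(** H'' = (r + m s^n)^2 H + m n s^{n-1} H with m = n + 1, and the last term has nonnegative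
    coefficients. *)
Lemma maj_ge2 k : r ^+ 2 * maj k + 2 * n.+1%:R * r * shiftseq n maj k +
  n.+1%:R ^+ 2 * shiftseq (n + n) maj k <= (k.+2 * k.+1)%:R * maj k.+2.
Proof.
have -> : (k.+2 * k.+1)%:R * maj k.+2 = r * (k.+1%:R * maj k.+1) +
    n.+1%:R * (shiftseq n maj k.+1 * k.+1%:R).
  by rewrite natrM mulrAC (majS k.+1); ring.
rewrite (majS k).
(* The term m n s^{n-1} H is dropped here, through (k - n) + 1 <= k + 1. *)
have h : r * shiftseq n maj k + n.+1%:R * shiftseq (n + n) maj k <=
   shiftseq n maj k.+1 * k.+1%:R.
  have [nk|kn] := leqP n k; last first.
    rewrite {1 2}/shiftseq leqNgt kn /= ifF; last by lia.
    by rewrite !mulr0 addr0 mulr_ge0.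
  rewrite /shiftseq nk leqW// subSn// [leRHS]mulrC.
  apply: (@le_trans _ _ ((k - n).+1%:R * maj (k - n).+1)).
    rewrite (majS (k - n)) /shiftseq lerD2l; case: ifP => [nnk|_]; last first.
      by rewrite mulr0 mulr_ge0//; case: ifP => // _; apply: maj_ge0.
    by rewrite ifT ?subnDA//; lia.
  by rewrite ler_wpM2r ?maj_ge0// ler_nat; lia.
have h2 := ler_wpM2l (ler0n R n.+1) h; nra.
Qed.

(** For s >= 0 the partial sum H obeys H' <= (r + m s^n) H, because the recursion holds termwise and
    the right side has extra nonnegative terms. So H divided by the exponential does not
    increase. *)
Lemma maj_sum_le (s : R) N : 0 <= s ->
  \sum_(k < N) maj k * s ^+ k <= expR (r * s + s ^+ n.+1).
Proof.
move=> s0; pose H (t : R) := \sum_(k < N) maj k * t ^+ k.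
pose dH (t : R) := \sum_(k < N) maj k * (k%:R * t ^+ k.-1).
have HdH (t : R) : is_derive t 1 H (dH t).
  by apply: der_sum => k; apply: derZ; apply: der_pow.
pose E (t : R) := expR (- (r * t + t ^+ n.+1)).
have EdE (t : R) : is_derive t 1 E (E t * - (r + n.+1%:R * t ^+ n)).
  apply: der_exp; apply: derN; apply: derD; last exact: der_pow.
  by apply: der_ext (derZ r (der_id t)) _ _ => //; rewrite mulr1.
have dH_le (t : R) : 0 <= t -> dH t <= (r + n.+1%:R * t ^+ n) * H t.
  move=> t0; rewrite /dH; case: N @H {dH HdH} => [|M] H.
    by rewrite /H !big_ord0 mulr0.
  rewrite big_ord_recl mul0r mulr0 add0r.
  rewrite (eq_bigr (fun k : 'I_M => r * (maj k * t ^+ k) + n.+1%:R * (shiftseq n maj k * t ^+ k))); last first.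
    by move=> k _ /=; rewrite mulrA (mulrC (maj _)) majS mulrDl !mulrA.
  rewrite big_split /= -!mulr_sumr sum_shiftseq mulrDl; apply: lerD.
    by rewrite ler_wpM2l// /H big_ord_recr /= lerDl mulr_ge0 ?maj_ge0 ?exprn_ge0.
  rewrite -mulrA ler_wpM2l// ler_wpM2l ?exprn_ge0// /H.
  apply: (@sum_ord_mono _ (fun k => maj k * t ^+ k)); last by lia.
  by move=> k; rewrite mulr_ge0 ?maj_ge0// exprn_ge0.
have : - (E 0 * H 0) <= - (E s * H s).
  apply: (@der_ge0_le _ (fun t => - (E t * H t))
     (fun t => - (E t * - (r + n.+1%:R * t ^+ n) * H t + E t * dH t))) => //.
    by move=> t _; apply: derN; apply: derM.
  move=> t /andP[t0 _]; rewrite mulrN mulNr opprD opprK -mulrA -mulrBr.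
  by rewrite mulr_ge0 ?expR_ge0// subr_ge0 dH_le.
rewrite lerN2 => h.
have H0 : H 0 <= 1.
  rewrite /H; case: (N) => [|M]; first by rewrite big_ord0.
  rewrite big_ord_recl big1 => [|k _]; last by rewrite expr0n mulr0.
  by rewrite majE mul1r addr0.
have : E s * H s <= 1.
  apply: le_trans h _; rewrite /E mulr0 expr0n addr0 oppr0 expR0 mul1r//.
by rewrite /E expRN mulrC ler_pdivrMr ?expR_gt0// mul1r.
Qed.

End Majorant.

(** * Entire power series with complex coefficients *)

Section EntireSeries.
Context {R : realType}.
Implicit Types (c : nat -> R[i]) (s : R).

Definition cpsum c s (N : nat) : R[i] := \sum_(k < N) c k * (s ^+ k)%:C%C.

Definition cser c s : R[i] :=
  (limn (pseries (fun k => complex.Re (c k)) s)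
   +i* limn (pseries (fun k => complex.Im (c k)) s))%C.

Definition entire c : Prop := forall s, 0 <= s ->
  exists B, forall N, \sum_(k < N) normc (c k) * s ^+ k <= B.

Lemma bounded_series_cvg (u : nat -> R) B : (forall N, \sum_(k < N) `|u k| <= B) ->
  cvgn (series u).
Proof.
move=> uB; apply: normed_cvg; apply: nondecreasing_is_cvgn.
  apply/nondecreasing_seqP => N; rewrite /normed_series_of /series /= big_nat_recr//=.
  by rewrite lerDl.
by exists B => _ [N _ <-]; rewrite /normed_series_of /series /= big_mkord.
Qed.

Lemma entire_cvg_Re c s : entire c -> cvgn (pseries (fun k => complex.Re (c k)) s).
Proof.
move=> /(_ `|s| (normr_ge0 s)) [B cB]; apply: (@bounded_series_cvg _ B) => N.
apply: le_trans (cB N); apply: ler_sum => k _.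
by rewrite normrM normrX ler_wpM2r ?exprn_ge0// normr_Re.
Qed.

Lemma entire_cvg_Im c s : entire c -> cvgn (pseries (fun k => complex.Im (c k)) s).
Proof.
move=> /(_ `|s| (normr_ge0 s)) [B cB]; apply: (@bounded_series_cvg _ B) => N.
apply: le_trans (cB N); apply: ler_sum => k _.
by rewrite normrM normrX ler_wpM2r ?exprn_ge0// normr_Im.
Qed.

Lemma Re_cpsum c s N : complex.Re (cpsum c s N) = pseries (fun k => complex.Re (c k)) s N.
Proof.
rewrite /cpsum Re_sum /pseries /series /= big_mkord; apply: eq_bigr => k _.
by rewrite cReM /= mulr0 subr0.
Qed.

Lemma Im_cpsum c s N : complex.Im (cpsum c s N) = pseries (fun k => complex.Im (c k)) s N.
Proof.
rewrite /cpsum Im_sum /pseries /series /= big_mkord; apply: eq_bigr => k _.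
by rewrite cImM /= mulr0 add0r.
Qed.

Lemma cser_cvg c s : entire c -> ccvg (cpsum c s) (cser c s).
Proof.
move=> ec; apply: ccvgRI.
  by under eq_fun do rewrite Re_cpsum; exact: entire_cvg_Re.
by under eq_fun do rewrite Im_cpsum; exact: entire_cvg_Im.
Qed.

Definition dseq c (k : nat) : R[i] := k.+1%:R * c k.+1.

Lemma entire_dseq c : entire c -> entire (dseq c).
Proof.
(* k + 1 <= 2^(k+1) absorbs the factor from differentiation into a larger radius, and s + 1 >= 1
   pays for the missing power of s. *)
move=> ec s s0; pose S := 2 * (s + 1).
have S0 : 0 <= S by rewrite mulr_ge0// addr_ge0.
have [B cB] := ec S S0; exists B => N; apply: le_trans (cB N.+1).
rewrite big_ord_recl /= -[leLHS]add0r; apply: lerD.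
  by rewrite mulr_ge0 ?normc_ge0.
apply: ler_sum => k _; rewrite /dseq normcM normc_nat.
rewrite mulrAC mulrC ler_wpM2l ?normc_ge0//.
apply: (@le_trans _ _ (2 ^+ k.+1 * (s + 1) ^+ k.+1)).
  apply: ler_pM => //; first by rewrite exprn_ge0.
    by rewrite -natrX ler_nat ltnW// ltn_expl.
  rewrite exprS; apply: (@le_trans _ _ (1 * (s + 1) ^+ k)).
    by rewrite mul1r lerXn2r ?nnegrE ?addr_ge0// lerDl.
  by rewrite ler_wpM2r ?exprn_ge0 ?addr_ge0// lerDr.
by rewrite -exprMn.
Qed.

Lemma dseq_Re c : (fun k => complex.Re (dseq c k)) = pseries_diffs (fun k => complex.Re (c k)).
Proof.
apply/funext => k; rewrite /dseq /pseries_diffs -(rmorph_nat (real_complex R)).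
by rewrite cReM /= mul0r subr0.
Qed.

Lemma dseq_Im c : (fun k => complex.Im (dseq c k)) = pseries_diffs (fun k => complex.Im (c k)).
Proof.
apply/funext => k; rewrite /dseq /pseries_diffs -(rmorph_nat (real_complex R)).
by rewrite cImM /= mul0r addr0.
Qed.

Definition cderiv (f : R -> R[i]) s (f' : R[i]) : Prop :=
  is_derive s 1 (fun t => complex.Re (f t)) (complex.Re f') /\
  is_derive s 1 (fun t => complex.Im (f t)) (complex.Im f').

Lemma cser_deriv c s : entire c -> cderiv (cser c) s (cser (dseq c) s).
Proof.
move=> ec; have ed := entire_dseq ec; have edd := entire_dseq ed.
have sK : `|s| < `|(`|s| + 1)| by rewrite [ltRHS]ger0_norm ?addr_ge0// ltrDl.
split; rewrite /cser /=.
  rewrite dseq_Re; apply: (@pseries_snd_diffs _ _ (`|s| + 1)) => //.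
  - exact: entire_cvg_Re.
  - by rewrite -dseq_Re; apply: entire_cvg_Re.
  - by rewrite -dseq_Re -dseq_Re; apply: entire_cvg_Re.
rewrite dseq_Im; apply: (@pseries_snd_diffs _ _ (`|s| + 1)) => //.
- exact: entire_cvg_Im.
- by rewrite -dseq_Im; apply: entire_cvg_Im.
- by rewrite -dseq_Im -dseq_Im; apply: entire_cvg_Im.
Qed.

Lemma cpsum_tail c s (h : nat -> R) N M : (forall k, normc (c k) <= h k) -> (N <= M)%N ->
  normc (cpsum c s M - cpsum c s N) <= \sum_(k < M) h k * `|s| ^+ k - \sum_(k < N) h k * `|s| ^+ k.
Proof.
move=> ch /subnK <-; elim: (M - N)%N => [|d IH]; first by rewrite add0n !subrr normc0.
rewrite addSn /cpsum !big_ord_recr /= addrAC [leRHS]addrAC.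
apply: le_trans (le_normcD _ _) _; apply: lerD => //.
by rewrite normcM normc_real normrX ler_wpM2r ?exprn_ge0.
Qed.

Lemma cser_tail c s (h : nat -> R) N e : entire c -> (forall k, normc (c k) <= h k) ->
  (forall M, \sum_(k < M) h k * `|s| ^+ k - \sum_(k < N) h k * `|s| ^+ k <= e) ->
  normc (cser c s - cpsum c s N) <= e.
Proof.
move=> ec ch he.
have := ccvgD (cser_cvg s ec) (ccvg_cst (- cpsum c s N)); move/ccvg_le; apply.
near=> M; apply: le_trans (he M); apply: cpsum_tail => //.
by near: M; exact: nbhs_infty_ge.
Unshelve. all: by end_near. Qed.

Lemma cser_lin (a b : R[i]) c1 c2 c s : entire c1 -> entire c2 -> entire c ->
  (forall k, c k = a * c1 k + b * c2 k) -> cser c s = a * cser c1 s + b * cser c2 s.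
Proof.
move=> e1 e2 ec E; apply: ccvg_uniq (cser_cvg s ec) _.
have -> : cpsum c s = (fun N => a * cpsum c1 s N + b * cpsum c2 s N).
  apply/funext => N; rewrite /cpsum !mulr_sumr -big_split; apply: eq_bigr => k _ /=.
  by rewrite E; ring.
by apply: ccvgD; apply: ccvgZ; apply: cser_cvg.
Qed.

Lemma entire_lin (a b : R[i]) c1 c2 c : entire c1 -> entire c2 ->
  (forall k, c k = a * c1 k + b * c2 k) -> entire c.
Proof.
move=> e1 e2 E s s0; have [B1 h1] := e1 s s0; have [B2 h2] := e2 s s0.
exists (normc a * B1 + normc b * B2) => N.
apply: (@le_trans _ _ (normc a * (\sum_(k < N) normc (c1 k) * s ^+ k) +
   normc b * (\sum_(k < N) normc (c2 k) * s ^+ k))).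
  rewrite !mulr_sumr -big_split; apply: ler_sum => k _ /=.
  rewrite E !mulrA -mulrDl ler_wpM2r ?exprn_ge0// -!normcM; exact: le_normcD.
by apply: lerD; rewrite ler_wpM2l ?normc_ge0.
Qed.

Lemma shiftseqE (d : nat) c N s : cpsum (shiftseq d c) s (N + d)%N = (s ^+ d)%:C%C * cpsum c s N.
Proof.
rewrite /cpsum (eq_bigr (fun k : 'I_(N + d) => shiftseq d c k * (s%:C%C) ^+ k)); last first.
  by move=> k _; rewrite rmorphXn.
rewrite sum_shiftseq addnK -rmorphXn; congr (_ * _); apply: eq_bigr => k _.
by rewrite rmorphXn.
Qed.

Lemma entire_shiftseq d c : entire c -> entire (shiftseq d c).
Proof.
move=> ec s s0; have [B h] := ec s s0; exists (s ^+ d * B) => N.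
rewrite (eq_bigr (fun k : 'I_N => shiftseq d (fun k => normc (c k)) k * s ^+ k)); last first.
  by move=> k _; rewrite /shiftseq; case: ifP => // _; rewrite normc0.
by rewrite sum_shiftseq ler_wpM2l ?exprn_ge0.
Qed.

Lemma cser_shiftseq d c s : entire c -> cser (shiftseq d c) s = (s ^+ d)%:C%C * cser c s.
Proof.
move=> ec; apply: ccvg_uniq (cser_cvg s (entire_shiftseq d ec)) _.
apply: (@ccvg_shift _ d); under eq_fun do rewrite shiftseqE.
by apply: ccvgZ; apply: cser_cvg.
Qed.

Lemma cser_at0 c : entire c -> cser c 0 = c 0%N.
Proof.
move=> ec; apply: ccvg_uniq (cser_cvg 0 ec) _; apply: (@ccvg_shift _ 1).
have -> : (fun N => cpsum c 0 (N + 1)) = (fun=> c 0%N); last exact: ccvg_cst.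
apply/funext => N; rewrite addn1 /cpsum big_ord_recl big1 => [|k _].
  by rewrite expr0 mulr1 addr0.
by rewrite expr0n mulr0.
Qed.

End EntireSeries.

Section Solutions.
Context {R : realType}.
Variable n : nat.
Implicit Types (a b z : R[i]) (s r : R).

Lemma ocoef_le_maj a b z r k : 1 <= r -> normc a <= 1 -> normc b <= 1 ->
  normc z <= r -> normc (ocoef n a b z k) <= maj n r k.
Proof.
move=> r1 a1 b1 zr; have r0 : 0 <= r by lra.
elim/ltn_ind: k => -[|[|k]] IH; rewrite ocoefE /=.
- by rewrite maj0.
- by apply: le_trans (maj1_ge _ r0); lra.
have sh d : normc (shiftseq d (ocoef n a b z) k) <= shiftseq d (maj n r) k.
  by rewrite /shiftseq; case: ifP => dk; [apply: IH; lia|rewrite normc0].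
rewrite normcM normcV normc_nat ler_pdivrMr// [leRHS]mulrC.
apply: le_trans (maj_ge2 n r0 k).
apply: le_trans (le_normcD _ _) _; apply: lerD.
  apply: le_trans (ler_normcB _ _) _; rewrite (normcM (z ^+ 2)) normcX (normcM (_ * _)) (normcM (_ * _)) (normcM 2%:R) !normc_nat.
  apply: lerD.
    by rewrite ler_pM ?exprn_ge0 ?normc_ge0 ?IH// lerXn2r ?nnegrE ?normc_ge0.
  apply: ler_pM => //; rewrite ?mulr_ge0 ?normc_ge0//.
  by rewrite ler_wpM2l// mulr_ge0.
by rewrite normcM normcX normc_nat ler_wpM2l// exprn_ge0.
Qed.

Let rz z : R := 1 + normc z.

Lemma entire_ocoef a b z : entire (ocoef n a b z).
Proof.
have r1 : 1 <= rz z by rewrite lerDl normc_ge0.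
have e a' b' : normc a' <= 1 -> normc b' <= 1 -> entire (ocoef n a' b' z).
  move=> a1 b1 s s0; exists (expR (rz z * s + s ^+ n.+1)) => N.
  have r0 : 0 <= rz z by lra.
  apply: le_trans (maj_sum_le n r0 N s0); apply: ler_sum => k _.
  by rewrite ler_wpM2r ?exprn_ge0 ?ocoef_le_maj// lerDr.
by apply: (entire_lin (e 1 0 _ _) (e 0 1 _ _) (ocoef_lin n a b z)); rewrite ?normc0 ?normc1.
Qed.

Definition sol a b z : R -> R[i] := cser (ocoef n a b z).
Definition dsol a b z : R -> R[i] := cser (dseq (ocoef n a b z)).

Lemma sol_0 a b z : sol a b z 0 = a.
Proof. by rewrite /sol cser_at0 ?ocoefE//; exact: entire_ocoef. Qed.

Lemma dsol_0 a b z : dsol a b z 0 = b.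
Proof.
by rewrite /dsol cser_at0 /dseq ?ocoefE ?mul1r//; apply: entire_dseq; exact: entire_ocoef.
Qed.

Lemma sol_lin a b z s : sol a b z s = a * sol 1 0 z s + b * sol 0 1 z s.
Proof. by apply: cser_lin; [exact: entire_ocoef..|exact: ocoef_lin]. Qed.

Lemma dsol_lin a b z s : dsol a b z s = a * dsol 1 0 z s + b * dsol 0 1 z s.
Proof.
apply: cser_lin; [by apply: entire_dseq; exact: entire_ocoef..|].
by move=> k; rewrite /dseq ocoef_lin; ring.
Qed.

Lemma sol_opp a b z s : odd n -> sol a b z (- s) = sol a (- b) (- z) s.
Proof.
move=> on; apply: ccvg_uniq (cser_cvg _ (entire_ocoef _ _ _)) _.
have -> : cpsum (ocoef n a b z) (- s) = cpsum (ocoef n a (- b) (- z)) s.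
  apply/funext => N; apply: eq_bigr => k _; rewrite ocoef_opp//.
  have -> : ((- s) ^+ k)%:C%C = (-1) ^+ k * (s ^+ k)%:C%C :> R[i].
    by rewrite (exprNn s) (rmorphM (real_complex R)) (rmorphXn (real_complex R)) (rmorphN (real_complex R)) rmorph1.
  by ring.
by apply: cser_cvg; apply: entire_ocoef.
Qed.

Lemma sol_deriv a b z s : cderiv (sol a b z) s (dsol a b z s).
Proof. by apply: cser_deriv; exact: entire_ocoef. Qed.

(** The three terms of the coefficient recursion are those of the expanded square, the powers of s
    acting as shifts. *)
Lemma dsol_deriv a b z s :
  cderiv (dsol a b z) s ((z - (n.+1%:R * s ^+ n)%:C%C) ^+ 2 * sol a b z s).
Proof.
have ec := entire_ocoef a b z; have ed := entire_dseq ec; have edd := entire_dseq ed.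
have -> : (z - (n.+1%:R * s ^+ n)%:C%C) ^+ 2 * sol a b z s =
   cser (dseq (dseq (ocoef n a b z))) s; last exact: cser_deriv.
have e1 := entire_shiftseq n ec; have e2 := entire_shiftseq (n + n) ec.
have E k : dseq (dseq (ocoef n a b z)) k = 1 * (z ^+ 2 * ocoef n a b z k +
    - (2%:R * n.+1%:R * z) * shiftseq n (ocoef n a b z) k)
    + n.+1%:R ^+ 2 * shiftseq (n + n) (ocoef n a b z) k.
  rewrite mul1r mulNr /dseq mulrA -natrM (mulnC k.+1) (ocoefE _ _ _ _ k.+2) /=.
  by rewrite [LHS]mulrC divfK// pnatr_eq0 muln_eq0.
have e12 := entire_lin ec e1 (fun k => erefl (z ^+ 2 * ocoef n a b z k +
    - (2%:R * n.+1%:R * z) * shiftseq n (ocoef n a b z) k)).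
rewrite (cser_lin s e12 e2 edd E) mul1r.
rewrite (cser_lin s ec e1 e12 (fun=> erefl)) !cser_shiftseq//.
by rewrite exprD !rmorphM rmorph_nat /sol; ring.
Qed.

Lemma sol_bound a b z r s : 1 <= r -> normc a <= 1 -> normc b <= 1 ->
  normc z <= r -> normc (sol a b z s) <= expR (r * `|s| + `|s| ^+ n.+1).
Proof.
move=> r1 a1 b1 zr; have r0 : 0 <= r by lra.
have := @cser_tail _ _ s (maj n r) 0 (expR (r * `|s| + `|s| ^+ n.+1)) (entire_ocoef a b z).
rewrite (_ : cpsum _ s 0 = 0) ?subr0; last by rewrite /cpsum big_ord0.
apply => [k|M]; first exact: ocoef_le_maj.
by rewrite big_ord0 subr0; apply: maj_sum_le.
Qed.

Lemma sol_real (a b x : R) s : complex.Im (sol a%:C%C b%:C%C x%:C%C s) = 0.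
Proof.
have h := ccvg_Im (cser_cvg s (entire_ocoef a%:C%C b%:C%C x%:C%C)).
rewrite -(cvg_lim _ h)//.
have -> : (fun N => complex.Im (cpsum (ocoef n a%:C%C b%:C%C x%:C%C) s N)) = (fun=> 0).
  apply/funext => N; rewrite Im_cpsum /pseries /series /= big1// => k _.
  rewrite -(@ocoef_morph n _ _ (real_complex R)) ?mul0r//.
  by move=> j; rewrite unitfE pnatr_eq0.
exact: lim_cst.
Qed.

(* Truncations, as polynomials in the spectral parameter. *)
Definition polcoef (a b : R[i]) (k : nat) : {poly R[i]} := ocoef n a%:P b%:P 'X k.

Definition trunc (a b : R[i]) (s : R) (N : nat) : {poly R[i]} :=
  \sum_(k < N) polcoef a b k * ((s ^+ k)%:C%C)%:P.

Lemma horner_trunc a b z s N : (trunc a b s N).[z] = cpsum (ocoef n a b z) s N.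
Proof.
rewrite /trunc horner_sum; apply: eq_bigr => k _; rewrite hornerM hornerC; congr (_ * _).
rewrite /polcoef -[LHS]/(horner_eval z _) ocoef_morph; last first.
  move=> j; rewrite poly_unitE -polyC1 -polyCMn size_polyC coefC /= unitfE.
  by rewrite pnatr_eq0.
by rewrite /= !horner_evalE !hornerC hornerX.
Qed.

(** The majorant depends on z only through r, so the tail is small uniformly over the disc and over
    normalized initial data. *)
Lemma trunc_tail (r s : R) : 1 <= r -> 0 <= s -> exists e : nat -> R,
  e @ \oo --> (0 : R) /\ forall a b z N, normc a <= 1 -> normc b <= 1 -> normc z <= r ->
  normc (sol a b z s - (trunc a b s N).[z]) <= e N.
Proof.
move=> r1 s0; have r0 : 0 <= r by lra.
pose T N := \sum_(k < N) maj n r k * s ^+ k.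
have cT : cvgn T.
  have := @bounded_series_cvg _ (fun k => maj n r k * s ^+ k) (expR (r * s + s ^+ n.+1)).
  have -> : series (fun k => maj n r k * s ^+ k) = T.
    by apply/funext => N; rewrite /series /= big_mkord.
  apply => N; apply: le_trans (maj_sum_le n r0 N s0); apply: ler_sum => k _.
  by rewrite ger0_norm// mulr_ge0 ?maj_ge0 ?exprn_ge0.
have nT : nondecreasing_seq T.
  apply/nondecreasing_seqP => N; rewrite /T big_ord_recr /= lerDl.
  by rewrite mulr_ge0 ?maj_ge0 ?exprn_ge0.
exists (fun N => limn T - T N); split.
  by rewrite -(subrr (limn T)); apply: cvgB => //; exact: cvg_cst.
move=> a b z N a1 b1 zr; rewrite horner_trunc.
apply: (@cser_tail _ _ _ (maj n r)); first exact: entire_ocoef.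
  by move=> k; apply: ocoef_le_maj.
move=> M; rewrite ger0_norm// lerD2r; exact: nondecreasing_cvgn_le.
Qed.

Lemma trunc_bound a b z (r s : R) N : 1 <= r -> 0 <= s ->
  normc a <= 1 -> normc b <= 1 -> normc z <= r ->
  normc (trunc a b s N).[z] <= expR (r * s + s ^+ n.+1).
Proof.
move=> r1 s0 a1 b1 zr; rewrite horner_trunc; have r0 : 0 <= r by lra.
have := @cpsum_tail _ (ocoef n a b z) s (maj n r) 0 N (fun k => ocoef_le_maj k r1 a1 b1 zr) (leq0n _).
rewrite (_ : cpsum _ s 0 = 0) ?subr0; last by rewrite /cpsum big_ord0.
move=> /le_trans; apply.
by rewrite big_ord0 subr0 ger0_norm//; apply: maj_sum_le.
Qed.

End Solutions.

(** * Lower bounds on the real axis *)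

Section WKB.
Context {R : realType}.

(* With [K' = k >= 0] nondecreasing and [f'' = k ^+ 2 * f], the function
   [(f' + k f) * expR (- K)] is nondecreasing, while [f' ^+ 2 - (k f) ^+ 2] is
   nonincreasing, so that [f' <= k f + f' s0]. *)
Lemma wkb_lower (f f1 k k1 K : R -> R) (s0 s : R) : s0 <= s ->
  (forall t, s0 <= t <= s -> is_derive t 1 f (f1 t)) ->
  (forall t, s0 <= t <= s -> is_derive t 1 f1 (k t ^+ 2 * f t)) ->
  (forall t, s0 <= t <= s -> is_derive t 1 K (k t)) ->
  (forall t, s0 <= t <= s -> is_derive t 1 k (k1 t)) ->
  (forall t, s0 <= t <= s -> [/\ 0 <= f t, 0 <= f1 t, 0 <= k t & 0 <= k1 t]) ->
  (f1 s0 + k s0 * f s0) * (expR (K s - K s0) - 1) <= 2 * k s * f s.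
Proof.
move=> s0s df df1 dK dk pos.
have phi : (f1 s0 + k s0 * f s0) * expR (- K s0) <= (f1 s + k s * f s) * expR (- K s).
  apply: (@der_ge0_le _ (fun t => (f1 t + k t * f t) * expR (- K t))
     (fun t => k1 t * f t * expR (- K t))) => // t t01; last first.
    by have [f0 f10 k0 k10] := pos t t01; rewrite !mulr_ge0 ?expR_ge0.
  apply: der_ext (derM (derD (df1 t t01) (derM (dk t t01) (df t t01))) (der_exp (derN (dK t t01)))) _ _ => //.
  by ring.
have psi : - (f1 s0 ^+ 2 - (k s0 * f s0) ^+ 2) <= - (f1 s ^+ 2 - (k s * f s) ^+ 2).
  apply: (@der_ge0_le _ (fun t => - (f1 t ^+ 2 - (k t * f t) ^+ 2))
     (fun t => 2 * k t * k1 t * f t ^+ 2)) => // t t01; last first.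
    by have [f0 f10 k0 k10] := pos t t01; rewrite !mulr_ge0 ?exprn_ge0.
  apply: der_ext (derN (derB (derX 2 (df1 t t01)) (derX 2 (derM (dk t t01) (df t t01))))) _ _ => //=.
  by ring.
have [f0 f10 k0 _] : [/\ 0 <= f s, 0 <= f1 s, 0 <= k s & 0 <= k1 s] by apply: pos; rewrite s0s lexx.
have [g0 g10 l0 _] : [/\ 0 <= f s0, 0 <= f1 s0, 0 <= k s0 & 0 <= k1 s0] by apply: pos; rewrite s0s lexx.
have le1 : f1 s <= k s * f s + f1 s0.
  have kf0 := mulr_ge0 k0 f0; have kg0 := mulr_ge0 l0 g0.
  rewrite -(@ler_pXn2r _ 2) ?nnegrE ?addr_ge0//; nra.
have : (f1 s0 + k s0 * f s0) * expR (K s - K s0) <= f1 s + k s * f s.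
  have := ler_wpM2r (expR_ge0 (K s)) phi.
  by rewrite -!mulrA -!expRD addNr expR0 mulr1 (addrC (- K s0)).
have := mulr_ge0 l0 g0; rewrite mulrBr; lra.
Qed.

Lemma expR_sub1_ge (x : R) : 1 <= x -> expR (x - 1) <= expR x - 1.
Proof.
move=> x1; have h : 1 <= expR (x - 1) by rewrite -[leLHS]expR0 ler_expR subr_ge0.
have e2 : 2 <= expR (1 : R).
  by have := expR_ge1Dx (1 : R); lra.
have -> : expR x = expR (x - 1) * expR 1 by rewrite -expRD subrK.
nra.
Qed.

Section RealSolutions.
Variables (n : nat).

Definition rsol (a b x s : R) : R := complex.Re (sol n a%:C%C b%:C%C x%:C%C s).
Definition drsol (a b x s : R) : R := complex.Re (dsol n a%:C%C b%:C%C x%:C%C s).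

Lemma rsolE a b x s : sol n a%:C%C b%:C%C x%:C%C s = (rsol a b x s)%:C%C.
Proof. by apply: complex_ext => //=; exact: sol_real. Qed.

Lemma rsol_deriv (a b x s : R) : is_derive s 1 (rsol a b x) (drsol a b x s).
Proof. by have [] := sol_deriv n a%:C%C b%:C%C x%:C%C s. Qed.

Lemma drsol_deriv (a b x s : R) :
  is_derive s 1 (drsol a b x) ((x - n.+1%:R * s ^+ n) ^+ 2 * rsol a b x s).
Proof.
have [+ _] := dsol_deriv n a%:C%C b%:C%C x%:C%C s.
by rewrite rsolE -!rmorphB -rmorphXn -rmorphM.
Qed.

Lemma rsol_0 a b x : rsol a b x 0 = a.
Proof. by rewrite /rsol sol_0. Qed.

Lemma drsol_0 a b x : drsol a b x 0 = b.
Proof. by rewrite /drsol dsol_0. Qed.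

Let cRe_lin (a b : R) (z w : R[i]) :
  complex.Re (a%:C%C * z + b%:C%C * w) = a * complex.Re z + b * complex.Re w.
Proof. by case: z w => p q [p' q'] /=; rewrite !mul0r !subr0. Qed.

Lemma rsol_lin a b x s : rsol a b x s = a * rsol 1 0 x s + b * rsol 0 1 x s.
Proof. by rewrite {1}/rsol sol_lin; apply: cRe_lin. Qed.

Lemma drsol_lin a b x s : drsol a b x s = a * drsol 1 0 x s + b * drsol 0 1 x s.
Proof. by rewrite {1}/drsol dsol_lin; apply: cRe_lin. Qed.

(** f f' has derivative f'^2 + (x - m s^n)^2 f^2 >= 0, so f^2 does not decrease and f cannot reach
    0. *)
Let rsol_pos (a b x s : R) : 0 < a -> 0 <= b -> 0 <= s ->
  0 <= rsol a b x s /\ 0 <= drsol a b x s.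
Proof.
move=> a0 b0 s0; pose f := rsol a b x; pose f1 := drsol a b x.
have ff1 t : 0 <= t -> 0 <= f t * f1 t.
  move=> t0; apply: (@le_trans _ _ (f 0 * f1 0)).
    by rewrite /f /f1 rsol_0 drsol_0; apply: mulr_ge0 => //; apply: ltW.
  apply: (@der_ge0_le _ (fun t => f t * f1 t)
    (fun t => f1 t * f1 t + f t * ((x - n.+1%:R * t ^+ n) ^+ 2 * f t))) => // u _.
    by apply: derM; [exact: rsol_deriv|exact: drsol_deriv].
  apply: addr_ge0; first by rewrite -expr2 sqr_ge0.
  by rewrite mulrCA; apply: mulr_ge0; [exact: sqr_ge0|rewrite -expr2 sqr_ge0].
have f2 t : 0 <= t -> a ^+ 2 <= f t ^+ 2.
  move=> t0; rewrite -{1}(rsol_0 a b x).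
  apply: (@der_ge0_le _ (fun t => f t ^+ 2) (fun t => 2%:R * f t ^+ 1 * f1 t)) => // u.
    by move=> _; apply: derX; exact: rsol_deriv.
  by move=> /andP[u0 _]; rewrite expr1 -mulrA mulr_ge0// ff1.
have fp : 0 < f s.
  rewrite ltNge; apply/negP => fs0.
  have cf : {within `[0, s], continuous f}.
    apply: continuous_subspaceT => u; exact: (der_continuous (rsol_deriv a b x u)).
  have [|c] := IVT (v := 0) s0 cf.
    by rewrite (rsol_0 a b x : f 0 = a) ge_min le_max fs0 orbT (ltW a0).
  rewrite in_itv/= => /andP[c0 _] fc; have := f2 c c0; rewrite fc expr0n /=.
  by rewrite leNgt exprn_gt0.
split; first exact: ltW.
by have := ff1 s s0; rewrite pmulr_rge0.
Qed.

Let ge0_of_eps (p q : R) : (forall e, 0 < e -> 0 <= e * p + q) -> 0 <= q.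
Proof.
move=> h; rewrite leNgt; apply/negP => q0.
have e0 : 0 < - q / (2 * (1 + `|p|)).
  by rewrite divr_gt0 ?oppr_gt0// mulr_gt0// ltr_pwDl.
have := h _ e0; rewrite leNgt => /negP; apply.
have P : 0 < 1 + `|p| by rewrite ltr_pwDl.
have : - q / (2 * (1 + `|p|)) * p <= - q / 2.
  rewrite invfM mulrA -mulrA ler_piMr//; first by rewrite divr_ge0// oppr_ge0 ltW.
  by rewrite mulrC ler_pdivrMr// mul1r (le_trans (ler_norm _))// lerDr.
lra.
Qed.

(** The case a = 0 is the limit of a + e as e tends to 0, by linearity in the initial data. *)
Lemma rsol_ge0 (a b x s : R) : 0 <= a -> 0 <= b -> 0 <= s ->
  0 <= rsol a b x s /\ 0 <= drsol a b x s.
Proof.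
move=> a0 b0 s0; have h e : 0 < e -> 0 <= rsol (e + a) b x s /\ 0 <= drsol (e + a) b x s.
  by move=> e0; apply: rsol_pos => //; rewrite ltr_pwDl.
split.
  apply: (ge0_of_eps (p := rsol 1 0 x s)) => e /h[+ _].
  by rewrite rsol_lin (rsol_lin a b) mulrDl -addrA.
apply: (ge0_of_eps (p := drsol 1 0 x s)) => e /h[_ +].
by rewrite drsol_lin (drsol_lin a b) mulrDl -addrA.
Qed.

Let rsol_le (a b x s t : R) : 0 <= a -> 0 <= b -> 0 <= s <= t ->
  rsol a b x s <= rsol a b x t /\ drsol a b x s <= drsol a b x t.
Proof.
move=> a0 b0 /andP[s0 st]; split.
  apply: (der_ge0_le st) => u /andP[su _]; first exact: rsol_deriv.
  by have [] := rsol_ge0 x a0 b0 (le_trans s0 su).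
apply: (der_ge0_le st) => u /andP[su _]; first exact: drsol_deriv.
by have [? _] := rsol_ge0 x a0 b0 (le_trans s0 su); apply: mulr_ge0 => //; apply: sqr_ge0.
Qed.

(* The common shape of the lower bounds: [k t = n.+1 t ^+ n + y] on [[s0, s]]. *)
Let rsol_lower (a b y s0 s : R) : 0 <= a -> 0 <= b -> 0 <= s0 <= s ->
  0 <= n.+1%:R * s0 ^+ n + y ->
  1 <= drsol a b (- y) s0 + (n.+1%:R * s0 ^+ n + y) * rsol a b (- y) s0 ->
  1 <= s ^+ n.+1 + y * s - (s0 ^+ n.+1 + y * s0) ->
  expR (s ^+ n.+1 + y * s - (s0 ^+ n.+1 + y * s0) - 1) <=
  2 * (n.+1%:R * s ^+ n + y) * rsol a b (- y) s.
Proof.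
move=> a0 b0 /andP[s00 s0s] k0 A1 E1.
set E := s ^+ n.+1 + _ - _ in E1 *.
have := @wkb_lower (rsol a b (- y)) (drsol a b (- y)) (fun t => n.+1%:R * t ^+ n + y)
  (fun t => n.+1%:R * (n%:R * t ^+ n.-1)) (fun t => t ^+ n.+1 + y * t) s0 s s0s.
have d1 t : s0 <= t <= s -> is_derive t 1 (rsol a b (- y)) (drsol a b (- y) t).
  by move=> _; exact: rsol_deriv.
have d2 t : s0 <= t <= s -> is_derive t 1 (drsol a b (- y)) ((n.+1%:R * t ^+ n + y) ^+ 2 * rsol a b (- y) t).
  move=> _; apply: der_ext (drsol_deriv a b (- y) t) _ _ => //; congr (_ * _).
  by ring.
have d3 t : s0 <= t <= s -> is_derive t 1 (fun t => t ^+ n.+1 + y * t) (n.+1%:R * t ^+ n + y).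
  move=> _; apply: der_ext (derD (der_pow t n.+1) (derZ y (der_id t))) _ _ => //.
  by rewrite mulr1.
have d4 t : s0 <= t <= s -> is_derive t 1 (fun t => n.+1%:R * t ^+ n + y) (n.+1%:R * (n%:R * t ^+ n.-1)).
  move=> _; apply: der_ext (derD (derZ _ (der_pow t n)) (der_cst y t)) _ _ => //.
  by rewrite addr0.
move/(_ d1 d2 d3 d4) => h; apply: le_trans (h _); last first.
  move=> t /andP[s0t ts]; have t0 := le_trans s00 s0t.
  have [f0 f10] := rsol_ge0 (- y) a0 b0 t0; split => //.
    by apply: le_trans k0 _; rewrite lerD2r ler_wpM2l// lerXn2r// nnegrE.
  by rewrite !mulr_ge0 ?exprn_ge0.
rewrite -/E; have := expR_sub1_ge E1; have := expR_ge0 (E - 1); nra.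
Qed.

(** For z = 0 the rate m s^n vanishes at 0; the comparison therefore starts at 1, where f' + m f >=
    a + b. *)
Lemma rsol_lower0 (a b s : R) : 0 <= a -> 0 <= b -> a + b = 1 -> 1 <= s -> 2 <= s ^+ n.+1 ->
  expR (s ^+ n.+1 - 2) <= 2 * (n.+1%:R * s ^+ n) * rsol a b 0 s.
Proof.
move=> a0 b0 ab s1 sn; have := @rsol_lower a b 0 1 s a0 b0.
rewrite !mul0r !addr0 oppr0 expr1n mulr1 expr1n.
have -> : s ^+ n.+1 - 1 - 1 = s ^+ n.+1 - 2 by ring.
apply; rewrite ?ler01 ?s1 ?ler0n//.
2: by lra.
have h01 : (0 : R) <= (0 : R) <= (1 : R) by apply/andP; split.
have [] := @rsol_le a b 0 0 1 a0 b0 h01; rewrite rsol_0 drsol_0.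
have : (1 : R) <= n.+1%:R by rewrite ler1n.
nra.
Qed.

(** The rate m s^n + x is already x >= 1 at 0, so the comparison starts there with f' + x f = x. *)
Lemma rsol_lower_neg (x s : R) : 1 <= x -> 1 <= s ->
  expR (s ^+ n.+1 + x * s - 1) <= 2 * (n.+1%:R * s ^+ n + x) * rsol 1 0 (- x) s.
Proof.
move=> x1 s1; have := @rsol_lower 1 0 x 0 s ler01 (lexx 0).
have h : 0 <= n.+1%:R * (0 : R) ^+ n by rewrite mulr_ge0// exprn_ge0.
have h1 : 1 <= s ^+ n.+1 by apply: exprn_ege1.
rewrite (expr0n _ n.+1) mulr0 add0r subr0 rsol_0 drsol_0 mulr1 add0r.
apply; rewrite ?lexx/=; nra.
Qed.

(** The rate m s^n - m sg^n changes sign at the turning point sg. The comparison starts there, where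
    the slope is still at least its initial value 1. Up to the final -1, the exponent is the
    integral of the rate from sg to s; its term n sg^m is the gain that defeats Harnack's
    inequality. *)
Lemma rsol_lower_pos (sg s : R) : 0 <= sg <= s ->
  1 <= s ^+ n.+1 - n.+1%:R * sg ^+ n * s + n%:R * sg ^+ n.+1 ->
  expR (s ^+ n.+1 - n.+1%:R * sg ^+ n * s + n%:R * sg ^+ n.+1 - 1) <=
  2 * (n.+1%:R * s ^+ n - n.+1%:R * sg ^+ n) * rsol 0 1 (n.+1%:R * sg ^+ n) s.
Proof.
move=> sgs E1; have := @rsol_lower 0 1 (- (n.+1%:R * sg ^+ n)) sg s (lexx 0) ler01 sgs.
rewrite !subrr !mulNr opprK mul0r addr0.
have E : s ^+ n.+1 - n.+1%:R * sg ^+ n * s - (sg ^+ n.+1 - n.+1%:R * sg ^+ n * sg) =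
   s ^+ n.+1 - n.+1%:R * sg ^+ n * s + n%:R * sg ^+ n.+1.
  by rewrite -natr1 !exprSr; ring.
rewrite E; apply => //.
have sg0 : (0 : R) <= (0 : R) <= sg by apply/andP; split => //; case/andP: sgs.
have [_] := @rsol_le 0 1 (n.+1%:R * sg ^+ n) 0 sg (lexx 0) ler01 sg0.
by rewrite drsol_0.
Qed.

End RealSolutions.
End WKB.

(** * A zero of the connection determinant *)

Section EvenHarnack.
Context {R : realType}.

(** P(w)^2 = P(w) P(-w) is, up to a constant, the product of 1 - w^2 / rt^2 over the roots rt, hence
    a polynomial in w^2. Harnack's inequality for it on the disc of radius r^2 involves (x / r)^2;
    the factors 2 from squaring P cancel. *)
Lemma harnack_even (P : {poly R[i]}) (r M x : R) : 0 < r -> 0 <= x < r -> 0 < M ->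
  (forall z, P.[- z] = P.[z]) ->
  (forall z, normc z <= r -> P.[z] != 0) ->
  (forall z, normc z <= r -> normc P.[z] <= M) ->
  ln (normc P.[x%:C%C]) - ln (normc P.[0]) <=
  2 * (x / r) ^+ 2 / (1 - (x / r) ^+ 2) * (ln M - ln (normc P.[0])).
Proof.
move=> r0 /andP[x0 xr] M0 Pev Pnz PM.
have [rs Prs] := closed_field_poly_normal P.
have rsr rt : rt \in rs -> r < normc rt.
  move=> rtrs; rewrite ltNge; apply/negP => /Pnz/negP; apply; rewrite Prs hornerZ.
  have /rootP -> : root (\prod_(z <- rs) ('X - z%:P)) rt by rewrite root_prod_XsubC.
  by rewrite mulr0.
have P0 : P.[0] != 0 by apply: Pnz; rewrite normc0 ltW.
have E w : \prod_(a <- [seq (rt ^+ 2)^-1 | rt <- rs]) (1 - a * w ^+ 2) = (P.[w] / P.[0]) ^+ 2.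
  rewrite big_map expr_div_n (_ : P.[w] ^+ 2 = P.[w] * P.[- w]); last by rewrite Pev expr2.
  have PE v : P.[v] = lead_coef P * \prod_(rt <- rs) ('X - rt%:P).[v].
    by rewrite {1}Prs hornerZ horner_prod.
  rewrite [P.[0] ^+ 2]expr2 !PE.
  have lc : lead_coef P != 0.
    by rewrite lead_coef_eq0; apply: contra P0 => /eqP ->; rewrite horner0.
  have q0 : \prod_(rt <- rs) (0 - rt) ^+ 2 != 0.
    rewrite prodf_seq_neq0; apply/allP => rt /rsr h /=.
    by rewrite sub0r sqrrN expf_eq0 /= -normc_gt0 (lt_trans r0 h).
  rewrite [X in _ / X](_ : _ = lead_coef P ^+ 2 * \prod_(rt <- rs) (0 - rt) ^+ 2); last first.
    rewrite mulrACA expr2 -big_split; congr (_ * _).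
    by apply: eq_bigr => rt _; rewrite hornerXsubC expr2.
  rewrite mulrACA -expr2 -big_split /=.
  apply: (mulIf (_ : lead_coef P ^+ 2 * \prod_(rt <- rs) (0 - rt) ^+ 2 != 0)).
    by rewrite mulf_neq0// expf_neq0.
  rewrite divfK; last by rewrite mulf_neq0// expf_neq0.
  rewrite mulrCA; congr (_ * _); rewrite -big_split /= big_seq [RHS]big_seq.
  apply: eq_bigr => rt /rsr h; rewrite !hornerXsubC; field.
  by rewrite -normc_gt0 (lt_trans r0 h).
have lnE w : normc w <= r -> ln (normc (\prod_(a <- [seq (rt ^+ 2)^-1 | rt <- rs]) (1 - a * w ^+ 2)))
    = 2 * (ln (normc P.[w]) - ln (normc P.[0])).
  move=> wr; rewrite E normcX normcM normcV lnXn; last first.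
    by rewrite divr_gt0 ?normc_gt0 ?P0 ?Pnz.
  by rewrite ln_div ?posrE ?normc_gt0 ?P0 ?Pnz// mulr_natl.
have := @harnack R [seq (rt ^+ 2)^-1 | rt <- rs] (r ^+ 2) (2 * (ln M - ln (normc P.[0]))) (x ^+ 2).
rewrite rmorphXn lnE; last by rewrite normc_real ger0_norm// ltW.
rewrite expr_div_n.
set B := 2 * _ / _ => h; have : 2 * (ln (normc P.[x%:C%C]) - ln (normc P.[0])) <=
    B * (2 * (ln M - ln (normc P.[0]))).
  apply: h.
  - by rewrite exprn_gt0.
  - by rewrite exprn_ge0//= ltrXn2r.
  - move=> a /mapP[rt /rsr h ->]; rewrite normcV normcX mulrC -expr_div_n.
    have rt0 := lt_trans r0 h.
    by rewrite expr_lt1// ?divr_ge0 ?(ltW r0) ?(ltW rt0)// ltr_pdivrMr ?mul1r.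
  (* Each point of the circle of radius r^2 is the square of a point of modulus r. *)
  move=> z zr; have wr : normc (sqrtC z) <= r.
    by rewrite -(@ler_pXn2r _ 2)// ?nnegrE ?normc_ge0 ?(ltW r0)// -normcX sqrtCK zr.
  rewrite -[z]sqrtCK lnE//; rewrite ler_pM2l// lerD2r ler_ln ?posrE ?normc_gt0 ?Pnz//.
  exact: PM.
by rewrite mulrCA ler_pM2l.
Qed.

End EvenHarnack.

Section Arithmetic.
Context {R : realType}.
(** These will be m = n + 1, nr = n, t = T, tau = T^n and Th = tau^m. Lam is the logarithm of the
    WKB prefactor; a bound linear in t is all that is asked of it. *)
Variables (m nr t tau Th Lam : R).
Hypotheses (m4 : 4 <= m) (nr3 : 3 <= nr) (t1 : 1 <= t).
Hypothesis tK : 6 + 8 * m + 2 * nr ^+ 2 + 8 * m ^+ 2 +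
  4 * m ^+ 2 * (6 + 8 * m + 2 * nr ^+ 2) < t.
Hypotheses (ttau : t <= tau) (Th4 : tau ^+ 2 * tau ^+ 2 <= Th).
Hypothesis LamK : Lam <= 4 * m + nr ^+ 2 * t.

Lemma param_arith : [/\ m <= tau, m * tau ^+ 2 <= Th, 2 * Lam + 5 <= 2 * Th,
  2 * m ^+ 2 <= tau ^+ 2 & 1 <= tau].
Proof.
move: m4 nr3 t1 tK ttau Th4 LamK => m4' nr3' t1' tK' ttau' Th4' LamK'.
have tau1 : 1 <= tau by apply: le_trans ttau.
have nr2 : 0 <= nr ^+ 2 by exact: sqr_ge0.
have m2 : 0 <= m ^+ 2 by exact: sqr_ge0.
have s0 : 0 <= 6 + 8 * m + 2 * nr ^+ 2 by lra.
have KcE2 : 0 <= 4 * m ^+ 2 * (6 + 8 * m + 2 * nr ^+ 2).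
  by apply: mulr_ge0 => //; apply: mulr_ge0.
have t0 := le_trans ler01 t1.
have tau2 : t * t <= tau ^+ 2 by rewrite expr2; apply: ler_pM.
have tau21 : 1 <= tau ^+ 2 by rewrite exprn_ege1.
have mt : m <= tau by lra.
have h1 : m * tau ^+ 2 <= Th.
  apply: le_trans Th4; rewrite ler_wpM2r ?sqr_ge0//; apply: le_trans mt _.
  by rewrite expr2 ler_peMr// (le_trans ler01 tau1).
have h2' : 2 * m ^+ 2 <= t by lra.
have h2 : 2 * m ^+ 2 <= t * t by apply: le_trans h2' _; rewrite ler_peMr.
have h3 : 4 + 8 * m + 2 * nr ^+ 2 * t <= t * t by nra.
have h4 : tau ^+ 2 <= tau ^+ 2 * tau ^+ 2 by rewrite ler_peMr ?sqr_ge0.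
have h5 : 1 <= t * t by apply: mulr_ege1.
by split => //; lra.
Qed.

(** q and p are ln |P| at m tau and at 0, l is the logarithm of the bound on the disc, and b = m^2 /
    tau^2. The terms 2 Th cancel in l - p, so Harnack allows only q - p = O(tau), against the gain
    nr t tau. The threshold in [tK] collects the resulting coefficients of tau. *)
Lemma no_zero_contradiction (p q l b : R) :
  2 * Th + nr * t * tau - 3 - 2 * Lam <= q ->
  2 * Th - 5 - 2 * Lam <= p -> p <= 1 + 2 * (tau + Th) ->
  l <= 1 + 2 * (tau ^+ 2 * tau + Th) -> p <= l ->
  b * tau ^+ 2 = m ^+ 2 -> 0 <= b -> q - p <= 2 * b / (1 - b) * (l - p) -> False.
Proof.
move=> q1 p1 p2 l1 pl bt b0 H.
have [mtau mTh LTh m2t tau1] := param_arith.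
move: m4 nr3 t1 ttau Th4 LamK => m4' nr3' t1' ttau' Th4' LamK'.
move: tK; set K := (X in X < t) => tK'.
have KE : K = 6 + 8 * m + 2 * nr ^+ 2 + 8 * m ^+ 2 + 4 * m ^+ 2 * (6 + 8 * m + 2 * nr ^+ 2) by [].
clearbody K.
have tau0 : 0 <= tau by apply: le_trans tau1.
have tau20 : 0 < tau ^+ 2 by rewrite exprn_gt0//; lra.
have nr2 : 0 <= nr ^+ 2 by exact: sqr_ge0.
have b2 : b <= 2^-1 by rewrite -(@ler_pM2r _ (tau ^+ 2))//; lra.
have H2 : 2 * b / (1 - b) <= 4 * b by rewrite ler_pdivrMr; nra.
have H3 : q - p <= 4 * b * (6 + 2 * (tau ^+ 2 * tau) + 2 * Lam).
  apply: le_trans H _; apply: (@le_trans _ _ (4 * b * (l - p))).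
    by rewrite ler_wpM2r// subr_ge0.
  by rewrite ler_wpM2l ?mulr_ge0//; lra.
have H5 : 4 * b * (6 + 2 * (tau ^+ 2 * tau) + 2 * Lam) <=
   8 * m ^+ 2 * tau + 4 * m ^+ 2 * (6 + 8 * m + 2 * nr ^+ 2) * tau.
  have h6 : 6 + 2 * Lam <= (6 + 8 * m + 2 * nr ^+ 2) * tau ^+ 2.
    have : 0 <= (6 + 8 * m) * (t - 1) by apply: mulr_ge0; lra.
    move=> h; apply: (@le_trans _ _ ((6 + 8 * m + 2 * nr ^+ 2) * t)); first by lra.
    rewrite ler_wpM2l//; first by lra.
    by apply: le_trans ttau _; rewrite expr2 ler_peMr.
  have -> : 4 * b * (6 + 2 * (tau ^+ 2 * tau) + 2 * Lam) =
     8 * (b * tau ^+ 2) * tau + 4 * (b * (6 + 2 * Lam)) by ring.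
  rewrite bt lerD2l.
  have -> : 4 * m ^+ 2 * (6 + 8 * m + 2 * nr ^+ 2) * tau =
    4 * (m ^+ 2 * ((6 + 8 * m + 2 * nr ^+ 2) * tau)) by ring.
  rewrite ler_wpM2l//.
  apply: (@le_trans _ _ (b * ((6 + 8 * m + 2 * nr ^+ 2) * tau ^+ 2))); first by rewrite ler_wpM2l.
  have -> : b * ((6 + 8 * m + 2 * nr ^+ 2) * tau ^+ 2) = m ^+ 2 * (6 + 8 * m + 2 * nr ^+ 2).
    by rewrite -bt; ring.
  apply: ler_wpM2l; first exact: sqr_ge0.
  by rewrite ler_peMr//; lra.
have H4 : nr * t * tau <= 4 + 2 * Lam + 2 * tau +
   (8 * m ^+ 2 * tau + 4 * m ^+ 2 * (6 + 8 * m + 2 * nr ^+ 2) * tau) by lra.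
have H6 : 4 + 2 * Lam <= (4 + 8 * m + 2 * nr ^+ 2) * tau.
  have h1 : 0 <= (4 + 8 * m) * (tau - 1) by apply: mulr_ge0; lra.
  have h2 : nr ^+ 2 * t <= nr ^+ 2 * tau by rewrite ler_wpM2l.
  lra.
have H7 : nr * t * tau <= K * tau by rewrite KE; lra.
have tau00 : 0 < tau by apply: lt_le_trans tau1.
have H8 : nr * t <= K by rewrite -(@ler_pM2r _ tau).
have : 1 * t <= nr * t by rewrite ler_wpM2r//; lra.
lra.
Qed.

End Arithmetic.

Section Zero.
Context {R : realType}.
Variable n : nat.
Hypothesis n3 : (3 <= n)%N.

(* Up to sign, [connection s z = 0] iff some nonzero solution vanishes at both
   [s] and [- s] (for odd [n]). *)
Definition connection (s : R) (z : R[i]) : R[i] :=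
  sol n 1 0 z s * sol n 0 1 (- z) s + sol n 0 1 z s * sol n 1 0 (- z) s.

Let twist (A B : {poly R[i]}) : {poly R[i]} := A * (B \Po (- 'X)) + B * (A \Po (- 'X)).

Let horner_twist A B z : (twist A B).[z] = A.[z] * B.[- z] + B.[z] * A.[- z].
Proof. by rewrite /twist hornerD !hornerM !horner_comp hornerN hornerX. Qed.

Let twist_even A B z : (twist A B).[- z] = (twist A B).[z].
Proof.
rewrite !horner_twist opprK.
by move: A.[z] A.[- z] B.[z] B.[- z] => p q u v; ring.
Qed.

(** A polynomial, so that the Harnack bound through roots applies. Truncating the four solutions
    before combining them keeps it exactly even in z. *)
Definition connection_pol (s : R) (N : nat) : {poly R[i]} :=
  trunc n 1 0 s N * (trunc n 0 1 s N \Po (- 'X)) + trunc n 0 1 s N * (trunc n 1 0 s N \Po (- 'X)).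

Let horner_pol s N z : (connection_pol s N).[z] =
  (trunc n 1 0 s N).[z] * (trunc n 0 1 s N).[- z] + (trunc n 0 1 s N).[z] * (trunc n 1 0 s N).[- z].
Proof. exact: horner_twist. Qed.

Let pol_even s N z : (connection_pol s N).[- z] = (connection_pol s N).[z].
Proof. exact: twist_even. Qed.

Let n01 : normc (0 : R[i]) <= 1. Proof. by rewrite normc0. Qed.
Let n11 : normc (1 : R[i]) <= 1. Proof. by rewrite normc1. Qed.

Let pol_bound (s r : R) N z : 1 <= r -> 0 <= s -> normc z <= r ->
  normc (connection_pol s N).[z] <= 2 * expR (r * s + s ^+ n.+1) ^+ 2.
Proof.
move=> r1 s0 zr; have zr' : normc (- z) <= r by rewrite normcN.
rewrite horner_pol; apply: le_trans (le_normcD _ _) _.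
have h := fun a b z' (ha : normc a <= 1) (hb : normc b <= 1) (hz : normc z' <= r) =>
  @trunc_bound R n a b z' r s N r1 s0 ha hb hz.
have -> (e : R) : 2 * e ^+ 2 = e * e + e * e by ring.
by apply: lerD; rewrite normcM; apply: ler_pM; rewrite ?normc_ge0 ?h.
Qed.

Let pol_approx (s r : R) : 1 <= r -> 0 <= s -> exists N, forall z, normc z <= r ->
  normc ((connection_pol s N).[z] - connection s z) <= 2^-1.
Proof.
move=> r1 s0; have [e [e0 eP]] := @trunc_tail R n r s r1 s0.
set B := expR (r * s + s ^+ n.+1).
have B0 : 0 < B by exact: expR_gt0.
(* With this error each of the two products moves by at most 2 B / (8 B) = 1/4. *)
have d0 : 0 < (8 * B)^-1 by rewrite invr_gt0 mulr_gt0.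
move/cvgr0_norm_le : (e0) => /(_ _ d0) [N _ /(_ N (leqnn N)) /= eN].
exists N => z zr; have zr' : normc (- z) <= r by rewrite normcN.
have hB a b z' (ha : normc a <= 1) (hb : normc b <= 1) (hz : normc z' <= r) :
   normc (sol n a b z' s) <= B.
  by have := sol_bound n s r1 ha hb hz; rewrite ger0_norm.
have hT a b z' (ha : normc a <= 1) (hb : normc b <= 1) (hz : normc z' <= r) :
   normc (trunc n a b s N).[z'] <= B by apply: trunc_bound.
have he a b z' (ha : normc a <= 1) (hb : normc b <= 1) (hz : normc z' <= r) :
   normc ((trunc n a b s N).[z'] - sol n a b z' s) <= (8 * B)^-1.
  rewrite normcB; apply: le_trans (eP _ _ _ _ ha hb hz) _.
  by apply: le_trans eN; rewrite ler_norm.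
have prod a b c d : normc a <= B -> normc d <= B -> normc (a - c) <= (8 * B)^-1 ->
    normc (b - d) <= (8 * B)^-1 -> normc (a * b - c * d) <= 4^-1.
  move=> ha hd hac hbd; have -> : a * b - c * d = a * (b - d) + (a - c) * d by ring.
  apply: le_trans (le_normcD _ _) _; rewrite !normcM.
  have -> : 4^-1 = B * (8 * B)^-1 + (8 * B)^-1 * B by field; rewrite gt_eqF.
  by apply: lerD; apply: ler_pM; rewrite ?normc_ge0.
rewrite horner_pol /connection opprD addrACA.
apply: le_trans (le_normcD _ _) _.
have -> : 2^-1 = 4^-1 + 4^-1 :> R by field.
by apply: lerD; apply: prod; rewrite ?hB ?hT ?he.
Qed.

Let connection_real (s x : R) : connection s x%:C%C =
  (rsol n 1 0 x s * rsol n 0 1 (- x) s + rsol n 0 1 x s * rsol n 1 0 (- x) s)%:C%C.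
Proof.
have E (p q u v : R) : (p * q + u * v)%:C%C = p%:C%C * q%:C%C + u%:C%C * v%:C%C :> R[i].
  by rewrite rmorphD !rmorphM.
have N1 : - x%:C%C = (- x)%:C%C :> R[i] by rewrite rmorphN.
rewrite E /connection N1; congr (_ * _ + _ * _).
- exact: (rsolE n 1 0 x s).
- exact: (rsolE n 0 1 (- x) s).
- exact: (rsolE n 0 1 x s).
- exact: (rsolE n 1 0 (- x) s).
Qed.

(** Passing from the determinant to its truncation, at distance at most 1/2, costs at most 1 in the
    logarithm when the lower bound e^y is at least 1. *)
Let half_ln (u v y : R) : 0 <= y -> 0 < v -> u <= 2^-1 + v -> expR y <= u ->
  y - 1 <= ln v.
Proof.
move=> y0 v0 uv yu; rewrite -[leLHS]expRK ler_ln ?posrE ?expR_gt0//.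
have e1 : 1 <= expR (y - 1) * expR 1 by rewrite -expRD subrK -[leLHS]expR0 ler_expR.
have ey : expR y = expR (y - 1) * expR 1 by rewrite -expRD subrK.
have e2 : 2 <= expR (1 : R) by have := expR_ge1Dx (1 : R); lra.
have := expR_gt0 (y - 1); nra.
Qed.

Let ln_2expR (y : R) : ln (2 * expR y ^+ 2) <= 1 + 2 * y.
Proof.
have ln2 : ln 2 <= 1 :> R.
  by rewrite -[leRHS]expRK ler_ln ?posrE ?expR_gt0//; have := expR_ge1Dx (1 : R); lra.
by rewrite lnM ?posrE ?exprn_gt0 ?expR_gt0// lnXn ?expR_gt0// expRK -[y *+ 2]mulr_natl lerD2r.
Qed.

Let Kc : R := 6 + 8 * n.+1%:R + 2 * n%:R ^+ 2 + 8 * n.+1%:R ^+ 2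
  + 4 * n.+1%:R ^+ 2 * (6 + 8 * n.+1%:R + 2 * n%:R ^+ 2).

(** With tau = t^n, the WKB estimates at s = tau carry the factor 2 (m s^n - z), and for the values
    z = 0 and z = m tau, -m tau used below it is at most 4 m tau^n. *)
Let log_const (t : R) : R := ln (4 * n.+1%:R * (t ^+ n) ^+ n).

Section LargeDisc.
Variables (t : R).
Hypotheses (t1 : 1 <= t) (tK : Kc < t).
Let m : R := n.+1%:R.
Let nr : R := n%:R.
Let tau := t ^+ n.
Let Th := tau ^+ n.+1.
Let Lam := log_const t.

Let expr_ge (x : R) : 1 <= x -> x <= x ^+ n.
Proof. by move=> x1; rewrite -[leLHS]expr1 ler_weXn2l//; lia. Qed.

Let m4 : 4 <= m. Proof. by rewrite ler_nat. Qed.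
Let nr3 : 3 <= nr. Proof. by rewrite ler_nat. Qed.

Let param_facts : [/\ t <= tau, tau <= tau ^+ n, tau ^+ 2 * tau ^+ 2 <= Th,
  Lam <= 4 * m + nr ^+ 2 * t & expR Lam = 4 * m * tau ^+ n].
Proof.
have ttau : t <= tau by exact: expr_ge.
have tau1 : 1 <= tau by apply: le_trans ttau.
have ktau : tau <= tau ^+ n by exact: expr_ge.
have G0 : 0 < 4 * m * tau ^+ n.
  by rewrite !mulr_gt0 ?(lt_le_trans ltr01 (le_trans tau1 ktau))// ltr0n.
split => //; last by rewrite /Lam /log_const lnK.
  by rewrite -exprD /Th ler_weXn2l//; lia.
have ln_le (x : R) : 0 < x -> ln x <= x.
  by move=> x0; have := expR_ge1Dx (ln x); rewrite lnK//; lra.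
have t0 : 0 < t by apply: lt_le_trans t1.
rewrite /Lam /log_const lnM ?posrE ?mulr_gt0 ?exprn_gt0 ?ltr0n//; apply: lerD.
  by apply: ln_le; rewrite mulr_gt0// ltr0n.
rewrite -exprM lnXn// -[ln t *+ _]mulr_natl natrM -expr2.
by rewrite ler_wpM2l ?ln_le// sqr_ge0.
Qed.

Let param_ineqs : [/\ m <= tau, m * tau ^+ 2 <= Th, 2 * Lam + 5 <= 2 * Th,
  2 * m ^+ 2 <= tau ^+ 2 & 1 <= tau].
Proof.
by have [ttau _ Th4 LamK _] := param_facts; apply: (param_arith m4 nr3 t1 tK).
Qed.

Let connection_lower (a b c d e : R) : 0 < e -> 0 <= a -> 0 <= b -> 0 <= c -> 0 <= d ->
  expR a <= e * b -> expR c <= e * d ->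
  expR (a + c - 2 * ln e) <= b * d.
Proof.
move=> e0 a0 b0 c0 d0 ab cd.
have -> : a + c - 2 * ln e = (a - ln e) + (c - ln e) by ring.
rewrite expRD; apply: ler_pM; rewrite ?expR_ge0// expRD expRN lnK ?posrE// ler_pdivrMr//.
  by rewrite mulrC.
by rewrite mulrC.
Qed.

(** Of the two nonnegative terms, the one kept pairs the solution with turning point t, since m t^n
    = m tau, with the solution for -m tau. Their exponents contain -m tau^2 and +m tau^2, which
    cancel, and nr t tau remains. *)
Lemma connection_lower_pos :
  expR (2 * Th + nr * t * tau - 2 - 2 * Lam) <= normc (connection tau (m * tau)%:C%C).
Proof.
have [ttau ktau Th4 LamK LamE] := param_facts.
have [mtau mTh LTh m2t tau1] := param_ineqs.
have tau0 : 0 <= tau by apply: le_trans tau1.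
have t0tau : 0 <= t <= tau by rewrite ttau (le_trans ler01 t1).
have ze1 : 1 <= m * tau by apply: mulr_ege1 => //; apply: le_trans m4; lra.
have mkap : m * tau <= m * tau ^+ n by rewrite ler_wpM2l.
have mtt : m * tau * tau <= Th by rewrite -mulrA -expr2.
have ntt : 1 <= nr * t * tau.
  by apply: mulr_ege1 => //; apply: mulr_ege1 => //; apply: le_trans nr3; lra.
have hS1 : 1 <= Th - m * tau * tau + nr * t * tau by lra.
have G0 : 0 < 4 * m * tau ^+ n by rewrite -LamE expR_gt0.
have k1 : 2 * (m * tau ^+ n + m * tau) <= 4 * m * tau ^+ n by lra.
have k2 : 2 * (m * tau ^+ n - m * tau) <= 4 * m * tau ^+ n by lra.
have a0 : 0 <= Th - m * tau * tau + nr * t * tau - 1 by lra.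
have mt0 : 1 <= m * tau * tau by apply: mulr_ege1.
have c0 : 0 <= Th + m * tau * tau - 1 by lra.
have E : 2 * Th + nr * t * tau - 2 - 2 * Lam =
   (Th - m * tau * tau + nr * t * tau - 1) + (Th + m * tau * tau - 1) - 2 * Lam by ring.
have hC := @rsol_lower_neg R n (m * tau) tau ze1 tau1.
have hS := @rsol_lower_pos R n t tau t0tau.
have [S0 _] := @rsol_ge0 R n 0 1 (m * tau) tau (lexx 0) ler01 tau0.
have [C0 _] := @rsol_ge0 R n 1 0 (- (m * tau)) tau ler01 (lexx 0) tau0.
have [S0' _] := @rsol_ge0 R n 0 1 (- (m * tau)) tau (lexx 0) ler01 tau0.
have [C0' _] := @rsol_ge0 R n 1 0 (m * tau) tau ler01 (lexx 0) tau0.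
rewrite connection_real normc_real ger0_norm; last first.
  exact: (addr_ge0 (mulr_ge0 C0' S0') (mulr_ge0 S0 C0)).
apply: (@le_trans _ _ (rsol n 0 1 (m * tau) tau * rsol n 1 0 (- (m * tau)) tau)); last first.
  by rewrite lerDr; exact: (mulr_ge0 C0' S0').
have ntE : n%:R * t ^+ n.+1 = nr * t * tau by rewrite exprS mulrA.
rewrite ntE in hS.
rewrite E.
exact: (connection_lower G0 a0 S0 c0 C0 (le_trans (hS hS1) (ler_wpM2r S0 k2))
  (le_trans hC (ler_wpM2r C0 k1))).
Qed.

Lemma connection_lower0 : expR (2 * Th - 4 - 2 * Lam) <= normc (connection tau 0).
Proof.
have [ttau ktau Th4 LamK LamE] := param_facts.
have [mtau mTh LTh m2t tau1] := param_ineqs.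
have tau0 : 0 <= tau by apply: le_trans tau1.
have Th2 : 2 <= Th.
  apply: le_trans mTh; apply: (@le_trans _ _ (4 * 1)); first by lra.
  by apply: ler_pM => //; rewrite exprn_ege1.
have a0 : 0 <= Th - 2 by lra.
have G0 : 0 < 4 * m * tau ^+ n by rewrite -LamE expR_gt0.
have k1 : 2 * (m * tau ^+ n) <= 4 * m * tau ^+ n.
  have k0 : 0 < m * tau ^+ n by move: G0; rewrite -mulrA pmulr_rgt0.
  lra.
have E : 2 * Th - 4 - 2 * Lam = (Th - 2) + (Th - 2) - 2 * Lam by ring.
have hS := @rsol_lower0 R n 0 1 tau (lexx 0) ler01 (add0r 1) tau1 Th2.
have hC := @rsol_lower0 R n 1 0 tau ler01 (lexx 0) (addr0 1) tau1 Th2.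
have [S0 _] := @rsol_ge0 R n 0 1 0 tau (lexx 0) ler01 tau0.
have [C0 _] := @rsol_ge0 R n 1 0 0 tau ler01 (lexx 0) tau0.
rewrite (_ : connection tau 0 = connection tau 0%:C%C)// connection_real oppr0 normc_real ger0_norm; last first.
  exact: (addr_ge0 (mulr_ge0 C0 S0) (mulr_ge0 S0 C0)).
apply: (@le_trans _ _ (rsol n 0 1 0 tau * rsol n 1 0 0 tau)); last first.
  by rewrite lerDr; exact: (mulr_ge0 C0 S0).
rewrite E.
exact: (connection_lower G0 a0 S0 a0 C0 (le_trans hS (ler_wpM2r S0 k1))
  (le_trans hC (ler_wpM2r C0 k1))).
Qed.

Lemma connection_zero_at :
  exists z : R[i], normc z <= tau ^+ 2 /\ normc (connection tau z) <= 2^-1.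
Proof.
have [mtau mTh LTh m2t tau1] := param_ineqs.
have tau0 : 0 <= tau by apply: le_trans tau1.
have r1 : 1 <= tau ^+ 2 by rewrite exprn_ege1.
have [N PN] := pol_approx r1 tau0.
set P := connection_pol tau N in PN.
(* At a root of the truncation the determinant is at most the approximation error 1/2. *)
have [[z [zr Pz]]|noz] := pselect (exists z, normc z <= tau ^+ 2 /\ P.[z] = 0).
  by exists z; split => //; have := PN z zr; rewrite Pz sub0r normcN.
exfalso.
have Pnz z : normc z <= tau ^+ 2 -> P.[z] != 0.
  by move=> zr; apply/eqP => Pz; apply: noz; exists z.
have half (y : R) z : normc z <= tau ^+ 2 -> 0 <= y -> expR y <= normc (connection tau z) ->
    y - 1 <= ln (normc P.[z]).
  move=> zr y0 hy; apply: half_ln y0 _ _ hy; first by rewrite normc_gt0 Pnz.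
  have := le_normcD (connection tau z - P.[z]) P.[z]; rewrite subrK => /le_trans; apply.
  by rewrite lerD2r normcB PN.
have ze0 : 0 <= m * tau by rewrite mulr_ge0.
have zer : 0 <= m * tau < tau ^+ 2.
  rewrite ze0 /= expr2 ltr_pM2r; last by apply: lt_le_trans tau1.
  have h2 : 2 * m * m <= tau * tau by rewrite -mulrA -!expr2.
  have := m4; nra.
have tau20 : 0 < tau ^+ 2 by apply: lt_le_trans r1.
have n0 : normc (0 : R[i]) <= tau ^+ 2 by rewrite normc0 ltW.
have P00 : 0 < normc P.[0] by rewrite normc_gt0 Pnz.
pose M := 2 * expR (tau ^+ 2 * tau + Th) ^+ 2.
have M0 : 0 < M by rewrite mulr_gt0 ?exprn_gt0 ?expR_gt0.
have hM z : normc z <= tau ^+ 2 -> normc P.[z] <= M by exact: pol_bound.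
have H := harnack_even tau20 zer M0 (pol_even _ _) Pnz hM.
have [ttau _ Th4 LamK _] := param_facts.
apply: (@no_zero_contradiction _ m nr t tau Th Lam m4 nr3 t1 tK ttau Th4 LamK (ln (normc P.[0])) (ln (normc P.[(m * tau)%:C%C])) (ln M)
   ((m * tau / tau ^+ 2) ^+ 2)) => //.
- have -> : 2 * Th + nr * t * tau - 3 - 2 * Lam = 2 * Th + nr * t * tau - 2 - 2 * Lam - 1 by ring.
  apply: half; [by rewrite normc_real ger0_norm//; case/andP: zer => _ /ltW| |exact: connection_lower_pos].
  have : 0 <= nr * t * tau by rewrite !mulr_ge0//; apply: le_trans t1.
  lra.
- have -> : 2 * Th - 5 - 2 * Lam = 2 * Th - 4 - 2 * Lam - 1 by ring.
  apply: half => //; [lra|exact: connection_lower0].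
(* At z = 0 the bound for the unit disc applies, with tau in place of tau^3 in the exponent. *)
- apply: le_trans (ln_2expR _); rewrite ler_ln ?posrE ?mulr_gt0 ?exprn_gt0 ?expR_gt0//.
  have n01' : normc (0 : R[i]) <= 1 := n01.
  by have := @pol_bound tau 1 N 0 (lexx 1) tau0 n01'; rewrite mul1r.
- exact: ln_2expR.
- by rewrite ler_ln ?posrE// hM.
- by field; rewrite gt_eqF//; apply: lt_le_trans tau1.
- by rewrite sqr_ge0.
Qed.

End LargeDisc.

Lemma connection_zero : exists T0 : nat, forall T : nat, (T0 <= T)%N ->
  exists z : R[i], normc z <= (T%:R ^+ n) ^+ 2 /\ normc (connection (T%:R ^+ n) z) <= 2^-1.
Proof.
exists (Num.bound Kc).+1 => T T0T.
have Kc0 : 0 <= Kc by rewrite /Kc !addr_ge0 ?mulr_ge0 ?addr_ge0 ?mulr_ge0 ?exprn_ge0.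
apply: connection_zero_at.
  by rewrite ler1n; apply: leq_trans T0T.
by apply: lt_le_trans (archi_boundP Kc0) _; rewrite ler_nat ltnW.
Qed.

End Zero.

(** * Solutions of moderate growth *)

Section Growth.
Context {R : realType}.

(** The vector (be, -al), scaled to maximum 1 by mu = max (|al|, |be|), annihilates the first row
    and sends the second to the determinant over mu, up to sign: at most 1 if mu > 1/2. If the first
    row is small, exchange the rows; if all entries are at most 1/2, (1, 0) works. *)
Lemma near_singular (al be ga de : R[i]) : normc (al * de - be * ga) <= 2^-1 ->
  exists a b : R[i], [/\ normc a <= 1, normc b <= 1, (normc a = 1 \/ normc b = 1),
    normc (a * al + b * be) <= 1 & normc (a * ga + b * de) <= 1].
Proof.
have key (p q r s : R[i]) : normc (p * s - q * r) <= 2^-1 -> 2^-1 < normc p \/ 2^-1 < normc q ->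
    exists a b : R[i], [/\ normc a <= 1, normc b <= 1, (normc a = 1 \/ normc b = 1),
    normc (a * p + b * q) <= 1 & normc (a * r + b * s) <= 1].
  move=> h pq; pose mu := Num.max (normc p) (normc q).
  have mu2 : 2^-1 < mu by rewrite /mu lt_max; case: pq => ->; rewrite ?orbT.
  have mu0 : 0 < mu by lra.
  have munz : mu != 0 by rewrite gt_eqF.
  have nmu (x : R[i]) : normc (x / mu%:C%C) = normc x / mu.
    by rewrite normcM normcV normc_real gtr0_norm.
  have cmu : mu%:C%C != 0 :> R[i].
    by rewrite -normc_gt0 normc_real gtr0_norm.
  exists (q / mu%:C%C), (- p / mu%:C%C); split.
  - by rewrite nmu ler_pdivrMr// mul1r /mu le_max lexx orbT.
  - by rewrite nmu normcN ler_pdivrMr// mul1r /mu le_max lexx.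
  - rewrite !nmu normcN /mu; case: (leP (normc p) (normc q)) => c.
      by left; rewrite divff// gt_eqF//; move: mu0; rewrite /mu; case: (leP (normc p)) c; lra.
    by right; rewrite divff// gt_eqF//; move: mu0; rewrite /mu; case: (leP (normc p)) c; lra.
  - have -> : q / mu%:C%C * p + - p / mu%:C%C * q = 0 by ring.
    by rewrite normc0.
  have -> : q / mu%:C%C * r + - p / mu%:C%C * s = - (p * s - q * r) / mu%:C%C by ring.
  rewrite nmu normcN ler_pdivrMr// mul1r; lra.
move=> h.
have [h1|h1] := boolP ((2^-1 < normc al) || (2^-1 < normc be)).
  by apply: key => //; apply/orP.
have [h2|h2] := boolP ((2^-1 < normc ga) || (2^-1 < normc de)).
  have h' : normc (ga * be - de * al) <= 2^-1.
    by rewrite normcB (mulrC de) (mulrC ga).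
  by have [a [b [? ? ? ? ?]]] := key _ _ _ _ h' (orP h2); exists a, b.
exists 1, 0; rewrite normc1 normc0 !mul1r !mul0r !addr0.
move: h1 h2; rewrite !negb_or -!leNgt => /andP[? ?] /andP[? ?].
split => //; [by left|lra|lra].
Qed.

(** A value above both ends would make the slope positive somewhere before it and negative somewhere
    after. *)
Lemma convex_max (g g1 g2 : R -> R) (a b s : R) : a <= s <= b ->
  (forall t : R, a <= t <= b -> is_derive t 1 g (g1 t)) ->
  (forall t : R, a <= t <= b -> is_derive t 1 g1 (g2 t)) ->
  (forall t : R, a <= t <= b -> 0 <= g2 t) -> g s <= Num.max (g a) (g b).
Proof.
move=> /andP[as_ sb] d1 d2 g20; rewrite leNgt; apply/negP; rewrite gt_max => /andP[ga gb].
have [c /andP[ac cs] E1] := der_MVT as_ (fun t h => d1 t (let: conj p q := andP h in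
   introT andP (conj p (le_trans q sb)))).
have [d /andP[sd db] E2] := der_MVT sb (fun t h => d1 t (let: conj p q := andP h in
   introT andP (conj (le_trans as_ p) q))).
have cd : c <= d := le_trans cs sd.
have : g1 c <= g1 d.
  apply: (der_ge0_le cd) => t /andP[ct td].
    by apply: d2; rewrite (le_trans ac ct) (le_trans td db).
  by apply: g20; rewrite (le_trans ac ct) (le_trans td db).
have p1 : 0 < g1 c * (s - a) by rewrite -E1 subr_gt0.
have p2 : g1 d * (b - s) < 0 by rewrite -E2 subr_lt0.
have sa0 : 0 <= s - a by rewrite subr_ge0.
have bs0 : 0 <= b - s by rewrite subr_ge0.
have g1c : 0 < g1 c by rewrite ltNge; apply/negP => h; have := mulr_le0_ge0 h sa0; rewrite leNgt p1.
have g1d : g1 d < 0 by rewrite ltNge; apply/negP => h; have := mulr_ge0 h bs0; rewrite leNgt p2.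
by move=> /(lt_le_trans g1c)/lt_trans/(_ g1d); rewrite ltxx.
Qed.

(** When f'' = Q f, the second derivative of |f|^2 is 2 (|f'|^2 + Re Q |f|^2). *)
Lemma normc_convex_max (f f1 : R -> R[i]) (Q : R -> R[i]) (a b s B : R) : a <= s <= b ->
  (forall t : R, a <= t <= b -> cderiv f t (f1 t)) ->
  (forall t : R, a <= t <= b -> cderiv f1 t (Q t * f t)) ->
  (forall t : R, a <= t <= b -> 0 <= complex.Re (Q t)) ->
  normc (f a) <= B -> normc (f b) <= B -> normc (f s) <= B.
Proof.
move=> asb d1 d2 Q0 fa fb.
have B0 : 0 <= B := le_trans (normc_ge0 _) fa.
pose A t := complex.Re (f t); pose C t := complex.Im (f t).
pose A1 t := complex.Re (f1 t); pose C1 t := complex.Im (f1 t).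
have h := @convex_max (fun t => A t ^+ 2 + C t ^+ 2)
  (fun t => 2 * (A t * A1 t + C t * C1 t))
  (fun t => 2 * (A1 t ^+ 2 + C1 t ^+ 2 + complex.Re (Q t) * (A t ^+ 2 + C t ^+ 2))) a b s asb.
rewrite -(@ler_pXn2r _ 2) ?nnegrE ?normc_ge0//.
have -> : normc (f s) ^+ 2 = A s ^+ 2 + C s ^+ 2 by rewrite cnormsq.
apply: (le_trans (h _ _ _)).
- move=> t t01; have [dA dC] := d1 t t01.
  apply: (der_ext (derD (derX 2 dA) (derX 2 dC))) => //=; rewrite !expr1.
  by rewrite -/(A t) -/(C t) -/(A1 t) -/(C1 t); ring.
- move=> t t01; have [dA dC] := d1 t t01; have [dA1 dC1] := d2 t t01.
  apply: (der_ext (derZ 2 (derD (derM dA dA1) (derM dC dC1)))) => //.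
  rewrite cReM cImM -/(A t) -/(C t) -/(A1 t) -/(C1 t); ring.
- move=> t t01; rewrite mulr_ge0// !addr_ge0 ?sqr_ge0// mulr_ge0 ?Q0//.
  by rewrite addr_ge0 ?sqr_ge0.
by rewrite ge_max -!cnormsq !lerXn2r ?nnegrE ?normc_ge0.
Qed.

(** For real functions f'(0) = f(1) - f(0) - c f''(d) with c, d in [0, 1]; the outer factor 2 joins
    real and imaginary parts. It serves to show that a solution small on [0, 1] has small initial
    data. *)
Lemma normc_small_deriv (f f1 f2 : R -> R[i]) (e M : R) :
  (forall t : R, 0 <= t <= 1 -> cderiv f t (f1 t)) ->
  (forall t : R, 0 <= t <= 1 -> cderiv f1 t (f2 t)) ->
  (forall t : R, 0 <= t <= 1 -> normc (f t) <= e) ->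
  (forall t : R, 0 <= t <= 1 -> normc (f2 t) <= M) -> 0 <= M ->
  normc (f1 0) <= 2 * (2 * e + M).
Proof.
move=> d1 d2 fe f2M M0.
have real_case (g g1 g2 : R -> R) : (forall t : R, 0 <= t <= 1 -> is_derive t 1 g (g1 t)) ->
   (forall t : R, 0 <= t <= 1 -> is_derive t 1 g1 (g2 t)) ->
   (forall t : R, 0 <= t <= 1 -> `|g t| <= e) ->
   (forall t : R, 0 <= t <= 1 -> `|g2 t| <= M) -> `|g1 0| <= 2 * e + M.
  move=> h1 h2 ge g2M; have [c /andP[c0 c1] E1] := der_MVT ler01 h1.
  have [d /andP[d0 dc] E2] := der_MVT c0 (fun t h => h2 t (let: conj p q := andP h in
     introT andP (conj p (le_trans q c1)))).
  have d01 : 0 <= d <= 1 by rewrite d0 (le_trans dc c1).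
  have g0 : `|g 0| <= e by apply: ge; rewrite lexx ler01.
  have g1' : `|g 1| <= e by apply: ge; rewrite lexx ler01.
  have gc : `|g2 d * (c - 0)| <= M.
    rewrite normrM subr0 (ger0_norm c0) -[leRHS]mulr1; apply: ler_pM => //; exact: g2M.
  have -> : g1 0 = g 1 - g 0 - g2 d * (c - 0) by rewrite E1 -E2; ring.
  apply: le_trans (ler_normB _ _) _; apply: lerD => //.
  apply: le_trans (ler_normB _ _) _; lra.
have r1 : `|complex.Re (f1 0)| <= 2 * e + M.
  apply: (real_case (fun t => complex.Re (f t)) (fun t => complex.Re (f1 t)) (fun t => complex.Re (f2 t))).
  - by move=> t /d1[].
  - by move=> t /d2[].
  - by move=> t /fe; apply: le_trans; exact: normr_Re.
  - by move=> t /f2M; apply: le_trans; exact: normr_Re.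
have r2 : `|complex.Im (f1 0)| <= 2 * e + M.
  apply: (real_case (fun t => complex.Im (f t)) (fun t => complex.Im (f1 t)) (fun t => complex.Im (f2 t))).
  - by move=> t /d1[].
  - by move=> t /d2[].
  - by move=> t /fe; apply: le_trans; exact: normr_Im.
  - by move=> t /f2M; apply: le_trans; exact: normr_Im.
by apply: le_trans (normc_le _) _; rewrite mulr_natl mulr2n; apply: lerD.
Qed.

Variable n : nat.
Hypotheses (n3 : (3 <= n)%N) (on : odd n).

(** The split is at t^2 because |z| <= (t^2)^n. Below it, both terms of the majorant's exponent are
    at most (t^2)^m; above it, m s^n >= 2 |z|, whence Re ((z - m s^n)^2) >= 0 and |f|^2 is
    convex. *)
Let sol_half_bound (t s : R) (z a b : R[i]) : 1 <= t -> normc z <= (t ^+ n) ^+ 2 ->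
  normc a <= 1 -> normc b <= 1 -> normc (sol n a b z (t ^+ n)) <= 1 ->
  0 <= s <= t ^+ n -> normc (sol n a b z s) <= expR (2 * (t ^+ 2) ^+ n.+1).
Proof.
move=> t1 zt a1 b1 f1 /andP[s0 st].
have t0 : 0 <= t by apply: le_trans t1.
have tn1 : 1 <= (t ^+ n) ^+ 2 by rewrite -exprM exprn_ege1.
have small u : 0 <= u <= t ^+ 2 -> normc (sol n a b z u) <= expR (2 * (t ^+ 2) ^+ n.+1).
  move=> /andP[u0 ut]; apply: le_trans (sol_bound n u tn1 a1 b1 zt) _.
  rewrite ler_expR (ger0_norm u0) mulr_natl mulr2n; apply: lerD; last first.
    by apply: lerXn2r; rewrite ?nnegrE// sqr_ge0.
  have -> : (t ^+ n) ^+ 2 = (t ^+ 2) ^+ n by rewrite -!exprM mulnC.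
  rewrite (exprSr (t ^+ 2) n); apply: ler_wpM2l => //.
  by rewrite exprn_ge0// sqr_ge0.
have [st2|st2] := leP s (t ^+ 2); first by apply: small; rewrite s0.
apply: (@normc_convex_max (sol n a b z) (dsol n a b z)
  (fun u => (z - (n.+1%:R * u ^+ n)%:C%C) ^+ 2) (t ^+ 2) (t ^+ n)).
- by rewrite ltW.
- by move=> u _; exact: sol_deriv.
- by move=> u _; exact: dsol_deriv.
- move=> u /andP[tu _].
  have q : 2 * normc z <= n.+1%:R * u ^+ n.
    apply: ler_pM; rewrite ?normc_ge0//.
      by rewrite ler_nat ltnS (leq_trans _ n3).
    apply: le_trans zt _; have -> : (t ^+ n) ^+ 2 = (t ^+ 2) ^+ n by rewrite -!exprM mulnC.
    by apply: lerXn2r; rewrite ?nnegrE ?sqr_ge0 ?(le_trans _ tu) ?sqr_ge0.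
  have E (v : R) : complex.Re ((z - v%:C%C) ^+ 2) = (v - complex.Re z - complex.Im z) * (v - complex.Re z + complex.Im z).
    by case: (z) => x y; rewrite expr2 !cE /= subr0; ring.
  have := normr_Re z; have := normr_Im z; rewrite !ler_norml E.
  move: (n.+1%:R * u ^+ n) (normc z) (complex.Re z) (complex.Im z) q => v N x y vN.
  by move=> /andP[y1 y2] /andP[x1 x2]; apply: mulr_ge0; lra.
- by apply: small; rewrite sqr_ge0 lexx.
by apply: le_trans f1 _; rewrite -[leLHS]expR0 ler_expR mulr_ge0// exprn_ge0// sqr_ge0.
Qed.

Let arith (p q e X : R) : 0 <= X -> e = (5 + 2 * X)^-1 -> (p = 1 \/ q = 1) -> p <= e ->
  q <= 2 * (2 * e + X * e) -> False.
Proof.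
move=> X0 eE pq pe qe; have eX : e * (5 + 2 * X) = 1 by rewrite eE mulVf// gt_eqF//; lra.
have e0 : 0 < e by rewrite eE invr_gt0; lra.
by case: pq => E; rewrite E in pe qe; nra.
Qed.

(** The lower bound e = 1 / (5 + 2 X), with X = (T^{2n} + m)^2, comes from the initial data a =
    f(0), b = f'(0), one of which has modulus 1. If |f| < e on [0, 1], then |f''| <= X e there, so
    |a| <= e and |b| <= 4 e + 2 X e, both below 1. *)
Lemma eigenfunction : exists T0 : nat, forall T : nat, (T0 <= T)%N ->
  exists z a b : R[i], [/\ normc z <= (T%:R ^+ n) ^+ 2,
    (forall s, `|s| <= T%:R ^+ n -> normc (sol n a b z s) <= expR (2 * (T%:R ^+ 2) ^+ n.+1)) &
    exists2 s, 0 <= s <= 1 &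
      (5 + 2 * ((T%:R ^+ n) ^+ 2 + n.+1%:R) ^+ 2)^-1 <= normc (sol n a b z s)].
Proof.
have [T0 hT] := @connection_zero R n n3.
exists T0.+1 => T T0T; have t1 : 1 <= T%:R :> R by rewrite ler1n; case: T T0T.
have [z [zt Dz]] := hT T (ltnW T0T).
pose t : R := T%:R; rewrite -/t in zt Dz t1 *.
have neg (p q u v : R[i]) : normc (p * - v - q * u) = normc (p * v + q * u).
  by rewrite mulrN -opprD normcN.
(* The rows of this matrix give f at s = t^n and at -s; for the second, f(-s) is the value at s of
   the solution with data (a, -b) and parameter -z. *)
have Dz' : normc (sol n 1 0 z (t ^+ n) * - sol n 0 1 (- z) (t ^+ n)
    - sol n 0 1 z (t ^+ n) * sol n 1 0 (- z) (t ^+ n)) <= 2^-1 by rewrite neg.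
have [a [b [a1 b1 ab fp fm]]] := near_singular Dz'.
have fp' : normc (sol n a b z (t ^+ n)) <= 1 by rewrite sol_lin.
have fm' : normc (sol n a (- b) (- z) (t ^+ n)) <= 1.
  by rewrite sol_lin mulNr -mulrN.
exists z, a, b; split => //.
  move=> s st; have [s0|s0] := leP 0 s.
    by apply: sol_half_bound => //; rewrite s0 -(ger0_norm s0).
  rewrite -(opprK s) sol_opp//; apply: sol_half_bound => //; rewrite ?normcN//.
  by rewrite oppr_ge0 (ltW s0) -(ltr0_norm s0).
set e := (_)^-1.
have [//|hno] := pselect (exists2 s : R, 0 <= s <= 1 & e <= normc (sol n a b z s)).
exfalso.
have small s : 0 <= s <= 1 -> normc (sol n a b z s) <= e.
  by move=> s01; rewrite leNgt; apply/negP => h; apply: hno; exists s => //; exact: ltW.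
set r := (t ^+ n) ^+ 2 in zt e hno small; set m : R := n.+1%:R in e hno small.
have r0 : 0 <= r by rewrite sqr_ge0.
have m0 : 0 <= m by [].
pose X := (r + m) ^+ 2.
have X0 : 0 <= X by rewrite sqr_ge0.
have e0 : 0 < e by rewrite invr_gt0; apply: ltr_wpDr; [apply: mulr_ge0|].
have Q u : 0 <= u <= 1 -> normc ((z - (m * u ^+ n)%:C%C) ^+ 2 * sol n a b z u) <= X * e.
  move=> u01; rewrite normcM normcX; apply: ler_pM.
  - by rewrite exprn_ge0 ?normc_ge0.
  - by rewrite normc_ge0.
  - apply: lerXn2r; rewrite ?nnegrE ?normc_ge0 ?addr_ge0//.
    apply: le_trans (ler_normcB _ _) _; apply: lerD => //.
    case/andP: u01 => u0 u1.
    rewrite normc_real ger0_norm ?mulr_ge0 ?exprn_ge0// ler_piMr// exprn_ile1//.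
  - exact: small.
have := @normc_small_deriv (sol n a b z) (dsol n a b z) _ e (X * e)
  (fun u _ => sol_deriv n a b z u) (fun u _ => dsol_deriv n a b z u) small Q (mulr_ge0 X0 (ltW e0)).
have h0 : normc a <= e by rewrite -(sol_0 n a b z) small// lexx ler01.
by rewrite dsol_0; apply: (arith X0 _ ab h0).
Qed.

End Growth.

(** * Integration over the space *)

Section Measurability.
Context {R : realType}.

Local Notation leb := (@lebesgue_measure R).
Local Notation mR := (measurableTypeR R).

Definition grid (N : nat) (x : R) : R := (Num.floor (x * N.+1%:R))%:~R / N.+1%:R.

Lemma grid_cvg (x : R) : (fun N => grid N x) @ \oo --> x.
Proof.
have h N : x - N.+1%:R^-1 <= grid N x <= x.
  have N0 : 0 < N.+1%:R :> R by rewrite ltr0n.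
  rewrite /grid ler_pdivrMr// ler_pdivlMr// mulrBl mulVf ?gt_eqF//.
  have /andP[h1 h2] := floor_itv (x * N.+1%:R).
  by rewrite h1 andbT lerBlDr ltW//; move: h2; rewrite intrD.
apply: (squeeze_cvgr (f := fun N => x - N.+1%:R^-1) (h := fun=> x)).
- by apply: nearW => N; exact: h.
- rewrite -[X in _ --> X]subr0; apply: cvgB; first exact: cvg_cst.
  exact: cvg_harmonic.
- exact: cvg_cst.
Qed.

(** For the product sigma-algebra, h is a pointwise limit of functions that are constant on the
    boxes of a countable grid. *)
Lemma continuous_measurable3 (h : space3 R -> R) : continuous h ->
  measurable_fun [set: (mR * mR * mR)%type] h.
Proof.
move=> ch.
have gc (x y t : R) : (fun N => (grid N x, grid N y, grid N t)) @ \oo --> (x, y, t).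
  exact: (cvg_pair (cvg_pair (@grid_cvg x) (@grid_cvg y)) (@grid_cvg t)).
apply: (@measurable_realfun.measurable_fun_cvg _ _ _ _
   (fun N (p : mR * mR * mR) => h (grid N p.1.1, grid N p.1.2, grid N p.2))); last first.
  by move=> -[[x y] t] _ /=; exact: (cvg_comp _ _ (gc x y t) (ch (x, y, t))).
move=> N _ Y mY; rewrite setTI.
pose cell (k : int) : set R := [set x | Num.floor (x * N.+1%:R) = k].
have mcell k : measurable (cell k : set mR).
  have N0 : 0 < N.+1%:R :> R by rewrite ltr0n.
  have -> : cell k = `[k%:~R / N.+1%:R, (k + 1)%:~R / N.+1%:R[%classic.
    apply/seteqP; split => x; rewrite /cell /= in_itv/= ler_pdivrMr// ltr_pdivlMr//.
      by move=> <-; exact: floor_itv.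
    by move=> xk; exact: floor_def.
  exact: measurable_itv.
pose val (k : int * int * int) : R :=
  h (k.1.1%:~R / N.+1%:R, k.1.2%:~R / N.+1%:R, k.2%:~R / N.+1%:R).
(* Triples of integers are enumerated through [pickle]; numbers encoding no triple contribute
   [set0]. *)
have -> : (fun p : mR * mR * mR => h (grid N p.1.1, grid N p.1.2, grid N p.2)) @^-1` Y =
  \bigcup_i (if unpickle i is Some k then
     if `[< Y (val k) >] then (cell k.1.1 `*` cell k.1.2) `*` cell k.2 else set0 else set0).
  apply/seteqP; split => [[[x y] t] Yp|[[x y] t] [i _]].
    pose k0 : int * int * int :=
      (Num.floor (x * N.+1%:R), Num.floor (y * N.+1%:R), Num.floor (t * N.+1%:R)).
    exists (pickle k0); first exact: I.
    rewrite pickleK; case: asboolP => [_|nY]; first by split.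
    by exfalso; exact: nY.
  case: (unpickle i) => [k|//]; case: asboolP => // Yk [[kx ky] kt].
  by move: Yk kx ky kt; rewrite /val /cell /preimage /grid /= => Yk -> -> ->.
apply: bigcupT_measurable => i; case: (unpickle i) => [k|]; last exact: measurable0.
case: ifP => _; last exact: measurable0.
by apply: measurableX => //; apply: measurableX.
Qed.

End Measurability.

Section BoundedSupport.
Local Open Scope ereal_scope.
Context d (T : measurableType d) (R : realType) (mu : {measure set T -> \bar R}).
Variables (A : set T) (f : T -> R) (B : R).
Hypotheses (mA : measurable A) (Afin : mu A < +oo) (mf : measurable_fun setT f).
Hypotheses (fB : forall x, (`|f x| <= B)%R) (fA : forall x, ~ A x -> f x = 0%R).

Let fE : EFin \o f = (EFin \o f) \_ A.
Proof.
apply/funext => x; rewrite /= patchE; case: ifPn => //.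
by move/negP => nA; rewrite /= fA//; apply: contra_not nA; rewrite inE.
Qed.

Let bddf : mu.-integrable A (EFin \o f).
Proof.
apply: measurable_bounded_integrable => //; first exact: measurable_funTS.
exists B; split; first exact: num_real.
by move=> M BM x _ /=; apply: le_trans (fB x) (ltW BM).
Qed.

Lemma bounded_support_integrable : mu.-integrable setT (EFin \o f).
Proof. by rewrite fE; apply/(integrable_mkcond _ mA). Qed.

Lemma bounded_support_le : (`|\int[mu]_x f x| <= B * fine (mu A))%R.
Proof.
have -> : (\int[mu]_x f x = \int[mu]_(x in A) f x)%R.
  rewrite [RHS]Rintegral_mkcond; apply: eq_Rintegral => x _; rewrite patchE.
  case: ifPn => // /negP nA; rewrite fA//; apply: contra_not nA; rewrite inE.
  by [].
apply: le_trans (le_normr_Rintegral mA bddf) _.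
rewrite -(Rintegral_cst mu mA); apply: le_Rintegral => //.
  exact: integrable_norm.
apply: measurable_bounded_integrable => //.
exists B; split; first exact: num_real.
by move=> M BM x Ax /=; rewrite ger0_norm ?(ltW BM)// (le_trans _ (fB x)).
Qed.

End BoundedSupport.

Section Slices.
Context {R : realType}.

(** A directional derivative sees only the restriction of [F] to a line. One direction slices
    integrands for Fubini, the other builds partial derivatives from one-variable ones. *)
Lemma is_derive_line (V : normedModType R) (F : V -> R) (phi : R -> R) (p v : V) (t d : R) :
  (forall u : R, F (u *: v + p) = phi (u + t)) -> is_derive p v F d <-> is_derive t 1 phi d.
Proof.
move=> E; have E0 : F p = phi t by have := E 0; rewrite scale0r !add0r.
have EQ : (fun h => h^-1 *: ((F \o shift p) (h *: v) - F p)) =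
   (fun h : R => h^-1 *: ((phi \o shift t) (h *: (1 : R)) - phi t)).
  by apply/funext => h /=; rewrite E E0 [h *: 1]mulr1.
split => -[dF DF].
  have dphi : derivable phi t 1 by rewrite /derivable -EQ.
  by split => //; rewrite -DF /derive EQ.
have dF' : derivable F p v by rewrite /derivable EQ.
by split => //; rewrite -DF /derive EQ.
Qed.

Lemma integral_deriv_support (phi phi' : R -> R) :
  (forall x : R, is_derive x 1 phi (phi' x)) -> continuous phi' ->
  (forall x, 1 < `|x| -> phi x = 0 /\ phi' x = 0) ->
  (\int[@lebesgue_measure R]_x (phi' x)%:E = 0)%E.
Proof.
move=> dphi cphi' supp.
(* The interval exceeds [-1, 1], so that phi is known to vanish at its end points. *)
have -> : (\int[@lebesgue_measure R]_x (phi' x)%:E =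
    \int[@lebesgue_measure R]_(x in `[(-2)%R, 2%R]) (phi' x)%:E)%E.
  rewrite [RHS]integral_mkcond; apply: eq_integral => x _; rewrite patchE.
  case: ifPn => //; rewrite mem_setE in_itv/= negb_and -!ltNge => x2.
  suff [_ ->] : phi x = 0 /\ phi' x = 0 by [].
  apply: supp; rewrite ltr_normr; case/orP: x2 => x2; apply/orP; [right|left]; lra.
have cphi (x : R) : {for x, continuous phi} by exact: der_continuous (dphi x).
rewrite (@continuous_FTC2 _ phi' phi)//; first last.
- by move=> x _; rewrite derive1E; case: (dphi x).
- split.
  + by move=> x _; case: (dphi x).
  + by apply: cvg_at_right_filter; exact: cphi.
  + by apply: cvg_at_left_filter; exact: cphi.
- by apply: continuous_subspaceT.
- by lra.
have [-> _] : phi 2 = 0 /\ phi' 2 = 0 by apply: supp; rewrite ger0_norm//; lra.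
have [-> _] : phi (-2) = 0 /\ phi' (-2) = 0 by apply: supp; rewrite normrN ger0_norm//; lra.
by rewrite subee.
Qed.

End Slices.

Section Fubini3.
Local Open Scope ereal_scope.
Context {R : realType} d1 d2 (T1 : measurableType d1) (T2 : measurableType d2).
Variable m1 : {sigma_finite_measure set T1 -> \bar R}.
Variable m2 : {sigma_finite_measure set T2 -> \bar R}.
Variable f : T1 * T2 -> \bar R.
Hypothesis intf : (m1 \x m2).-integrable setT f.

Lemma integral_prod_eq0l : (forall y, \int[m1]_x f (x, y) = 0) ->
  \int[m1 \x m2]_p f p = 0.
Proof.
move=> H; refine (etrans (esym (@integral21_prod_meas1 _ _ _ _ R m1 m2 f intf)) _).
by apply: integral0_eq => y _; exact: H.
Qed.

Lemma integral_prod_eq0r : (forall x, \int[m2]_y f (x, y) = 0) ->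
  \int[m1 \x m2]_p f p = 0.
Proof.
move=> H; refine (etrans (esym (@integral12_prod_meas1 _ _ _ _ R m1 m2 f intf)) _).
by apply: integral0_eq => x _; exact: H.
Qed.
End Fubini3.

Section Plane.
Context {R : realType}.
Local Notation leb := (@lebesgue_measure R).
Local Notation mR := (measurableTypeR R).

(* Fubini's theorem needs a sigma-finite structure, which is not inferred for
   [leb \x leb]. *)
Definition plane_measure : set (mR * mR) -> \bar R := (leb \x leb)%E.

HB.instance Definition _ := Measure.on plane_measure.

Let plane_sigma_finite : sigma_finite setT plane_measure.
Proof.
pose I k : set mR := `[- k%:R, k%:R]%classic.
have mI k : measurable (I k) by exact: measurable_itv.
exists (fun k => I k `*` I k).
  apply/esym; rewrite -subTset => -[x y] _; exists (Num.trunc (Num.max `|x| `|y|)).+1 => //.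
  have [] : `|x| <= (Num.trunc (Num.max `|x| `|y|)).+1%:R /\ `|y| <= (Num.trunc (Num.max `|x| `|y|)).+1%:R.
    by split; apply: le_trans (ltW (truncnS_gt _)); rewrite le_max lexx ?orbT.
  by rewrite !ler_norml /I /= !in_itv.
move=> k; split; first exact: measurableX.
have Ifin : (leb (I k) < +oo)%E.
  by rewrite lebesgue_measure_itv /=; case: ifP => //; rewrite -EFinB ltry.
have -> : plane_measure (I k `*` I k) = (leb (I k) * leb (I k))%E by exact: product_measure1E.
by rewrite lte_mul_pinfty// ge0_fin_numE.
Qed.

HB.instance Definition _ := Measure_isSigmaFinite.Build _ _ _ plane_measure plane_sigma_finite.

End Plane.

Section Integration3.
Context {R : realType}.
Implicit Types (g h : space3 R -> R).

Local Notation leb := (@lebesgue_measure R).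
Local Notation mR := (measurableTypeR R).
Local Notation I := (`[(-1 : R), 1]%classic).

(** Compact, and it contains [ball 0 1] because the product norm is the sup norm. *)
Definition cube : set (space3 R) := (I `*` I) `*` I.

Lemma cubeP (x y t : R) : cube (x, y, t) <-> [/\ `|x| <= 1, `|y| <= 1 & `|t| <= 1].
Proof.
by rewrite /cube /= !in_itv/= -!ler_norml; split => [[[]]|[]].
Qed.

Definition cube_supported h : Prop := continuous h /\ forall p, ~ cube p -> h p = 0.

Definition vol : R := fine (lebesgue3 R cube).

Let mI : measurable (I : set mR). Proof. exact: measurable_itv. Qed.

Let mcube : measurable (cube : set (mR * mR * mR)).
Proof. by apply: measurableX => //; apply: measurableX. Qed.

Let I2 : leb I = 2%:E.
Proof.
rewrite lebesgue_measure_itv /= ifT; last by rewrite lte_fin; lra.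
by rewrite -EFinB; congr EFin; ring.
Qed.

Let box_measure (A B C : set mR) (a : R) : measurable A -> measurable B -> measurable C ->
  leb A = a%:E -> leb B = a%:E -> leb C = a%:E ->
  (leb \x leb)%E (A `*` B) = (a * a)%:E /\ lebesgue3 R ((A `*` B) `*` C) = (a * a * a)%:E.
Proof.
move=> mA mB mC Aa Ba Ca.
have E : (leb \x leb)%E (A `*` B) = (a * a)%:E.
  by rewrite EFinM -{1}Aa -Ba; exact: product_measure1E.
split => //; rewrite EFinM -E -Ca; apply: product_measure1E => //; exact: measurableX.
Qed.

Let square_fin : ((leb \x leb)%E (I `*` I) < +oo)%E.
Proof. by have [-> _] := box_measure mI mI mI I2 I2 I2; rewrite ltry. Qed.

Let cube_fin : (lebesgue3 R cube < +oo)%E.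
Proof. by have [_ ->] := box_measure mI mI mI I2 I2 I2; rewrite ltry. Qed.

Lemma cube_supported_bounded h : cube_supported h -> exists B, forall p, `|h p| <= B.
Proof.
move=> [ch h0].
have cI : compact (I : set R) by exact: segment_compact.
have cc : compact cube by apply: compact_setX => //; apply: compact_setX.
have /compact_bounded[M [_ hM]] := continuous_compact (continuous_subspaceT ch) cc.
exists (Num.max 0 (M + 1)) => p; have [cp|ncp] := pselect (cube p).
  by rewrite le_max; apply/orP; right; apply: hM; [rewrite ltrDl|exists p].
by rewrite h0// normr0 le_max lexx.
Qed.

Lemma cube_supported_integrable h : cube_supported h ->
  (lebesgue3 R).-integrable setT (EFin \o h).
Proof.
move=> hc; have [B hB] := cube_supported_bounded hc; case: hc => ch h0.
apply: (@bounded_support_integrable _ (mR * mR * mR)%type R (lebesgue3 R) cube h B) => //.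
exact: continuous_measurable3.
Qed.

Lemma cube_supported_le h B : cube_supported h -> (forall p, `|h p| <= B) ->
  `|Rintegral (lebesgue3 R) setT h| <= B * vol.
Proof.
move=> [ch h0] hB.
apply: (@bounded_support_le _ (mR * mR * mR)%type R (lebesgue3 R) cube h B) => //.
exact: continuous_measurable3.
Qed.

Let slice_x (y t : R) : continuous (fun x : R => (x, y, t) : space3 R).
Proof. by move=> x; exact: (cvg_pair (cvg_pair cvg_id (@cvg_cst _ y _ _ _)) (@cvg_cst _ t _ _ _)). Qed.
Let slice_y (x t : R) : continuous (fun y : R => (x, y, t) : space3 R).
Proof. by move=> y; exact: (cvg_pair (cvg_pair (@cvg_cst _ x _ _ _) cvg_id) (@cvg_cst _ t _ _ _)). Qed.
Let slice_t (x y : R) : continuous (fun t : R => (x, y, t) : space3 R).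
Proof. by move=> t; exact: (cvg_pair (cvg_pair (@cvg_cst _ x _ _ _) (@cvg_cst _ y _ _ _)) cvg_id). Qed.

Let slice_integrable h (t : R) : cube_supported h ->
  (leb \x leb)%E.-integrable setT (EFin \o (fun q : mR * mR => h (q, t))).
Proof.
move=> hc; have [B hB] := cube_supported_bounded hc; case: hc => ch h0.
apply: (@bounded_support_integrable _ (mR * mR)%type R (leb \x leb)%E (I `*` I) _ B) => //.
- exact: measurableX.
- exact: (measurable_fun_pair1 t (continuous_measurable3 ch)).
- move=> [x y] nI; apply: h0; apply: contra_not nI => -[[? ?] ?]; by split.
Qed.

(** By Fubini the variable of differentiation is integrated innermost, where a derivative of bounded
    support has integral 0. *)
Lemma integral_partial (i : 'I_3) h g : cube_supported h -> cube_supported g ->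
  (forall p, is_derive p (axis i) h (g p)) -> Rintegral (lebesgue3 R) setT g = 0.
Proof.
move=> hc gc dh; have [ch h0] := hc; have [cg g0] := gc.
have intg := cube_supported_integrable gc.
have out x y t : (1 < `|x| \/ 1 < `|y| \/ 1 < `|t|) -> h (x, y, t) = 0 /\ g (x, y, t) = 0.
  move=> o; have nc : ~ cube (x, y, t).
    by rewrite cubeP => -[]; rewrite !leNgt => /negP ? /negP ? /negP ?; case: o => [|[]].
  by rewrite h0// g0.
have lineE (a b c x y t u : R) : u *: ((a, b, c) : space3 R) + (x, y, t) =
  (u * a + x, u * b + y, u * c + t) by [].
rewrite /Rintegral.
have -> // : (\int[lebesgue3 R]_p (g p)%:E = 0)%E.
case: i dh => -[|[|[|//]]] i3 dh.
- refine (@integral_prod_eq0l R _ _ _ _ plane_measure leb _ intg _) => t.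
  refine (@integral_prod_eq0l R _ _ _ _ leb leb _ (slice_integrable t gc) _) => y /=.
  apply: (@integral_deriv_support _ (fun x => h (x, y, t))).
  + move=> x; refine (proj1 (is_derive_line (p := (x, y, t)) (v := axis (Ordinal i3)) _ _) (dh _)).
    by move=> u; rewrite /axis lineE /= !mulr0 !add0r mulr1.
  + by move=> x; apply: (cvg_comp _ _ (@slice_x y t x) (cg (x, y, t))).
  + by move=> x x1; apply: out; left.
- refine (@integral_prod_eq0l R _ _ _ _ plane_measure leb _ intg _) => t.
  refine (@integral_prod_eq0r R _ _ _ _ leb leb _ (slice_integrable t gc) _) => x /=.
  apply: (@integral_deriv_support _ (fun y => h (x, y, t))).
  + move=> y; refine (proj1 (is_derive_line (p := (x, y, t)) (v := axis (Ordinal i3)) _ _) (dh _)).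
    by move=> u; rewrite /axis lineE /= !mulr0 !add0r mulr1.
  + by move=> y; apply: (cvg_comp _ _ (@slice_y x t y) (cg (x, y, t))).
  + by move=> y y1; apply: out; right; left.
refine (@integral_prod_eq0r R _ _ _ _ plane_measure leb _ intg _) => -[x y] /=.
apply: (@integral_deriv_support _ (fun t => h (x, y, t))).
- move=> t; refine (proj1 (is_derive_line (p := (x, y, t)) (v := axis (Ordinal i3)) _ _) (dh _)).
  by move=> u; rewrite /axis lineE /= !mulr0 !add0r mulr1.
- by move=> t; apply: (cvg_comp _ _ (@slice_t x y t) (cg (x, y, t))).
- by move=> t t1; apply: out; right; right.
Qed.

Lemma integral_pos h (x y t e d : R) : cube_supported h -> (forall p, 0 <= h p) ->
  0 < e -> 0 < d ->
  (forall p, `|p.1.1 - x| <= e -> `|p.1.2 - y| <= e -> `|p.2 - t| <= e -> d <= h p) ->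
  0 < Rintegral (lebesgue3 R) setT h.
Proof.
move=> hc h0 e0 d0 hd; have inth := cube_supported_integrable hc.
pose J (a : R) : set mR := `[a - e, a + e]%classic.
pose Q : set (mR * mR * mR) := (J x `*` J y) `*` J t.
have mJ a : measurable (J a) by exact: measurable_itv.
have JE a : leb (J a) = (2 * e)%:E.
  rewrite lebesgue_measure_itv /= ifT; last by rewrite lte_fin; lra.
  by rewrite -EFinB; congr EFin; ring.
have mQ : measurable Q by apply: measurableX => //; apply: measurableX.
have QE : lebesgue3 R Q = (2 * e * (2 * e) * (2 * e))%:E.
  by have [_ ->] := box_measure (mJ x) (mJ y) (mJ t) (JE x) (JE y) (JE t).
have Qfin : (lebesgue3 R Q < +oo)%E by rewrite QE ltry.
have intd : (lebesgue3 R).-integrable setT (EFin \o (fun p => d * \1_Q p)).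
  apply: (@bounded_support_integrable _ (mR * mR * mR)%type R (lebesgue3 R) Q _ d) => //.
  - by apply: measurable_funM => //; exact: measurable_indic.
  - move=> p; rewrite normrM (gtr0_norm d0) ler_piMr ?(ltW d0)// indicE.
    by case: (p \in Q); rewrite ?normr1 ?normr0.
  - by move=> p nQ; rewrite indicE memNset// mulr0.
apply: (@lt_le_trans _ _ (Rintegral (lebesgue3 R) setT (fun p => d * \1_Q p))); last first.
  apply: le_Rintegral => // p _; rewrite indicE; case: (boolP (p \in Q)) => [|_]; last by rewrite mulr0.
  rewrite inE => -[[+ +] +]; rewrite mulr1 /J /= !in_itv/= => /andP[? ?] /andP[? ?] /andP[? ?].
  by apply: hd; rewrite ler_distl; apply/andP; split.
have ind : (lebesgue3 R).-integrable setT (EFin \o \1_Q).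
  apply: (@bounded_support_integrable _ (mR * mR * mR)%type R (lebesgue3 R) Q _ 1) => //.
  - by move=> p; rewrite indicE; case: (p \in Q); rewrite ?normr1 ?normr0.
  - by move=> p nQ; rewrite indicE memNset.
have -> : Rintegral (lebesgue3 R) setT (fun p => d * \1_Q p) =
  d * Rintegral (lebesgue3 R) setT \1_Q by exact: RintegralZl.
have -> : Rintegral (lebesgue3 R) setT \1_Q = 2 * e * (2 * e) * (2 * e).
  by rewrite -[RHS]/(fine (EFin _)) -QE; congr fine; rewrite -[in RHS](setIT Q); exact: integral_indic.
by rewrite !mulr_gt0.
Qed.

End Integration3.

(** * Finite differences *)

Section FiniteDifferences.
Context {R : realType}.
Implicit Types (phi psi : R -> R[i]) (t h : R).

(** Each step differences the function rather than the result, so that induction on [k] may change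
    [phi]. The factor 1/2 makes every step a contraction for the sup norm. *)
Fixpoint fdiff h (k : nat) phi t : R[i] :=
  if k is k'.+1 then fdiff h k' (fun s => (2^-1)%:C%C * (phi (s + h) - phi s)) t else phi t.

Let in_step h (k : nat) t s : 0 <= h -> t <= s <= t + k%:R * h ->
  (t <= s <= t + k.+1%:R * h) /\ (t <= s + h <= t + k.+1%:R * h).
Proof. by move=> h0; rewrite -natr1 mulrDl mul1r => /andP[? ?]; split; lra. Qed.

Lemma eq_fdiff h k phi psi t : phi =1 psi -> fdiff h k phi t = fdiff h k psi t.
Proof. by move=> /funext ->. Qed.

Lemma fdiff_bound h k phi t (B : R) : 0 <= h ->
  (forall s : R, t <= s <= t + k%:R * h -> normc (phi s) <= B) ->
  normc (fdiff h k phi t) <= B.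
Proof.
move=> h0; elim: k phi => [|k IH] phi pB /=; first by apply: pB; rewrite mul0r addr0 lexx.
apply: IH => s sk; have [s1 s2] := in_step h0 sk.
rewrite normcM normc_real gtr0_norm ?invr_gt0//.
have := le_trans (ler_normcB (phi (s + h)) (phi s)) (lerD (pB _ s2) (pB _ s1)).
move: (normc _) => u u2; lra.
Qed.

Lemma fdiff_lin h k (a : R[i]) phi psi t :
  fdiff h k (fun s => a * phi s + psi s) t = a * fdiff h k phi t + fdiff h k psi t.
Proof.
elim: k phi psi => //= k IH phi psi; rewrite -IH; apply: eq_fdiff => s; ring.
Qed.

Lemma fdiff0 h k t : fdiff h k (fun=> 0) t = 0.
Proof. by elim: k => //= k IH; rewrite subrr mulr0. Qed.

Lemma fdiff_sum h k N (a : nat -> R[i]) (phi : nat -> R -> R[i]) t :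
  fdiff h k (fun s => \sum_(i < N) a i * phi i s) t = \sum_(i < N) a i * fdiff h k (phi i) t.
Proof.
elim: N => [|N IH]; first by rewrite big_ord0 -[RHS](fdiff0 h k t); apply: eq_fdiff => s; rewrite big_ord0.
rewrite big_ord_recr /= addrC -IH -fdiff_lin; apply: eq_fdiff => s.
by rewrite big_ord_recr /= addrC.
Qed.

Lemma fdiff_exp h k phi (w : R[i]) t : (forall s, phi (s + h) = w * phi s) ->
  fdiff h k phi t = ((2^-1)%:C%C * (w - 1)) ^+ k * phi t.
Proof.
elim: k phi => [|k IH] phi pw /=; first by rewrite expr0 mul1r.
rewrite IH => [|s]; last by rewrite !pw; ring.
by rewrite pw exprS; ring.
Qed.

(** One difference turns the power d into a combination of lower powers. *)
Lemma fdiff_pow h k d t : (d < k)%N -> fdiff h k (fun s => (s ^+ d)%:C%C) t = 0.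
Proof.
elim: k d => // k IH d; rewrite ltnS => dk /=.
transitivity (fdiff h k (fun s => \sum_(i < d)
  ((2^-1)%:C%C * (h ^+ (d - i) *+ 'C(d, i))%:C%C) * (s ^+ i)%:C%C) t).
  apply: eq_fdiff => s; rewrite -rmorphB -rmorphM /= (addrC s) exprDn big_ord_recr /=.
  rewrite subnn binn expr0 mul1r mulr1n addrK mulr_sumr rmorph_sum /=; apply: eq_bigr => i _.
  by rewrite -!rmorphM /= -mulrA mulrnAl.
rewrite (@fdiff_sum _ _ _ (fun i => (2^-1)%:C%C * (h ^+ (d - i) *+ 'C(d, i))%:C%C)
  (fun i s => (s ^+ i)%:C%C)) big1// => i _.
by rewrite IH ?mulr0// (leq_trans (ltn_ord i)).
Qed.

(** Powers below k are killed; for d >= k the trivial bound (k h)^d = r^d (k h / r)^d is at most r^d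
    (k h / r)^k, as k h / r <= 1. The factor r^d lets the bounds be summed against a power series
    converging absolutely at radius r. *)
Lemma fdiff_pow_le h k d (r : R) : 0 <= h -> 0 < r -> k%:R * h <= r ->
  normc (fdiff h k (fun s => (s ^+ d)%:C%C) 0) <= r ^+ d * (k%:R * h / r) ^+ k.
Proof.
move=> h0 r0 khr; set e := k%:R * h / r.
have kh0 : 0 <= k%:R * h by rewrite mulr_ge0.
have e0 : 0 <= e by rewrite divr_ge0// ltW.
have e1 : e <= 1 by rewrite ler_pdivrMr ?mul1r.
have [dk|kd] := ltnP d k; first by rewrite fdiff_pow// normc0 mulr_ge0// exprn_ge0// ltW.
apply: fdiff_bound => // s /andP[s0]; rewrite add0r => s1.
rewrite normc_real ger0_norm ?exprn_ge0//.
apply: (@le_trans _ _ (r ^+ d * e ^+ d)); last first.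
  by apply: ler_wpM2l; [rewrite exprn_ge0// ltW|apply: ler_wiXn2l].
have re : r * e = k%:R * h by rewrite /e mulrC divfK// gt_eqF.
by rewrite -exprMn re lerXn2r ?nnegrE.
Qed.

Lemma fdiff_ccvg h k (phi : nat -> R -> R[i]) psi t : 0 <= h ->
  (forall s : R, t <= s <= t + k%:R * h -> ccvg (fun N => phi N s) (psi s)) ->
  ccvg (fun N => fdiff h k (phi N) t) (fdiff h k psi t).
Proof.
move=> h0; elim: k phi psi => [|k IH] phi psi pc /=.
  by apply: pc; rewrite mul0r addr0 lexx.
apply: IH => s sk; have [s1 s2] := in_step h0 sk.
apply: ccvgZ; have := ccvgD (pc _ s2) (ccvgZ (-1) (pc _ s1)).
by under eq_fun do rewrite mulN1r; rewrite mulN1r.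
Qed.

Lemma fdiff_psum c (x y h r : R) (k N : nat) : 0 <= h -> 0 < r -> k%:R * h <= r ->
  `|x| <= r -> `|y| <= r ->
  normc (fdiff h k (fun t => psum c (x, y, t) N) 0) <=
  psum_abs c (r, r, r) N * (k%:R * h / r) ^+ k.
Proof.
move=> h0 r0 khr xr yr; have r0' := ltW r0.
pose u a b d s := (c a b d * (x ^+ a * y ^+ b)%:C%C) * (s ^+ d)%:C%C.
have E t : psum c (x, y, t) N = \sum_(a < N) 1 * (\sum_(b < N) 1 * (\sum_(d < N) u a b d t)).
  apply: eq_bigr => a _; rewrite mul1r; apply: eq_bigr => b _; rewrite mul1r.
  by apply: eq_bigr => d _; rewrite /u !rmorphM /= -!mulrA.
rewrite (eq_fdiff _ _ _ E).
rewrite (@fdiff_sum h k N (fun=> 1) (fun a s => \sum_(b < N) 1 * (\sum_(d < N) u a b d s))).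
rewrite /psum_abs mulr_suml; apply: le_trans (normc_sum _ _ _) _; apply: ler_sum => a _.
rewrite mul1r (@fdiff_sum h k N (fun=> 1) (fun b s => \sum_(d < N) u a b d s)).
rewrite mulr_suml; apply: le_trans (normc_sum _ _ _) _; apply: ler_sum => b _.
rewrite mul1r (@fdiff_sum h k N (fun d => c a b d * (x ^+ a * y ^+ b)%:C%C) (fun d s => (s ^+ d)%:C%C)).
rewrite mulr_suml; apply: le_trans (normc_sum _ _ _) _; apply: ler_sum => d _ /=.
rewrite !normcM !normc_real -[leRHS]mulrA -[leLHS]mulrA; apply: ler_wpM2l; first exact: normc_ge0.
rewrite (_ : `|r ^+ a * r ^+ b * r ^+ d| = r ^+ a * r ^+ b * r ^+ d); last first.
  by rewrite ger0_norm// !mulr_ge0// exprn_ge0.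
rewrite normrM !normrX -[leRHS]mulrA.
apply: ler_pM; [apply: mulr_ge0; exact: exprn_ge0|exact: normc_ge0| |exact: fdiff_pow_le].
by apply: ler_pM; rewrite ?exprn_ge0// lerXn2r ?nnegrE.
Qed.

End FiniteDifferences.

(** * Bump functions *)

Lemma coord_x_continuous (R : realType) : continuous (fun p : space3 R => p.1.1).
Proof.
by move=> p; apply: (@continuous_comp _ _ _ fst fst); [exact: cvg_fst|exact: cvg_fst].
Qed.

Lemma coord_y_continuous (R : realType) : continuous (fun p : space3 R => p.1.2).
Proof.
by move=> p; apply: (@continuous_comp _ _ _ fst snd); [exact: cvg_fst|exact: cvg_snd].
Qed.

Lemma coord_t_continuous (R : realType) : continuous (fun p : space3 R => p.2).
Proof. by move=> p; exact: cvg_snd. Qed.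

Section Bumps.
Context {R : realType}.
Implicit Types (P : {poly R}) (x : R).

(** Closed under differentiation, which acts on [P] as (P - P') X^2; [flat 1] is the usual
    e^{-1/x}. *)
Definition flat P x : R := if 0 < x then P.[x^-1] * expR (- x^-1) else 0.

(** With y = k w this is w^k <= e^{k w}. *)
Let pow_expR (k : nat) (y : R) : 0 <= y -> y ^+ k <= k%:R ^+ k * expR y.
Proof.
move=> y0; case: k => [|k]; first by rewrite !expr0 mul1r -expR0 ler_expR.
have [w w0 ->] : exists2 w, 0 <= w & y = k.+1%:R * w.
  by exists (y / k.+1%:R); [exact: divr_ge0|rewrite mulrC divfK// pnatr_eq0].
rewrite expRM_natl exprMn; apply: ler_wpM2l; first exact: exprn_ge0.
by rewrite lerXn2r ?nnegrE ?expR_ge0//; apply: le_trans (expR_ge1Dx _); rewrite lerDr.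
Qed.

(** Quadratic smallness gives the derivative 0 at the gluing point. *)
Lemma flat_bound P : exists C, forall x, `|flat P x| <= C * x ^+ 2.
Proof.
exists (\sum_(i < size P) `|P`_i| * i.+2%:R ^+ i.+2) => x; rewrite /flat.
have C0 : 0 <= \sum_(i < size P) `|P`_i| * i.+2%:R ^+ i.+2.
  by apply: sumr_ge0 => i _; rewrite mulr_ge0// exprn_ge0.
case: ltP => [x0|_]; last by rewrite normr0 mulr_ge0// sqr_ge0.
rewrite horner_coef !mulr_suml; apply: le_trans (ler_norm_sum _ _ _) _; apply: ler_sum => i _.
move: (@pow_expR i.+2); move: (i.+2%:R ^+ i.+2) => K HK.
rewrite !normrM -!mulrA; apply: ler_wpM2l => //.
have y0 : 0 < x^-1 by rewrite invr_gt0.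
rewrite normrX (gtr0_norm y0) (gtr0_norm (expR_gt0 _)) expRN.
rewrite ler_pdivrMr ?expR_gt0//.
(* Two extra inverse powers are traded for x^2, whence the constants (i + 2)^(i + 2). *)
have -> : x^-1 ^+ i = x^-1 ^+ i.+2 * x ^+ 2.
  by rewrite -addn2 exprD -mulrA -exprMn mulVf ?gt_eqF// expr1n mulr1.
by apply: le_trans (ler_wpM2r (sqr_ge0 x) (HK _ (ltW y0))) _; rewrite mulrAC.
Qed.

Let der_quadratic (f : R -> R) C : f 0 = 0 -> (forall h, `|f h| <= C * h ^+ 2) ->
  is_derive (0 : R) (1 : R) f (0 : R).
Proof.
move=> f0 fC; have C0 : 0 <= C by have := fC 1; rewrite expr1n mulr1; exact: le_trans.
suff H : (fun h => h^-1 *: ((f \o shift 0) (h *: (1 : R)) - f 0)) @ 0^' --> (0 : R).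
  by split; [exact: cvgP H|exact: cvg_lim H].
apply/cvgrPdist_le => e e0; have C1 : 0 < C + 1 by lra.
near=> h.
rewrite /= sub0r normrN f0 subr0 addr0 [h *: 1]mulr1 [_ *: _]/(_ * _) normrM normfV.
have [->|h0] := eqVneq h 0; first by rewrite normr0 invr0 mul0r ltW.
have hn : 0 < `|h| by rewrite normr_gt0.
rewrite mulrC ler_pdivrMr//; apply: le_trans (fC h) _.
rewrite -[h ^+ 2]real_normK ?num_real// expr2 mulrA; apply: ler_wpM2r; first exact: ltW.
have : `|h| <= e / (C + 1) by near: h; apply: dnbhs0_le; exact: divr_gt0.
rewrite ler_pdivlMr// => he; apply: le_trans he.
by rewrite mulrC ler_wpM2l// lerDl.
Unshelve. all: by end_near. Qed.

Lemma flat_deriv P x : is_derive x 1 (flat P) (flat ((P - P^`()) * 'X^2) x).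
Proof.
have [x0|x0|<-] := ltgtP 0 x; last first.
- have [C PC] := flat_bound P; rewrite {2}/flat ltxx.
  by apply: (der_quadratic _ PC); rewrite /flat ltxx.
- rewrite {2}/flat ltNge (ltW x0) /=; apply: (@near_eq_is_derive _ _ _ (fun=> 0) (flat P)).
    by near=> z; rewrite /flat ltNge ltW//; near: z; exact: lt_nbhsl.
have dV : is_derive x 1 (fun z : R => z^-1) (- x ^- 2).
  by apply: der_ext (@is_deriveV _ id x 1 1 _ (der_id _)) _ _ => //; [rewrite gt_eqF|rewrite [_ *: _]mulr1].
have dF : is_derive x 1 (fun z : R => P.[z^-1] * expR (- z^-1)) (flat ((P - P^`()) * 'X^2) x).
  apply: der_ext (derM (der_comp (f := horner P) (is_derive_poly P _) dV) (der_exp (derN dV))) _ _ => //.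
  rewrite /flat x0 hornerM hornerD hornerN hornerXn -exprVn; ring.
apply: near_eq_is_derive dF.
by near=> z; rewrite /flat ifT//; near: z; exact: lt_nbhsr.
Unshelve. all: by end_near. Qed.

(* Stable under partial derivatives, whence smoothness. *)
Inductive bump_algebra : (space3 R -> R) -> Prop :=
| bump_x P a b : bump_algebra (fun p => flat P (a + b * p.1.1))
| bump_y P a b : bump_algebra (fun p => flat P (a + b * p.1.2))
| bump_t P a b : bump_algebra (fun p => flat P (a + b * p.2))
| bump_cst c : bump_algebra (fun=> c)
| bump_add f g : bump_algebra f -> bump_algebra g -> bump_algebra (fun p => f p + g p)
| bump_mul f g : bump_algebra f -> bump_algebra g -> bump_algebra (fun p => f p * g p).

Lemma bump_continuous f : bump_algebra f -> continuous f.
Proof.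
have aff P (a b : R) : continuous (fun u : R => flat P (a + b * u)).
  move=> u; apply: (@der_continuous _ _ _ (flat ((P - P^`()) * 'X^2) (a + b * u) * b)).
  apply: (der_comp (flat_deriv P _)).
  by apply: der_ext (derD (der_cst a u) (derZ b (der_id u))) _ _ => //; rewrite add0r mulr1.
elim=> [P a b|P a b|P a b|c|{}f g _ cf _ cg|{}f g _ cf _ cg] p.
- exact: (cvg_comp _ _ (@coord_x_continuous R p) (aff P a b p.1.1)).
- exact: (cvg_comp _ _ (@coord_y_continuous R p) (aff P a b p.1.2)).
- exact: (cvg_comp _ _ (@coord_t_continuous R p) (aff P a b p.2)).
- exact: cvg_cst.
- exact: cvgD (cf p) (cg p).
- exact: cvgM (cf p) (cg p).
Qed.

Lemma bump_deriv f (i : 'I_3) : bump_algebra f ->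
  exists2 g, bump_algebra g & forall p, is_derive p (axis i) f (g p).
Proof.
pose D P : {poly R} := (P - P^`()) * 'X^2.
(* Here d is 1 along the axis of the coordinate and 0 along the others, so one computation serves
   all axes. *)
have aff P (a b t d : R) : is_derive t 1 (fun u : R => flat P (a + b * (d * u + (t - d * t)))) (b * d * flat (D P) (a + b * t)).
  have inner : is_derive t 1 (fun u : R => a + b * (d * u + (t - d * t))) (b * d).
    apply: der_ext (derD (der_cst a t) (derZ b (derD (derZ d (der_id t)) (der_cst (t - d * t) t)))) _ _ => //.
    by rewrite add0r addr0 mulr1.
  have E : d * t + (t - d * t) = t by ring.
  have outer : is_derive (a + b * (d * t + (t - d * t))) 1 (flat P) (flat (D P) (a + b * t)).
    by rewrite E; exact: flat_deriv.
  rewrite [X in is_derive _ _ _ X]mulrC.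
  exact: (@der_comp _ (flat P) (fun u : R => a + b * (d * u + (t - d * t))) t _ _ outer inner).
have E (d q u : R) : u * d + q = d * (u + q) + (q - d * q) by ring.
elim=> [P a b|P a b|P a b|c|{}f g bf [f' bf' df] bg [g' bg' dg]|{}f g bf [f' bf' df] bg [g' bg' dg]].
- exists (fun p => b * (i == ix)%:R * flat (D P) (a + b * p.1.1)).
    by apply: bump_mul; [exact: bump_cst|exact: bump_x].
  move=> p; refine (proj2 (is_derive_line (t := p.1.1) _ _) (aff _ _ _ _ (i == ix)%:R)).
  by move=> u; exact: (congr1 (fun w => flat P (a + b * w)) (E _ _ _)).
- exists (fun p => b * (i == iy)%:R * flat (D P) (a + b * p.1.2)).
    by apply: bump_mul; [exact: bump_cst|exact: bump_y].
  move=> p; refine (proj2 (is_derive_line (t := p.1.2) _ _) (aff _ _ _ _ (i == iy)%:R)).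
  by move=> u; exact: (congr1 (fun w => flat P (a + b * w)) (E _ _ _)).
- exists (fun p => b * (i == it)%:R * flat (D P) (a + b * p.2)).
    by apply: bump_mul; [exact: bump_cst|exact: bump_t].
  move=> p; refine (proj2 (is_derive_line (t := p.2) _ _) (aff _ _ _ _ (i == it)%:R)).
  by move=> u; exact: (congr1 (fun w => flat P (a + b * w)) (E _ _ _)).
- by exists (fun=> 0); [exact: bump_cst|move=> p; exact: is_derive_cst].
- by exists (fun p => f' p + g' p); [exact: bump_add|move=> p; exact: is_deriveD].
exists (fun p => f p * g' p + g p * f' p); first by apply: bump_add; exact: bump_mul.
by move=> p; exact: is_deriveM.
Qed.

Lemma bump_smooth f : bump_algebra f -> smooth (fun p => (f p)%:C%C).
Proof.
move=> bf w; suff [g bg ->] : exists2 g, bump_algebra g &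
    partials w (fun p => (f p)%:C%C) = (fun p => (g p)%:C%C).
  split; first by split; [exact: bump_continuous|move=> p; exact: cvg_cst].
  move=> i p; have [g' _ dg] := bump_deriv i bg; have [dg1 _] := dg p.
  by split; [exact: dg1|exact: derivable_cst].
elim: w => [|i w [g bg E]]; first by exists f.
have [g' bg' dg] := bump_deriv i bg; exists g' => //; rewrite /= E; apply/funext => p.
by rewrite /partial /=; have [_ ->] := dg p; rewrite derive_cst.
Qed.

Definition box_bump (p0 : space3 R) (e : R) (p : space3 R) : R :=
  (flat 1 ((e - p0.1.1) + 1 * p.1.1) * flat 1 ((e + p0.1.1) + (-1) * p.1.1)) *
  ((flat 1 ((e - p0.1.2) + 1 * p.1.2) * flat 1 ((e + p0.1.2) + (-1) * p.1.2)) *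
  (flat 1 ((e - p0.2) + 1 * p.2) * flat 1 ((e + p0.2) + (-1) * p.2))).

Lemma bump_smooth_bump p0 e : smooth (fun p => (box_bump p0 e p)%:C%C).
Proof.
apply: bump_smooth; do !apply: bump_mul; first [exact: bump_x|exact: bump_y|exact: bump_t].
Qed.

Let flat1_ge0 x : 0 <= flat 1 x.
Proof. by rewrite /flat; case: ifP => // _; rewrite hornerE mul1r expR_ge0. Qed.

Lemma bump_ge0 p0 e p : 0 <= box_bump p0 e p.
Proof. by rewrite !mulr_ge0. Qed.

Let flat1_out (e a x : R) : e <= `|x - a| -> flat 1 ((e - a) + 1 * x) * flat 1 ((e + a) + (-1) * x) = 0.
Proof.
rewrite ler_normr => /orP[] ex.
  by rewrite [X in _ * X]/flat ifF ?mulr0//; apply/negbTE; rewrite -leNgt; lra.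
by rewrite [X in X * _]/flat ifF ?mul0r//; apply/negbTE; rewrite -leNgt; lra.
Qed.

Let flat1_in (e a x : R) : `|x - a| <= e / 2 -> 0 < e ->
  expR (- (2 / e)) ^+ 2 <= flat 1 ((e - a) + 1 * x) * flat 1 ((e + a) + (-1) * x).
Proof.
rewrite ler_norml => /andP[h1 h2] e0.
have key (u : R) : e / 2 <= u -> expR (- (2 / e)) <= flat 1 u.
  move=> eu; have e2 : 0 < e / 2 by lra.
  have u0 : 0 < u by lra.
  rewrite /flat u0 hornerE mul1r ler_expR lerN2 -[2 / e]invf_div lef_pV2//.
by rewrite expr2; apply: ler_pM; rewrite ?expR_ge0//; apply: key; lra.
Qed.

Lemma bump_out p0 e p :
  (e <= `|p.1.1 - p0.1.1|) || (e <= `|p.1.2 - p0.1.2|) || (e <= `|p.2 - p0.2|) -> box_bump p0 e p = 0.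
Proof.
by move=> /orP[/orP[]|] h; rewrite /box_bump (flat1_out h) ?mul0r ?mulr0.
Qed.

Lemma bump_in p0 e p : 0 < e -> `|p.1.1 - p0.1.1| <= e / 2 -> `|p.1.2 - p0.1.2| <= e / 2 ->
  `|p.2 - p0.2| <= e / 2 -> expR (- (2 / e)) ^+ 6 <= box_bump p0 e p.
Proof.
move=> e0 hx hy ht; rewrite -[6%N]/(2 + (2 + 2))%N 2!exprD.
apply: ler_pM; rewrite ?mulr_ge0 ?exprn_ge0 ?expR_ge0//; first exact: flat1_in.
by apply: ler_pM; rewrite ?exprn_ge0 ?expR_ge0//; exact: flat1_in.
Qed.

End Bumps.

(** * Integration by parts *)

Section ComplexCalculus.
Context {R : realType}.
Implicit Types (f g v : space3 R -> R[i]).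

Definition csupported f : Prop :=
  cube_supported (fun p => complex.Re (f p)) /\ cube_supported (fun p => complex.Im (f p)).

(** The relational form carries existence of the derivative, which the total operator [partial] does
    not. *)
Definition has_partial (i : 'I_3) f g : Prop := forall p,
  is_derive p (axis i) (fun q => complex.Re (f q)) (complex.Re (g p)) /\
  is_derive p (axis i) (fun q => complex.Im (f q)) (complex.Im (g p)).

Lemma has_partialE i f g : has_partial i f g -> partial i f = g.
Proof.
move=> fg; apply/funext => p; rewrite /partial.
by have [[_ ->] [_ ->]] := fg p; apply: complex_ext.
Qed.

Lemma eq_has_partial i f g g' : has_partial i f g -> g =1 g' -> has_partial i f g'.
Proof. by move=> + /funext <-. Qed.

Lemma has_partialM i f f' g g' : has_partial i f f' -> has_partial i g g' ->
  has_partial i (fun p => f p * g p) (fun p => f' p * g p + f p * g' p).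
Proof.
move=> hf hg p; have [fR fI] := hf p; have [gR gI] := hg p; split.
  have H := is_deriveB (is_deriveM fR gR) (is_deriveM fI gI).
  rewrite (_ : (fun q => _) = (fun q => complex.Re (f q)) * (fun q => complex.Re (g q)) -
    (fun q => complex.Im (f q)) * (fun q => complex.Im (g q))); last by apply/funext => q; rewrite cReM.
  by apply: is_derive_eq H _; rewrite !cE /GRing.scale /=; ring.
have H := is_deriveD (is_deriveM fR gI) (is_deriveM fI gR).
rewrite (_ : (fun q => _) = (fun q => complex.Re (f q)) * (fun q => complex.Im (g q)) +
  (fun q => complex.Im (f q)) * (fun q => complex.Re (g q))); last by apply/funext => q; rewrite cImM.
by apply: is_derive_eq H _; rewrite !cE /GRing.scale /=; ring.
Qed.

Lemma ccontinuous_cst (a : R[i]) : ccontinuous (fun=> a : R[i]).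
Proof. by split => p; exact: cvg_cst. Qed.

Lemma ccontinuousD f g : ccontinuous f -> ccontinuous g -> ccontinuous (fun p => f p + g p).
Proof.
move=> [f1 f2] [g1 g2]; split => p.
  by under eq_fun do rewrite cReD; exact: cvgD (f1 p) (g1 p).
by under eq_fun do rewrite cImD; exact: cvgD (f2 p) (g2 p).
Qed.

Lemma ccontinuousM f g : ccontinuous f -> ccontinuous g -> ccontinuous (fun p => f p * g p).
Proof.
move=> [f1 f2] [g1 g2]; split => p.
  under eq_fun do rewrite cReM.
  exact: cvgB (cvgM (f1 p) (g1 p)) (cvgM (f2 p) (g2 p)).
under eq_fun do rewrite cImM.
exact: cvgD (cvgM (f1 p) (g2 p)) (cvgM (f2 p) (g1 p)).
Qed.

Lemma ccontinuous_sum N (F : nat -> space3 R -> R[i]) : (forall i, ccontinuous (F i)) ->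
  ccontinuous (fun p => \sum_(i < N) F i p).
Proof.
move=> cF; elim: N => [|N IH].
  by under eq_fun do rewrite big_ord0; exact: ccontinuous_cst.
by under eq_fun do rewrite big_ord_recr /=; exact: ccontinuousD.
Qed.

Lemma csupported_cont f : csupported f -> ccontinuous f.
Proof. by move=> [[? _] [? _]]. Qed.

Lemma csupportedP f : ccontinuous f -> (forall p, ~ cube p -> f p = 0) -> csupported f.
Proof. by move=> [f1 f2] f0; split; split => // p np; rewrite f0. Qed.

Lemma csupported0 f p : csupported f -> ~ cube p -> f p = 0.
Proof. by move=> [[_ f1] [_ f2]] np; apply: complex_ext; [exact: f1|exact: f2]. Qed.

Lemma csupportedD f g : csupported f -> csupported g -> csupported (fun p => f p + g p).
Proof.
move=> sf sg; apply: csupportedP; first by apply: ccontinuousD; exact: csupported_cont.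
by move=> p np; rewrite (csupported0 sf)// (csupported0 sg)// addr0.
Qed.

Lemma csupportedM v f : ccontinuous v -> csupported f -> csupported (fun p => v p * f p).
Proof.
move=> cv sf; apply: csupportedP; first by apply: ccontinuousM => //; exact: csupported_cont.
by move=> p np; rewrite (csupported0 sf)// mulr0.
Qed.

Lemma cintegralD f g : csupported f -> csupported g ->
  cintegral (fun p => f p + g p) = cintegral f + cintegral g.
Proof.
move=> [f1 f2] [g1 g2]; apply: complex_ext; rewrite !cE /=.
  under [LHS]eq_Rintegral do rewrite cReD.
  by apply: RintegralD => //; exact: cube_supported_integrable.
under [LHS]eq_Rintegral do rewrite cImD.
by apply: RintegralD => //; exact: cube_supported_integrable.
Qed.

Lemma cintegralZ (a : R[i]) f : csupported f -> cintegral (fun p => a * f p) = a * cintegral f.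
Proof.
move=> [f1 f2]; have i1 := cube_supported_integrable f1; have i2 := cube_supported_integrable f2.
have Z (b : R) h : (lebesgue3 R).-integrable setT (EFin \o h) ->
  (lebesgue3 R).-integrable setT (EFin \o (fun p => b * h p)).
  by move=> ih; exact: (integrableZl measurableT b ih).
apply: complex_ext; rewrite !cE /=.
  under [LHS]eq_Rintegral do rewrite cReM.
  by rewrite RintegralB ?RintegralZl//; exact: Z.
under [LHS]eq_Rintegral do rewrite cImM.
by rewrite RintegralD ?RintegralZl//; exact: Z.
Qed.

Lemma cintegral_le f (B : R) : csupported f -> (forall p, normc (f p) <= B) ->
  normc (cintegral f) <= 2 * (B * vol).
Proof.
move=> [f1 f2] fB; apply: le_trans (normc_le _) _; rewrite mulr2n mulrDl mul1r.
apply: lerD; apply: cube_supported_le => // p; apply: le_trans (fB p).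
  exact: normr_Re.
exact: normr_Im.
Qed.

Lemma cintegral_partial i f g : csupported f -> csupported g -> has_partial i f g ->
  cintegral g = 0.
Proof.
move=> [f1 f2] [g1 g2] fg; apply: complex_ext => /=.
  exact: (integral_partial f1 g1 (fun p => proj1 (fg p))).
exact: (integral_partial f2 g2 (fun p => proj2 (fg p))).
Qed.

Lemma cintegral_by_parts i v v' f f' : ccontinuous v -> ccontinuous v' -> has_partial i v v' ->
  csupported f -> csupported f' -> has_partial i f f' ->
  cintegral (fun p => v p * f' p) = - cintegral (fun p => v' p * f p).
Proof.
move=> cv cv' vv' sf sf' ff'.
have s1 := csupportedM cv' sf; have s2 := csupportedM cv sf'.
apply/eqP; rewrite -addr_eq0 addrC -cintegralD//; apply/eqP.
apply: (cintegral_partial _ _ (has_partialM vv' ff')); first exact: csupportedM.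
exact: csupportedD.
Qed.

Lemma smooth_has_partial f w (i : 'I_3) : smooth f -> has_partial i (partials w f) (partials (i :: w) f).
Proof. by move=> sf p; have [_ /(_ i p)[d1 d2]] := sf w; split; exact: derivableP. Qed.

Lemma smooth_in_partials (K : set (space3 R)) f w : closed K -> smooth_in K f ->
  forall p, ~ K p -> partials w f p = 0.
Proof.
move=> cK [_ f0]; elim: w => [|i w IH]; first exact: f0.
move=> p nK; rewrite /= /partial.
have N : \forall q \near p, partials w f q = 0.
  by near=> q; apply: IH; near: q; apply: open_nbhs_nbhs; split => //; exact: closed_openC.
rewrite (@near_eq_derive _ _ _ _ (fun=> 0 : R)); last by near=> q; rewrite (near N q).
rewrite (@near_eq_derive _ _ _ _ (fun=> 0 : R)); last by near=> q; rewrite (near N q).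
by rewrite derive_cst.
Unshelve. all: by end_near. Qed.

Lemma ball_cube p : ball (0 : space3 R) 1 p -> cube p.
Proof.
case: p => -[x y] t; rewrite cubeP => -[[/= + +] +].
by rewrite /ball /= !sub0r !normrN => /ltW ? /ltW ? /ltW ?.
Qed.

Lemma test_csupported f w : test_function (ball 0 1) f -> csupported (partials w f).
Proof.
move=> [K [cK KU sf]]; apply: csupportedP; first by have [] := sf.1 w.
move=> p np; apply: (@smooth_in_partials K) => //.
  by apply: compact_closed => //; exact: norm_hausdorff.
by move=> /KU /ball_cube.
Qed.

Lemma test_has_partial f w (i : 'I_3) : test_function (ball 0 1) f ->
  has_partial i (partials w f) (partials (i :: w) f).
Proof. by move=> [K [_ _ [sf _]]]; exact: smooth_has_partial. Qed.

Section Expansion.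
Variable (m : nat).

(** Y is d/dy - [Lcoef] d/dt. *)
Definition Lcoef (p : space3 R) : R[i] := (m%:R * p.1.1 ^+ m.-1)%:C%C.
Local Notation q := Lcoef.

Lemma Lcoef_continuous : ccontinuous q.
Proof.
split => p /=; last exact: cvg_cst.
have c : continuous (fun x : R => m%:R * x ^+ m.-1).
  by move=> x; exact: der_continuous (derZ _ (der_pow x _)).
exact: (cvg_comp _ _ (@coord_x_continuous R p) (c p.1.1)).
Qed.

Lemma Lcoef_partial i : i != ix -> has_partial i q (fun=> 0).
Proof.
move=> ix p; split; last exact: is_derive_cst.
refine (proj2 (is_derive_line (t := 0 : R) _ _) (der_cst (m%:R * p.1.1 ^+ m.-1) 0)) => u.
suff E : (u *: axis i + p).1.1 = p.1.1 by exact: (congr1 (fun x => m%:R * x ^+ m.-1) E).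
by rewrite /axis (negbTE ix) -[LHS]/(u * 0 + p.1.1) mulr0 add0r.
Qed.

Let YopYop (u : functional R) f : Yop m (Yop m u) f =
  u (partial iy (partial iy f)) - u (partial it (fun p => q p * partial iy f p)) -
  (u (partial iy (partial it (fun p => q p * f p))) -
   u (partial it (fun p => q p * partial it (fun p => q p * f p) p))).
Proof.
have E (a b c d : R[i]) : - (- a - - b) - - (- c - - d) = a - b - (c - d) by ring.
exact: E.
Qed.

(** [Lcoef] is independent of y and t, so it passes through [partial iy] and [partial it]. The right
    side consists of five values of [u], so that sums and limits of functionals can be taken term by
    term. *)
Lemma Lop_expand (u : functional R) f : test_function (ball 0 1) f ->
  Lop m u f = u (partials [:: ix; ix] f) + (u (partials [:: iy; iy] f) -
    u (fun p => q p * partials [:: it; iy] f p) - (u (fun p => q p * partials [:: iy; it] f p) -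
    u (fun p => q p * (q p * partials [:: it; it] f p)))).
Proof.
move=> tf; have dp := fun w i => test_has_partial w i tf.
have qf i w : i != ix -> partial i (fun p => q p * partials w f p) =
    (fun p => q p * partials (i :: w) f p).
  move=> ni; rewrite (has_partialE (has_partialM (Lcoef_partial ni) (dp w i))).
  by apply/funext => p; rewrite mul0r add0r.
have qqf : partial it (fun p => q p * (q p * partials [:: it] f p)) =
    (fun p => q p * (q p * partials [:: it; it] f p)).
  have nt : it != ix by [].
  rewrite (has_partialE (has_partialM (Lcoef_partial nt) (has_partialM (Lcoef_partial nt) (dp [:: it] it)))).
  by apply/funext => p; rewrite !mul0r !add0r.
have E : Lop m u f = - - u (partial ix (partial ix f)) + Yop m (Yop m u) f by [].
by rewrite E opprK YopYop (qf it [::] isT) (qf it [:: iy] isT) (qf iy [:: it] isT) qqf.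
Qed.

Lemma Lop_additive (u v : functional R) f : test_function (ball 0 1) f ->
  Lop m (fun g => u g + v g) f = Lop m u f + Lop m v f.
Proof.
move=> tf; rewrite (Lop_expand (fun g => u g + v g) tf) (Lop_expand u tf) (Lop_expand v tf).
have E (a b c d e a' b' c' d' e' : R[i]) : a + a' + (b + b' - (c + c') - (d + d' - (e + e'))) =
  a + (b - c - (d - e)) + (a' + (b' - c' - (d' - e'))) by ring.
exact: E.
Qed.

End Expansion.

Section Annihilation.
(** J is a square root of -1. The relations in y and t give Y v = J (eta - tau q) v, hence Y^2 v =
    -(eta - tau q)^2 v, which cancels X^2 v. *)
Variables (m : nat) (J eta tau : R[i]) (v vx : space3 R -> R[i]).
Hypothesis (JJ : J * J = -1).
Local Notation q := (Lcoef m).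
Hypotheses (cv : ccontinuous v) (cvx : ccontinuous vx).
Hypothesis v_x : has_partial ix v vx.
Hypothesis vx_x : has_partial ix vx (fun p => (eta - tau * q p) ^+ 2 * v p).
Hypothesis v_y : has_partial iy v (fun p => (J * eta) * v p).
Hypothesis v_t : has_partial it v (fun p => (J * tau) * v p).

(** Integration by parts against an eigenfunction of the i-th derivative, the weight [w] being
    constant in that variable. *)
Let sol_weight i lam w : ccontinuous w -> has_partial i w (fun=> 0) ->
  has_partial i v (fun p => lam * v p) -> forall f f', csupported f -> csupported f' ->
  has_partial i f f' ->
  cintegral (fun p => v p * (w p * f' p)) = - lam * cintegral (fun p => v p * (w p * f p)).
Proof.
move=> cw w0 vl f f' sf sf' ff'.
have cvw : ccontinuous (fun p => v p * w p) by exact: ccontinuousM.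
rewrite (_ : (fun p => _) = (fun p => (v p * w p) * f' p)); last by apply/funext => p; rewrite mulrA.
rewrite (@cintegral_by_parts i _ (fun p => lam * (v p * w p)) f)//.
- rewrite mulNr -cintegralZ; last by do !apply: csupportedM.
  by congr (- cintegral _); apply/funext => p; rewrite -!mulrA.
- by apply: ccontinuousM => //; exact: ccontinuous_cst.
- by apply: eq_has_partial (has_partialM vl w0) _ => p; rewrite mulr0 addr0 mulrA.
Qed.

Lemma Lop_annihilates f : test_function (ball 0 1) f ->
  Lop m (fun g => cintegral (fun p => v p * g p)) f = 0.
Proof.
move=> tf; rewrite Lop_expand//; have sp := fun w => test_csupported w tf.
have dp := fun w i => test_has_partial w i tf.
have q_cont := Lcoef_continuous m.
have q_const i : i != ix -> has_partial i q (fun=> 0) by exact: Lcoef_partial.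
(* Both X^2 and Y^2 reduce to the three integrals with weights 1, q and q^2. *)
pose I w := cintegral (fun p => v p * (w p * f p)).
have c1 := ccontinuous_cst 1.
have cqq : ccontinuous (fun p => q p * q p) by exact: ccontinuousM.
have two i j li lj w : ccontinuous w -> has_partial i w (fun=> 0) -> has_partial j w (fun=> 0) ->
    has_partial i v (fun p => li * v p) -> has_partial j v (fun p => lj * v p) ->
    cintegral (fun p => v p * (w p * partials [:: i; j] f p)) = li * lj * I w.
  move=> cw wi wj vi vj.
  rewrite (sol_weight cw wi vi (sp [:: j]) (sp [:: i; j]) (dp [:: j] i)).
  by rewrite (sol_weight cw wj vj (sp [::]) (sp [:: j]) (dp [::] j)) mulrA mulrNN.
have d1 i : has_partial i (fun=> 1) (fun=> 0) by move=> p; split; exact: is_derive_cst.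
have dqq i : i != ix -> has_partial i (fun p => q p * q p) (fun=> 0).
  move=> ni; apply: eq_has_partial (has_partialM (q_const _ ni) (q_const _ ni)) _ => p.
  by rewrite mul0r mulr0 addr0.
have Xpart : cintegral (fun p => v p * partials [:: ix; ix] f p) =
    eta ^+ 2 * I (fun=> 1) + ((- 2 * eta * tau) * I q + tau ^+ 2 * I (fun p => q p * q p)).
  rewrite (cintegral_by_parts cv cvx v_x (sp [:: ix]) (sp [:: ix; ix]) (dp [:: ix] ix)).
  rewrite (cintegral_by_parts cvx _ vx_x (sp [::]) (sp [:: ix]) (dp [::] ix)) ?opprK.
    have s w : ccontinuous w -> csupported (fun p => v p * (w p * f p)).
      by move=> cw; do 2!apply: csupportedM => //; exact: (sp [::]).
    have s' (a : R[i]) w : ccontinuous w -> csupported (fun p => a * (v p * (w p * f p))).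
      by move=> cw; apply: csupportedM; [exact: ccontinuous_cst|exact: s].
    have Z (a : R[i]) w : ccontinuous w -> a * I w = cintegral (fun p => a * (v p * (w p * f p))).
      by move=> cw; rewrite /I -cintegralZ//; exact: s.
    have s2 := s' (- 2 * eta * tau) _ q_cont; have s3 := s' (tau ^+ 2) _ cqq.
    rewrite (Z _ _ c1) (Z _ _ q_cont) (Z _ _ cqq).
    refine (etrans _ (congr1 (fun w => _ + w) (cintegralD s2 s3))).
    refine (etrans _ (cintegralD (s' (eta ^+ 2) _ c1) (csupportedD s2 s3))).
    by congr cintegral; apply/funext => p /=; ring.
  apply: ccontinuousM => //.
  have cl : ccontinuous (fun p => eta - tau * q p).
    under eq_fun do rewrite -mulNr; apply: ccontinuousD; first exact: ccontinuous_cst.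
    by apply: ccontinuousM => //; exact: ccontinuous_cst.
  by under eq_fun do rewrite expr2; exact: ccontinuousM.
have comb (x1 x2 x3 x4 a b c : R[i]) : x1 = (J * eta) * (J * eta) * a ->
    x2 = (J * tau) * (J * eta) * b -> x3 = (J * eta) * (J * tau) * b ->
    x4 = (J * tau) * (J * tau) * c ->
    x1 - x2 - (x3 - x4) = - (eta ^+ 2 * a + ((- 2 * eta * tau) * b + tau ^+ 2 * c)).
  have F y z : J * y * (J * z) = - (y * z) by rewrite mulrACA JJ mulN1r.
  by rewrite !F => -> -> -> ->; ring.
have E11 : cintegral (fun p => v p * partials [:: iy; iy] f p) = (J * eta) * (J * eta) * I (fun=> 1).
  by rewrite -(two iy iy) //; congr cintegral; apply/funext => p; rewrite mul1r.
have Eqq : cintegral (fun p => v p * (q p * (q p * partials [:: it; it] f p))) =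
    (J * tau) * (J * tau) * I (fun p => q p * q p).
  rewrite -(two it it) //; [|exact: dqq|exact: dqq].
  by congr cintegral; apply/funext => p; rewrite !mulrA.
have H2 := two it iy _ _ q q_cont (q_const _ (isT : it != ix)) (q_const _ (isT : iy != ix)) v_t v_y.
have H3 := two iy it _ _ q q_cont (q_const _ (isT : iy != ix)) (q_const _ (isT : it != ix)) v_y v_t.
refine (etrans (congr1 (fun w => _ + w) (comb _ _ _ _ _ _ _ E11 H2 H3 Eqq)) _).
by rewrite Xpart subrr.
Qed.

End Annihilation.
End ComplexCalculus.

(** * Uniform limits and duality *)

Section UniformLimits.
Context {R : realType}.
Implicit Types (p : space3 R).

(* Precomposition with this retraction onto a cube makes a function which is
   controlled only near 0 continuous everywhere. *)
Definition clamp (r : R) p : space3 R :=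
  let c (x : R) := (`|x + r| - `|x - r|) / 2 in (c p.1.1, c p.1.2, c p.2).

Let clamp_le (r x : R) : 0 <= r -> `|(`|x + r| - `|x - r|) / 2| <= r.
Proof.
move=> r0; rewrite ler_norml.
by case: (ger0P (x + r)) => ?; case: (ger0P (x - r)) => ?; apply/andP; split; lra.
Qed.

Let clamp1_id (r x : R) : `|x| <= r -> (`|x + r| - `|x - r|) / 2 = x.
Proof.
rewrite ler_norml => /andP[? ?]; by case: (ger0P (x + r)) => ?; case: (ger0P (x - r)) => ?; lra.
Qed.

Lemma clamp_bound r p : 0 <= r ->
  [/\ `|(clamp r p).1.1| <= r, `|(clamp r p).1.2| <= r & `|(clamp r p).2| <= r].
Proof. by move=> r0; split; exact: clamp_le. Qed.

Lemma clamp_id r p : `|p.1.1| <= r -> `|p.1.2| <= r -> `|p.2| <= r -> clamp r p = p.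
Proof. by case: p => -[x y] t /= *; rewrite /clamp /= !clamp1_id. Qed.

Lemma clamp_continuous r : continuous (clamp r).
Proof.
pose k (x : R) := (`|x + r| - `|x - r|) / 2.
have ck : continuous k.
  move=> x; apply: cvgM; last exact: cvg_cst.
  by apply: cvgB; apply: cvg_norm; [apply: cvgD|apply: cvgB] => //; exact: cvg_cst.
move=> p.
have cx : (fun q : space3 R => k q.1.1) @ p --> k p.1.1.
  exact: (cvg_comp _ _ (@coord_x_continuous R p) (ck p.1.1)).
have cy : (fun q : space3 R => k q.1.2) @ p --> k p.1.2.
  exact: (cvg_comp _ _ (@coord_y_continuous R p) (ck p.1.2)).
have ct : (fun q : space3 R => k q.2) @ p --> k p.2.
  exact: (cvg_comp _ _ (@coord_t_continuous R p) (ck p.2)).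
exact: (cvg_pair (cvg_pair cx cy) ct).
Qed.

Lemma ccontinuous_clamp r (f : space3 R -> R[i]) : ccontinuous f -> ccontinuous (f \o clamp r).
Proof.
by move=> [f1 f2]; split => p;
  [exact: (cvg_comp _ _ (@clamp_continuous r p) (f1 _))|exact: (cvg_comp _ _ (@clamp_continuous r p) (f2 _))].
Qed.

Let real_uniform_limit (s : nat -> space3 R -> R) (h : space3 R -> R) : (forall N, continuous (s N)) ->
  (forall e : R, 0 < e -> exists N, forall p, `|s N p - h p| <= e) -> continuous h.
Proof.
move=> cs sh p; apply/cvgrPdist_le => e e0.
have e3 : 0 < e / 3 by lra.
have [N hN] := sh _ e3; have /cvgrPdist_le /(_ _ e3) near_s := cs N p.
apply: filterS near_s => q sq.
have h1 := hN p; have h2 := hN q.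
have -> : h p - h q = (s N p - s N q) - (s N p - h p) + (s N q - h q) by ring.
apply: le_trans (ler_normD _ _) _; have := ler_normB (s N p - s N q) (s N p - h p); lra.
Qed.

Lemma ccontinuous_uniform (s : nat -> space3 R -> R[i]) h : (forall N, ccontinuous (s N)) ->
  (forall e : R, 0 < e -> exists N, forall p, normc (s N p - h p) <= e) -> ccontinuous h.
Proof.
move=> cs sh; split.
  apply: (@real_uniform_limit (fun N p => complex.Re (s N p))) => [N|e e0]; first by have [] := cs N.
  have [N hN] := sh e e0; exists N => p; apply: le_trans (hN p).
  by apply: le_trans (normr_Re _); rewrite !cE.
apply: (@real_uniform_limit (fun N p => complex.Im (s N p))) => [N|e e0]; first by have [] := cs N.
have [N hN] := sh e e0; exists N => p; apply: le_trans (hN p).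
by apply: le_trans (normr_Im _); rewrite !cE.
Qed.

Lemma half_cvg0 (C : R) : (fun N => C * 2^-1 ^+ N) @ \oo --> (0 : R).
Proof.
rewrite -[0](mulr0 C); apply: cvgM; first exact: cvg_cst.
by apply: cvg_expr; rewrite ger0_norm ?invr_ge0// invf_lt1// ltr1n.
Qed.

Lemma half_pow_cvg (C e : R) : 0 < e -> exists N, C * 2^-1 ^+ N <= e.
Proof.
move=> e0; move/cvgr0_norm_le : (@half_cvg0 C) => /(_ _ e0) [N _ /(_ N (leqnn N)) /= eN].
by exists N; apply: le_trans eN; exact: ler_norm.
Qed.

Lemma half_sum (u : nat -> R[i]) (C : R) N M : (N <= M)%N ->
  (forall l, (N <= l)%N -> normc (u l) <= C * 2^-1 ^+ l) ->
  normc (\sum_(l < M) u l - \sum_(l < N) u l) <= 2 * C * (2^-1 ^+ N - 2^-1 ^+ M).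
Proof.
move=> NM uC; elim: M NM => [|M IH].
  by rewrite leqn0 => /eqP ->; rewrite !subrr normc0 mulr0.
rewrite leq_eqVlt => /orP[/eqP ->|]; first by rewrite !subrr normc0 mulr0.
rewrite ltnS => NM; rewrite big_ord_recr /= addrAC; apply: le_trans (le_normcD _ _) _.
have := IH NM; have := uC M NM; rewrite exprS; lra.
Qed.

Lemma half_series (u : nat -> R[i]) (C : R) : (forall l, normc (u l) <= C * 2^-1 ^+ l) ->
  exists L, ccvg (fun N => \sum_(l < N) u l) L.
Proof.
move=> uC; have C0 : 0 <= C by have := uC 0%N; rewrite expr0 mulr1; apply: le_trans; exact: normc_ge0.
have B N : \sum_(l < N) normc (u l) <= 2 * C.
  suff : \sum_(l < N) normc (u l) <= 2 * C * (1 - 2^-1 ^+ N).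
    move=> /le_trans; apply; by rewrite ler_piMr ?mulr_ge0// gerBl exprn_ge0// invr_ge0.
  elim: N => [|N IH]; first by rewrite big_ord0 expr0 subrr mulr0.
  by rewrite big_ord_recr /= exprS; have := uC N; lra.
have cR : cvgn (series (fun l => complex.Re (u l))).
  by apply: (@bounded_series_cvg _ _ (2 * C)) => N; apply: le_trans (B N); apply: ler_sum => l _; exact: normr_Re.
have cI : cvgn (series (fun l => complex.Im (u l))).
  by apply: (@bounded_series_cvg _ _ (2 * C)) => N; apply: le_trans (B N); apply: ler_sum => l _; exact: normr_Im.
exists (lim (series (fun l => complex.Re (u l)) @ \oo) +i* lim (series (fun l => complex.Im (u l)) @ \oo))%C.
apply: ccvgRI => /=.
  by under eq_fun do rewrite Re_sum; move: cR; rewrite /series /=; under eq_fun do rewrite big_mkord.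
by under eq_fun do rewrite Im_sum; move: cI; rewrite /series /=; under eq_fun do rewrite big_mkord.
Qed.

Lemma half_series_tail (u : nat -> R[i]) (C : R) L N : ccvg (fun N => \sum_(l < N) u l) L ->
  (forall l, (N <= l)%N -> normc (u l) <= C * 2^-1 ^+ l) ->
  normc (\sum_(l < N) u l - L) <= 2 * C * 2^-1 ^+ N.
Proof.
move=> cL uC.
have C0 : 0 <= C.
  have := le_trans (normc_ge0 _) (uC N (leqnn N)).
  by rewrite pmulr_lge0// exprn_gt0// invr_gt0.
have cD : ccvg (fun M => \sum_(l < M) u l - \sum_(l < N) u l) (L - \sum_(l < N) u l).
  exact: (ccvgD cL (ccvg_cst (- \sum_(l < N) u l))).
rewrite normcB; apply: (ccvg_le cD); near=> M.
have NM : (N <= M)%N by near: M; exact: nbhs_infty_ge.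
apply: le_trans (half_sum NM uC) _; apply: ler_wpM2l; first exact: mulr_ge0.
by rewrite gerBl exprn_ge0// invr_ge0.
Unshelve. all: by end_near. Qed.

(** Puts two partial sums over the same box, so that their difference is estimated term by term. *)
Let box_widen (V : nmodType) (f : nat -> nat -> nat -> V) N M : (N <= M)%N ->
  \sum_(a < N) \sum_(b < N) \sum_(d < N) f a b d =
  \sum_(a < M) \sum_(b < M) \sum_(d < M)
    if [&& (a < N)%N, (b < N)%N & (d < N)%N] then f a b d else 0.
Proof.
move=> NM; rewrite (big_ord_widen M (fun a => \sum_(b < N) \sum_(d < N) f a b d))//.
rewrite big_mkcond; apply: eq_bigr => a _; case: ifP => _ /=; last by rewrite big1// => ? _; rewrite big1.
rewrite (big_ord_widen M (fun b => \sum_(d < N) f a b d))//.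
rewrite big_mkcond; apply: eq_bigr => b _; case: ifP => _ /=; last by rewrite big1.
by rewrite (big_ord_widen M (fun d => f a b d))// big_mkcond.
Qed.

Let box_sum_diff (f : nat -> nat -> nat -> R[i]) (h : nat -> nat -> nat -> R) N M : (N <= M)%N ->
  (forall a b d, normc (f a b d) <= h a b d) ->
  normc (\sum_(a < M) \sum_(b < M) \sum_(d < M) f a b d -
         \sum_(a < N) \sum_(b < N) \sum_(d < N) f a b d) <=
  \sum_(a < M) \sum_(b < M) \sum_(d < M) h a b d -
  \sum_(a < N) \sum_(b < N) \sum_(d < N) h a b d.
Proof.
move=> NM fh; rewrite (box_widen f NM) (box_widen h NM) -!sumrB.
apply: le_trans (normc_sum _ _ _) _; apply: ler_sum => a _.
rewrite -!sumrB; apply: le_trans (normc_sum _ _ _) _; apply: ler_sum => b _.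
rewrite -!sumrB; apply: le_trans (normc_sum _ _ _) _; apply: ler_sum => d _.
by case: ifP => _; rewrite ?subrr ?normc0 ?subr0.
Qed.

Lemma psum_diff c (r : R) p N M : (N <= M)%N ->
  `|p.1.1| <= r -> `|p.1.2| <= r -> `|p.2| <= r ->
  normc (psum c p M - psum c p N) <= psum_abs c (r, r, r) M - psum_abs c (r, r, r) N.
Proof.
move=> NM xr yr tr; have r0 := le_trans (normr_ge0 _) xr.
apply: (box_sum_diff (f := fun a b d => c a b d * (p.1.1 ^+ a * p.1.2 ^+ b * p.2 ^+ d)%:C%C)
  (h := fun a b d => normc (c a b d * (r ^+ a * r ^+ b * r ^+ d)%:C%C))) => // a b d.
rewrite !normcM !normc_real; apply: ler_wpM2l; first exact: normc_ge0.
rewrite [leRHS]ger0_norm ?mulr_ge0 ?exprn_ge0// !normrM !normrX.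
by apply: ler_pM; rewrite ?mulr_ge0 ?exprn_ge0//; [apply: ler_pM; rewrite ?exprn_ge0//|];
  rewrite lerXn2r ?nnegrE.
Qed.

Lemma psum_abs_le_lim c (r : R) N : 0 <= r -> cvgn (psum_abs c (r, r, r)) ->
  psum_abs c (r, r, r) N <= limn (psum_abs c (r, r, r)).
Proof.
move=> r0 cA; apply: nondecreasing_cvgn_le => //.
apply/nondecreasing_seqP => k; have K := leqnSn k.
have := @psum_diff c r (0, 0, 0) k k.+1 K; rewrite /= normr0 => /(_ r0 r0 r0).
by move=> /(le_trans (normc_ge0 _)); rewrite subr_ge0.
Qed.

Lemma psum_continuous c N : ccontinuous (fun p => psum c p N).
Proof.
apply: (ccontinuous_sum N (F := fun a p => \sum_(b < N) \sum_(d < N)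
  c a b d * (p.1.1 ^+ a * p.1.2 ^+ b * p.2 ^+ d)%:C%C)) => a.
apply: (ccontinuous_sum N (F := fun b p => \sum_(d < N)
  c a b d * (p.1.1 ^+ a * p.1.2 ^+ b * p.2 ^+ d)%:C%C)) => b.
apply: (ccontinuous_sum N (F := fun d p =>
  c a b d * (p.1.1 ^+ a * p.1.2 ^+ b * p.2 ^+ d)%:C%C)) => d.
apply: ccontinuousM; first exact: ccontinuous_cst.
split => p; last exact: cvg_cst.
have c_pow k : continuous (fun x : R => x ^+ k) by move=> x; exact: der_continuous (der_pow x k).
apply: cvgM; first apply: cvgM.
- exact: (cvg_comp _ _ (@coord_x_continuous R p) (c_pow a p.1.1)).
- exact: (cvg_comp _ _ (@coord_y_continuous R p) (c_pow b p.1.2)).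
- exact: (cvg_comp _ _ (@coord_t_continuous R p) (c_pow d p.2)).
Qed.

(** On the closed cube of radius r the series is dominated by its absolute values at the corner (r,
    r, r), so it converges uniformly. *)
Lemma analytic_clamp_continuous c (r : R) (g : space3 R -> R[i]) : 0 <= r ->
  cvgn (psum_abs c (r, r, r)) ->
  (forall p, `|p.1.1| <= r -> `|p.1.2| <= r -> `|p.2| <= r -> ccvg (psum c p) (g p)) ->
  ccontinuous (g \o clamp r).
Proof.
move=> r0 cA cg; apply: (@ccontinuous_uniform (fun N => (fun p => psum c p N) \o clamp r)) => [N|e e0].
  by apply: ccontinuous_clamp; exact: psum_continuous.
have /cvgrPdist_le /(_ _ e0) [N _ hN] := cA; exists N => p /=.
have [c1 c2 c3] := clamp_bound p r0.
have cD := ccvgD (cg _ c1 c2 c3) (ccvg_cst (- psum c (clamp r p) N)).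
rewrite normcB; apply: (ccvg_le cD); near=> M.
have NM : (N <= M)%N by near: M; exact: nbhs_infty_ge.
rewrite /=; apply: (le_trans (@psum_diff c r (clamp r p) N M NM c1 c2 c3)).
apply: le_trans (hN N (leqnn N)); apply: le_trans (ler_norm _).
rewrite lerD2r; exact: psum_abs_le_lim.
Unshelve. all: by end_near. Qed.

End UniformLimits.

Section ContinuousFunctionals.
Context {R : realType}.
Implicit Types (p q : space3 R).

Definition in_box (r : R) p := [/\ `|p.1.1| <= r, `|p.1.2| <= r & `|p.2| <= r].

(** A functional of order 0: the sup norm of the test function suffices for every compact set. *)
Lemma ccontinuous_distribution (H : space3 R -> R[i]) (B : R) : ccontinuous H ->
  (forall p, normc (H p) <= B) ->
  distribution_on (ball 0 1) (fun f => cintegral (fun p => H p * f p)).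
Proof.
move=> cH HB; have B0 : 0 <= B := le_trans (normc_ge0 _) (HB 0).
split=> [a f g tf tg|K cK KU].
  have sf : csupported (fun p => H p * f p) by apply: csupportedM => //; exact: (test_csupported [::] tf).
  have sg : csupported (fun p => H p * g p) by apply: csupportedM => //; exact: (test_csupported [::] tg).
  rewrite -cintegralZ// -cintegralD//; last by apply: csupportedM => //; exact: ccontinuous_cst.
  by congr cintegral; apply/funext => p; rewrite mulrDr mulrCA.
exists (2 * (B * vol)), 0%N => f sf.
have tf : test_function (ball 0 1) f by exists K.
have cf := test_csupported [::] tf.
have [f1 f2] := cf; have [B1 hB1] := cube_supported_bounded f1.
have [B2 hB2] := cube_supported_bounded f2.
have ub : has_ubound (range (fun p => normc (f p))).
  by exists (B1 + B2) => _ [p _ <-]; apply: le_trans (normc_le _) (lerD (hB1 p) (hB2 p)).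
have N0 : CN_norm 0 f = sup (range (fun p => normc (f p))).
  rewrite /CN_norm big_ord1 (big_pred1 [tuple]) => [|w]; first by [].
  by apply/esym/eqP; exact: tuple0.
have fle p : normc (f p) <= CN_norm 0 f by rewrite N0; apply: ub_le_sup => //; exists p.
rewrite -mulrA -[B * vol * _]mulrA [vol * _]mulrC [B * _]mulrA.
apply: cintegral_le; first exact: csupportedM.
move=> p; rewrite normcM; apply: ler_pM => //; exact: normc_ge0.
Qed.

Lemma bump_test (p0 : space3 R) (e r : R) : 0 < e -> r < 1 ->
  `|p0.1.1| + e <= r -> `|p0.1.2| + e <= r -> `|p0.2| + e <= r ->
  test_function (ball 0 1) (fun p => (box_bump p0 e p)%:C%C).
Proof.
move=> e0 r1 hx hy ht.
pose I (a : R) : set R := `[a - e, a + e]%classic.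
exists ((I p0.1.1 `*` I p0.1.2) `*` I p0.2); split.
- have cI a : compact (I a) by exact: segment_compact.
  by apply: compact_setX => //; apply: compact_setX.
- have key (a u : R) : `|a| + e <= r -> I a u -> ball 0 1 u.
    rewrite /I /= in_itv /= => ar /andP[h1 h2]; rewrite /ball /= sub0r normrN ltr_norml.
    have := ler_norm a; have := ler_norm (- a); rewrite normrN => ? ?; apply/andP; split; lra.
  by move=> [[x y] t] [[/= h1 h2] h3]; split; [split; [exact: key hx h1|exact: key hy h2]|exact: key ht h3].
split; first exact: bump_smooth_bump.
move=> p np; rewrite bump_out//; apply: contra_notT np; rewrite !negb_or -!ltNge => /andP[/andP[]].
by rewrite !ltr_distl => /andP[? ?] /andP[? ?] /andP[? ?]; split; [split|];
  rewrite /I /= in_itv /=; apply/andP; split; apply: ltW.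
Qed.

Let bump_away (p0 p : space3 R) (e r : R) :
  `|p0.1.1| + e <= r -> `|p0.1.2| + e <= r -> `|p0.2| + e <= r -> ~ in_box r p -> box_bump p0 e p = 0.
Proof.
move=> hx hy ht np; apply: bump_out; apply: contra_notT np; rewrite !negb_or -!ltNge => /andP[/andP[]].
have key (a u : R) : `|a| + e <= r -> `|u - a| < e -> `|u| <= r.
  by move=> ar ua; have := ler_normD (u - a) a; rewrite subrK; lra.
by move=> /(key _ _ hx) ? /(key _ _ hy) ? /(key _ _ ht) ?.
Qed.

Let bump_supported (h : space3 R -> R) (p0 : space3 R) (e r : R) : continuous h -> r < 1 ->
  `|p0.1.1| + e <= r -> `|p0.1.2| + e <= r -> `|p0.2| + e <= r ->
  cube_supported (fun p => h p * box_bump p0 e p).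
Proof.
move=> ch r1 hx hy ht; split.
  by move=> p; apply: cvgM (ch p) _; have [[c _] _] := @bump_smooth_bump R p0 e [::]; exact: c.
move=> p np; rewrite (bump_away hx hy ht) ?mulr0// => bx; apply: np.
by case: p bx => -[x y] t [/= ? ? ?]; rewrite cubeP; split; lra.
Qed.

Let positive_on_bump (h : space3 R -> R) (r : R) p0 : continuous h -> r < 1 ->
  `|p0.1.1| < r -> `|p0.1.2| < r -> `|p0.2| < r -> 0 < h p0 ->
  exists e : R, [/\ 0 < e, `|p0.1.1| + e <= r, `|p0.1.2| + e <= r, `|p0.2| + e <= r &
    0 < Rintegral (lebesgue3 R) setT (fun p => h p * box_bump p0 e p)].
Proof.
move=> ch r1 hx hy ht h0.
have h2 : 0 < h p0 / 2 by lra.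
have /cvgrPdist_le /(_ _ h2) /nbhs_ballP[e0 /= e00 he0] := ch p0.
pose e := Num.min (e0 / 2) (Num.min (r - `|p0.1.1|) (Num.min (r - `|p0.1.2|) (r - `|p0.2|))).
have [el ex ey et] : [/\ e <= e0 / 2, e <= r - `|p0.1.1|, e <= r - `|p0.1.2| & e <= r - `|p0.2|].
  by rewrite /e; split; rewrite !ge_min lexx ?orbT.
have ep : 0 < e by rewrite /e !lt_min; apply/and4P; split; lra.
clearbody e; exists e; rewrite -!lerBrDl; split => //.
have lo p : `|p.1.1 - p0.1.1| < e -> `|p.1.2 - p0.1.2| < e -> `|p.2 - p0.2| < e -> h p0 / 2 <= h p.
  move=> dx dy dt; have /he0 /= : ball p0 e0 p.
    by split; [split|]; rewrite /ball /= distrC; lra.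
  by rewrite ler_norml => /andP[_]; lra.
have e2 : 0 < e / 2 by lra.
have d0 : 0 < h p0 / 2 * expR (- (2 / e)) ^+ 6 by rewrite mulr_gt0// exprn_gt0// expR_gt0.
apply: (@integral_pos _ _ p0.1.1 p0.1.2 p0.2 _ _ _ _ e2 d0).
- by apply: (bump_supported ch r1); lra.
- move=> p; have [far|] := boolP ((e <= `|p.1.1 - p0.1.1|) || (e <= `|p.1.2 - p0.1.2|) || (e <= `|p.2 - p0.2|)).
    by rewrite bump_out// mulr0.
  rewrite !negb_or -!ltNge => /andP[/andP[dx dy] dt]; rewrite mulr_ge0 ?bump_ge0//.
  by have := lo p dx dy dt; lra.
- move=> p dx dy dt; apply: ler_pM; rewrite ?(ltW h2) ?exprn_ge0 ?expR_ge0//.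
    by apply: lo; lra.
  exact: bump_in.
Qed.

(** If the real or imaginary part of F - G were nonzero at a point, a narrow bump there would have a
    nonzero integral against it. The test functions are confined to the box of radius r because, in
    the application, the clamped G agrees with the analytic density only there. *)
Lemma fundamental_lemma (F G : space3 R -> R[i]) (r : R) : ccontinuous F -> ccontinuous G -> r < 1 ->
  (forall f, test_function (ball 0 1) f -> (forall p, ~ in_box r p -> f p = 0) ->
    cintegral (fun p => F p * f p) = cintegral (fun p => G p * f p)) ->
  forall p, `|p.1.1| < r -> `|p.1.2| < r -> `|p.2| < r -> F p = G p.
Proof.
move=> cF cG r1 FG.
have cN : ccontinuous (fun p => - 1 * G p) by apply: ccontinuousM => //; exact: ccontinuous_cst.
have [cR cI] := ccontinuousD cF cN.
have test p0 e : 0 < e -> `|p0.1.1| + e <= r -> `|p0.1.2| + e <= r -> `|p0.2| + e <= r ->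
    cintegral (fun p => (F p + - 1 * G p) * (box_bump p0 e p)%:C%C) = 0.
  move=> e0 hx hy ht; have tb := bump_test e0 r1 hx hy ht.
  have sb := test_csupported [::] tb.
  have sF := csupportedM cF sb; have sG := csupportedM cG sb.
  have E := FG _ tb (fun p np => congr1 (fun x => x%:C%C) (bump_away hx hy ht np)).
  transitivity (cintegral (fun p => F p * (box_bump p0 e p)%:C%C) +
    - 1 * cintegral (fun p => G p * (box_bump p0 e p)%:C%C)); last by rewrite E mulN1r subrr.
  rewrite -cintegralZ// -cintegralD//; last by apply: csupportedM => //; exact: ccontinuous_cst.
  by congr cintegral; apply/funext => p; rewrite mulrDl mulrA.
have zero (h : space3 R -> R) : continuous h ->
    (forall p0 e, 0 < e -> `|p0.1.1| + e <= r -> `|p0.1.2| + e <= r -> `|p0.2| + e <= r ->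
      Rintegral (lebesgue3 R) setT (fun p => h p * box_bump p0 e p) = 0) ->
    forall p, `|p.1.1| < r -> `|p.1.2| < r -> `|p.2| < r -> h p <= 0.
  move=> ch hz p hx hy ht; rewrite leNgt; apply/negP => /(positive_on_bump ch r1 hx hy ht).
  by move=> [e [e0 ex ey et]]; rewrite hz// ltxx.
have both (h : space3 R -> R) : continuous h ->
    (forall p0 e, 0 < e -> `|p0.1.1| + e <= r -> `|p0.1.2| + e <= r -> `|p0.2| + e <= r ->
      Rintegral (lebesgue3 R) setT (fun p => h p * box_bump p0 e p) = 0) ->
    forall p, `|p.1.1| < r -> `|p.1.2| < r -> `|p.2| < r -> h p = 0.
  move=> ch hz p hx hy ht; apply/eqP; rewrite eq_le zero//= -oppr_le0.
  apply: (zero (fun p => - h p)) => //; first by move=> q; exact: cvgN (ch q).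
  move=> p0 e e0 ex ey et; have sb := bump_supported ch r1 ex ey et.
  under eq_Rintegral do rewrite mulNr -mulN1r.
  by rewrite RintegralZl ?hz ?mulr0//; exact: cube_supported_integrable.
move=> p hx hy ht; apply/eqP; rewrite -subr_eq0 -mulN1r; apply/eqP; apply: complex_ext.
  apply: (both _ cR) => // p0 e e0 ex ey et.
  have /(congr1 (@complex.Re R)) /= := test p0 e e0 ex ey et; apply: etrans.
  by apply: eq_Rintegral => q _; rewrite [in RHS]cReM /= mulr0 subr0.
apply: (both _ cI) => // p0 e e0 ex ey et.
have /(congr1 (@complex.Im R)) /= := test p0 e e0 ex ey et; apply: etrans.
by apply: eq_Rintegral => q _; rewrite [in RHS]cImM /= mulr0 add0r.
Qed.

End ContinuousFunctionals.

(** * Detection of non-analyticity *)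

Section Detection.
Context {R : realType}.
(** [Q l] is r_l, kept a natural number so that growth is compared in [nat]; [A l] and [G l] are A_l
    and v_l. *)
Variables (n : nat) (Q : nat -> nat) (G : nat -> space3 R -> R[i]).
Hypotheses (n3 : (3 <= n)%N) (Q0 : (0 < Q 0)%N) (QS : forall l, Q l.+1 = (2 ^ n * Q l)%N).
Let A l := (Q l ^ 3)%N.
Hypothesis G_bound : forall l p, in_box 1 p -> normc (G l p) <= expR (- (A l)%:R).
Hypothesis G_shift : forall l (x t h : R),
  G l (x, 0, t + h) = expi ((Q l)%:R ^+ n.+1 * h) * G l (x, 0, t).
Hypothesis G_peak : forall l, exists2 x : R, 0 <= x <= (Q l)%:R^-1 &
  expR (- (5 * A l)%:R) <= normc (G l (x, 0, 0)).

Let QS8 l : (8 * Q l <= Q l.+1)%N.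
Proof. by rewrite QS leq_mul2r -[8%N]/(2 ^ 3)%N leq_exp2l// n3 orbT. Qed.

Let Q_ge l : (l < Q l)%N.
Proof. by elim: l => // l IH; apply: leq_trans (QS8 l); move: IH; lia. Qed.

Let Q_le_A l : (Q l <= A l)%N.
Proof. by rewrite /A -{1}[Q l]expn1 leq_pexp2l// (leq_ltn_trans _ (Q_ge l)). Qed.

Let A_step l : (512 * A l <= A l.+1)%N.
Proof. by rewrite /A -[512%N]/(8 ^ 3)%N -expnMn leq_exp2r. Qed.

Let A_mono j l : (j <= l)%N -> (A j <= A l)%N.
Proof.
by move=> jl; apply: (@homo_leq nat A leq) jl => // [y x z|i]; [exact: leq_trans|have := A_step i; lia].
Qed.

(** The summand l pays for a factor 2^-l that makes the tail summable, and 10 A_j for a tail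
    negligible beside e^{-5 A_j}. *)
Let A_gap j l : (j < l)%N -> (10 * A j + l <= A l)%N.
Proof.
case: l => // l; rewrite ltnS => jl.
have := A_mono jl; have := A_step l; have := Q_le_A l; have := Q_ge l; lia.
Qed.

Let A_ge l : (l <= A l)%N.
Proof. by apply: leq_trans (Q_le_A l); exact: ltnW (Q_ge l). Qed.

Let expRN1 : expR (-1) <= (2^-1 : R).
Proof.
rewrite expRN lef_pV2 ?posrE ?expR_gt0//.
by apply: le_trans (expR_ge1Dx 1).
Qed.

Let half_le : (2^-1 : R) <= expR (- 2^-1).
Proof. by apply: le_trans (expR_ge1Dx (- 2^-1)); lra. Qed.

Let expRN_nat l : expR (- (l%:R : R)) <= 2^-1 ^+ l.
Proof.
by rewrite -[l%:R]mul1r -mulNr expRM_natr lerXn2r ?nnegrE ?expR_ge0 ?invr_ge0.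
Qed.

Lemma G_head l p : in_box 1 p -> normc (G l p) <= 1 * 2^-1 ^+ l.
Proof.
move=> p1; rewrite mul1r; apply: le_trans (expRN_nat l); apply: le_trans (G_bound l p1) _.
by rewrite ler_expR lerN2 ler_nat.
Qed.

Let G_tail j l p : in_box 1 p -> (j < l)%N ->
  normc (G l p) <= expR (- (10 * A j)%:R) * 2^-1 ^+ l.
Proof.
move=> p1 jl; apply: le_trans (G_bound l p1) _.
apply: le_trans (ler_wpM2l (expR_ge0 _) (expRN_nat l)).
by rewrite -expRD ler_expR -opprD lerN2 -natrD ler_nat; exact: A_gap.
Qed.

Section Contradiction.
Variables (H : space3 R -> R[i]) (c : nat -> nat -> nat -> R[i]) (r M : R).
Hypothesis G_cvg : forall p, in_box 1 p -> ccvg (fun N => \sum_(l < N) G l p) (H p).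
Hypotheses (r0 : 0 < r) (r1 : r < 1) (cM : forall N, psum_abs c (r, r, r) N <= M).
Hypothesis c_cvg : forall p, `|p.1.1| < r -> `|p.1.2| < r -> `|p.2| < r -> ccvg (psum c p) (H p).

Let tau l : R := (Q l)%:R ^+ n.+1.

Let tau_gt0 l : 0 < tau l.
Proof. by rewrite exprn_gt0// ltr0n (leq_ltn_trans _ (Q_ge l)). Qed.

Let tau_step l : 4 * tau l <= tau l.+1.
Proof.
rewrite /tau; have q0 : 0 <= (Q l)%:R :> R by [].
apply: (@le_trans _ _ ((8 * (Q l)%:R) ^+ n.+1)).
  rewrite exprMn; apply: ler_wpM2r; first exact: exprn_ge0.
  by rewrite -natrX ler_nat; apply: (@leq_trans (8 ^ 1)%N) => //; rewrite leq_exp2l.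
by rewrite lerXn2r ?nnegrE ?mulr_ge0// -natrM ler_nat.
Qed.

Let tau_lt j l : (l < j)%N -> 4 * tau l <= tau j.
Proof.
elim: j => // j IH; rewrite ltnS leq_eqVlt => /orP[/eqP ->|/IH h]; first exact: tau_step.
by have := tau_step j; have := tau_gt0 j; lra.
Qed.

Section Scale.
Variable j : nat.
Let h : R := pi / tau j.
Let k : nat := (20 * A j)%N.

Let h_gt0 : 0 < h. Proof. by rewrite divr_gt0// pi_gt0. Qed.

(** k h = 20 Q_j^3 pi / Q_j^m with m = n + 1 >= 4 and pi <= 4: the stencil shrinks at least like 1 /
    Q_j. *)
Let kh_le : k%:R * h <= 80 / (Q j)%:R.
Proof.
have q1 : 1 <= (Q j)%:R :> R by rewrite ler1n (leq_ltn_trans _ (Q_ge j)).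
have q0 : 0 < (Q j)%:R :> R by lra.
have pi4 : (pi : R) <= 4 by have := pihalf_lt2 R; lra.
rewrite /h /k natrM /A natrX mulrA ler_pdivrMr// [leRHS]mulrAC ler_pdivlMr//.
have e : (Q j)%:R ^+ 3 * (Q j)%:R <= tau j.
  by rewrite -exprSr /tau ler_weXn2l// ltnS.
have : (Q j)%:R ^+ 3 * (Q j)%:R * pi <= tau j * 4.
  by apply: ler_pM => //; rewrite ?pi_ge0// mulr_ge0// exprn_ge0.
by move: (tau j) ((Q j)%:R ^+ 3) => a b; nra.
Qed.

Let weight l := (2^-1)%:C%C * (expi (tau l * h) - 1).

(** The step is half a period of v_j in t, so each halved difference multiplies v_j by (-1 - 1) /
    2. *)
Let weight_diag : normc (weight j) = 1.
Proof.
have E : tau j * h = pi by rewrite /h mulrC divfK// gt_eqF.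
rewrite /weight E expi_pi normcM normc_real -opprD normcN.
rewrite -[1 + 1]/(2%:R) normc_nat gtr0_norm ?invr_gt0// mulVf//.
Qed.

(** tau_l h = pi tau_l / tau_j <= pi / 4 <= 1, which bounds |e^{i tau_l h} - 1|. *)
Let weight_low l : (l < j)%N -> normc (weight l) <= 2^-1.
Proof.
move=> lj; rewrite /weight normcM normc_real gtr0_norm ?invr_gt0//.
rewrite ler_piMr ?invr_ge0//; apply: le_trans (normc_expiB1 _) _.
rewrite ger0_norm; last by rewrite mulr_ge0// ltW.
have pi4 : (pi : R) <= 4 by have := pihalf_lt2 R; lra.
rewrite /h mulrA ler_pdivrMr// mul1r; apply: le_trans (tau_lt lj).
by rewrite mulrC ler_wpM2r// ltW.
Qed.

Let fdiff_G l x : fdiff h k (fun t => G l (x, 0, t)) 0 = weight l ^+ k * G l (x, 0, 0).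
Proof. by rewrite (@fdiff_exp _ h k _ (expi (tau l * h)))// => s; exact: G_shift. Qed.

(** M comes from the power series, one 2 from the waves after j and the other from those before. The
    condition on Q_j gives k h < r / 2, hence (k h / r)^k <= 2^-k. *)
Lemma scale_bound : 160 / (Q j)%:R < r -> expR (- (5 * A j)%:R) <= (M + 4) * expR (- (10 * A j)%:R).
Proof.
move=> large; have [x /andP[x0 xq] peak] := G_peak j.
have q0 : 0 < (Q j)%:R :> R by rewrite ltr0n (leq_ltn_trans _ (Q_ge j)).
have iq : 0 < (Q j)%:R^-1 :> R by rewrite invr_gt0.
have kh2 : k%:R * h < r / 2 by apply: le_lt_trans kh_le _; move: large; move: (_^-1) => u; lra.
have kh0 : 0 <= k%:R * h by rewrite mulr_ge0// ltW.
move: (kh2) (kh0); move: {-2}(k%:R * h) (erefl (k%:R * h)) => kh khE kh2' kh0'.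
have xr : `|x| < r by rewrite ger0_norm//; apply: le_lt_trans xq _; move: large iq; move: (_^-1) => u; lra.
have in_seg t : 0 <= t <= 0 + k%:R * h -> `|t| < r.
  by rewrite add0r -khE => /andP[t0 t1]; rewrite ger0_norm//; lra.
have box t : 0 <= t <= 0 + k%:R * h -> in_box 1 (x, 0, t).
  by move=> /in_seg tr; split => /=; [exact: ltW (lt_trans xr r1)|rewrite normr0|exact: ltW (lt_trans tr r1)].
have M0 : 0 <= M by have := cM 0; rewrite /psum_abs big_ord0.
(* k = 20 A_j and 1/2 <= e^{-1/2}. *)
have E10 : 2^-1 ^+ k <= expR (- (10 * A j)%:R) :> R.
  apply: (@le_trans _ _ (expR (- 2^-1) ^+ k)); first by rewrite lerXn2r ?nnegrE ?expR_ge0 ?invr_ge0.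
  rewrite -expRM_natr ler_expR /k !natrM; lra.
have analytic : normc (fdiff h k (fun t => H (x, 0, t)) 0) <= M * 2^-1 ^+ k.
  have cv := @fdiff_ccvg _ h k (fun N t => psum c (x, 0, t) N) (fun t => H (x, 0, t)) 0 (ltW h_gt0).
  apply: (ccvg_le (cv _)) => [t tk|].
    by apply: c_cvg => //=; [rewrite normr0|exact: in_seg].
  near=> N; apply: (le_trans (@fdiff_psum _ c x 0 h r k N (ltW h_gt0) r0 _ _ _)).
  - lra.
  - exact: ltW.
  - by rewrite normr0 ltW.
  apply: ler_pM => //.
  - by apply: sumr_ge0 => ? _; apply: sumr_ge0 => ? _; apply: sumr_ge0 => ? _; exact: normc_ge0.
  - by rewrite exprn_ge0// divr_ge0// ltW.
  - by rewrite lerXn2r ?nnegrE ?invr_ge0 ?divr_ge0 ?(ltW r0)// ler_pdivrMr//; lra.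
have tail : normc (fdiff h k (fun t => \sum_(l < j.+1) G l (x, 0, t)) 0 -
    fdiff h k (fun t => H (x, 0, t)) 0) <= 2 * expR (- (10 * A j)%:R).
  rewrite addrC -[- fdiff _ _ _ _]mulN1r -fdiff_lin; apply: fdiff_bound; first exact: ltW.
  move=> t /box bt; rewrite mulN1r addrC.
  apply: le_trans (half_series_tail (G_cvg bt) (fun l jl => G_tail bt jl)) _.
  by rewrite ler_piMr ?mulr_ge0 ?expR_ge0// exprn_ile1 ?invr_ge0// invf_le1// ler1n.
have sumE : fdiff h k (fun t => \sum_(l < j.+1) G l (x, 0, t)) 0 =
    \sum_(l < j) weight l ^+ k * G l (x, 0, 0) + weight j ^+ k * G j (x, 0, 0).
  transitivity (fdiff h k (fun t => \sum_(l < j.+1) 1 * G l (x, 0, t)) 0).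
    by apply: eq_fdiff => t; apply: eq_bigr => l _; rewrite mul1r.
  rewrite (@fdiff_sum _ h k j.+1 (fun=> 1) (fun l t => G l (x, 0, t))) big_ord_recr /= mul1r fdiff_G.
  by congr (_ + _); apply: eq_bigr => l _; rewrite mul1r fdiff_G.
have b0 : in_box 1 (x, 0, 0) by apply: box; rewrite lexx add0r.
have low : normc (\sum_(l < j) weight l ^+ k * G l (x, 0, 0)) <= 2 * 2^-1 ^+ k.
  apply: le_trans (normc_sum _ _ _) _.
  apply: (@le_trans _ _ (\sum_(l < j) 2^-1 ^+ k * 2^-1 ^+ l)).
    apply: ler_sum => l _; rewrite normcM normcX; apply: ler_pM.
    - by rewrite exprn_ge0// normc_ge0.
    - exact: normc_ge0.
    - by rewrite lerXn2r ?nnegrE ?normc_ge0 ?invr_ge0// weight_low.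
    - by apply: le_trans (G_head l b0) _; rewrite mul1r.
  rewrite -mulr_sumr mulrC; apply: ler_wpM2r; first by rewrite exprn_ge0 ?invr_ge0.
  suff : \sum_(l < j) 2^-1 ^+ l <= 2 * (1 - 2^-1 ^+ j) :> R.
    by move=> /le_trans; apply; rewrite ler_piMr// gerBl exprn_ge0 ?invr_ge0.
  elim: (j) => [|i IH]; first by rewrite big_ord0 expr0 subrr mulr0.
  by rewrite big_ord_recr /= exprS; lra.
apply: le_trans peak _.
have -> : normc (G j (x, 0, 0)) = normc (weight j ^+ k * G j (x, 0, 0)).
  by rewrite normcM normcX weight_diag expr1n mul1r.
move: analytic tail low E10; rewrite sumE.
move: (fdiff _ _ _ _) (\sum_(l < j) _) (weight j ^+ k * _) (2^-1 ^+ k) (expR _) => f s w e E.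
move=> fM sw se eE.
have -> : w = (s + w - f) + f - s by ring.
apply: le_trans (ler_normcB _ _) _; have := le_normcD (s + w - f) f.
have : M * e <= M * E by apply: ler_wpM2l.
lra.
Unshelve. all: by end_near. Qed.

End Scale.

Lemma detection : False.
Proof.
have [j hj] : exists j, (160 / r < j%:R) /\ (M + 4 < j%:R).
  exists (Num.trunc (Num.max (160 / r) (M + 4))).+1.
  by split; apply: le_lt_trans (truncnS_gt _); rewrite le_max lexx ?orbT.
have [j1 j2] := hj.
have Qj : j%:R < (Q j)%:R :> R by rewrite ltr_nat.
have q0 : 0 < (Q j)%:R :> R by apply: le_lt_trans Qj.
have := @scale_bound j; rewrite ltr_pdivrMr// mulrC -ltr_pdivrMr// => /(_ (lt_trans j1 Qj)).
have -> : expR (- (10 * A j)%:R) = expR (- (5 * A j)%:R) * expR (- (5 * A j)%:R) :> R.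
  by rewrite -expRD -opprD -natrD -mulnDl.
have e0 := expR_gt0 (- (5 * A j)%:R : R); have E0 := expR_gt0 ((5 * A j)%:R : R).
have eE : expR (5 * A j)%:R * expR (- (5 * A j)%:R) = 1 :> R by rewrite -expRD subrr expR0.
have EM : M + 4 < expR (5 * A j)%:R.
  apply: lt_le_trans (expR_ge1Dx _); apply: (lt_trans j2); apply: (lt_le_trans Qj).
  have : (Q j)%:R <= (5 * A j)%:R :> R by rewrite ler_nat; apply: leq_trans (Q_le_A j) _; exact: leq_pmull.
  move: (_ * _)%N => z; lra.
move: (expR _) (expR _) e0 E0 eE EM => E e e0 E0 eE EM.
rewrite mulrA -[leLHS]mul1r ler_pM2r// => L.
suff : E <= M + 4 by rewrite leNgt EM.
by rewrite -(ler_pM2r e0) eE.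
Qed.

End Contradiction.
End Detection.

(** * Separated solutions *)

Section Waves.
Context {R : realType}.
Implicit Types (A B C : R -> R[i]) (p : space3 R).

Definition imag : R[i] := (0 +i* 1)%C.

Lemma imagE : imag * imag = -1.
Proof. by apply: complex_ext; rewrite !cE /=; ring. Qed.

(* [cexpi w y] is exp(i w y) for complex [w]. *)
Definition cexpi (w : R[i]) (y : R) : R[i] :=
  (expR (- complex.Im w * y))%:C%C * expi (complex.Re w * y).

Lemma cexpi_deriv w y : cderiv (cexpi w) y (imag * w * cexpi w y).
Proof.
have e : is_derive y 1 (fun y => expR (- complex.Im w * y)) (- complex.Im w * expR (- complex.Im w * y)).
  by apply: der_ext (der_exp (derZ (- complex.Im w) (der_id y))) _ _ => //; rewrite mulr1 mulrC.
have lin : is_derive y 1 (fun y => complex.Re w * y) (complex.Re w).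
  by apply: der_ext (derZ (complex.Re w) (der_id y)) _ _ => //; rewrite mulr1.
have c := der_comp (is_derive_cos (complex.Re w * y)) lin.
have s := der_comp (is_derive_sin (complex.Re w * y)) lin.
split.
  apply: der_ext (derM e c) _ _ => [t|]; first by rewrite /cexpi !cE /=; ring.
  by rewrite /cexpi !cE /=; ring.
apply: der_ext (derM e s) _ _ => [t|]; first by rewrite /cexpi !cE /=; ring.
by rewrite /cexpi !cE /=; ring.
Qed.

Lemma cexpi0 w : cexpi w 0 = 1.
Proof. by rewrite /cexpi !mulr0 expR0 expi0 mulr1. Qed.

Lemma cexpi_real (a y : R) : cexpi a%:C%C y = expi (a * y).
Proof. by rewrite /cexpi /= oppr0 mul0r expR0 mul1r. Qed.

Lemma normc_cexpi w y : normc (cexpi w y) <= expR (normc w * `|y|).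
Proof.
rewrite /cexpi normcM normc_expi mulr1 normc_real gtr0_norm ?expR_gt0// ler_expR.
apply: le_trans (ler_norm _) _; rewrite normrM normrN; apply: ler_wpM2r => //; exact: normr_Im.
Qed.

Lemma cderivZ (a : R[i]) A s d : cderiv A s d -> cderiv (fun x => a * A x) s (a * d).
Proof.
move=> [dR dI]; split.
  by apply: der_ext (derB (derZ (complex.Re a) dR) (derZ (complex.Im a) dI)) _ _ => [t|]; rewrite !cE.
by apply: der_ext (derD (derZ (complex.Re a) dI) (derZ (complex.Im a) dR)) _ _ => [t|]; rewrite !cE.
Qed.

Lemma cderiv_scale (r : R) A s d : cderiv A (r * s) d -> cderiv (fun x => A (r * x)) s (r%:C%C * d).
Proof.
have l : is_derive s 1 (fun x => r * x) r.
  by apply: der_ext (derZ r (der_id s)) _ _ => //; rewrite mulr1.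
by move=> [dR dI]; split; [apply: der_ext (der_comp dR l) _ _|apply: der_ext (der_comp dI l) _ _] => //;
  rewrite !cE /=; ring.
Qed.

Definition sep A B C p : R[i] := C p.2 * (B p.1.2 * A p.1.1).

Let cderiv_line (i : 'I_3) (f : space3 R -> R[i]) (A : R -> R[i]) p d t :
  (forall u : R, f (u *: axis i + p) = A (u + t)) -> cderiv A t d ->
  is_derive p (axis i) (fun q => complex.Re (f q)) (complex.Re d) /\
  is_derive p (axis i) (fun q => complex.Im (f q)) (complex.Im d).
Proof.
move=> E [dR dI]; split; [apply: (proj2 (is_derive_line _ _) dR)|apply: (proj2 (is_derive_line _ _) dI)].
  by move=> u; rewrite E.
by move=> u; rewrite E.
Qed.

Let lineE (a b c x y t u : R) : u *: ((a, b, c) : space3 R) + (x, y, t) = (u * a + x, u * b + y, u * c + t).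
Proof. by []. Qed.

Lemma sep_x A A' B C : (forall s, cderiv A s (A' s)) -> has_partial ix (sep A B C) (sep A' B C).
Proof.
move=> dA [[x y] t]; apply: (@cderiv_line _ _ (fun s => (C t * B y) * A s) _ _ x).
  by move=> u; rewrite /axis lineE /= !mulr0 !add0r mulr1 /sep /= mulrA.
by rewrite /sep /= mulrA; exact: cderivZ.
Qed.

Lemma sep_y A B B' C : (forall s, cderiv B s (B' s)) -> has_partial iy (sep A B C) (sep A B' C).
Proof.
move=> dA [[x y] t]; apply: (@cderiv_line _ _ (fun s => (C t * A x) * B s) _ _ y).
  by move=> u; rewrite /axis lineE /= !mulr0 !add0r mulr1 /sep /= -mulrA [A x * _]mulrC.
by rewrite /sep /= [B' y * _]mulrC mulrA; exact: cderivZ.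
Qed.

Lemma sep_t A B C C' : (forall s, cderiv C s (C' s)) -> has_partial it (sep A B C) (sep A B C').
Proof.
move=> dA [[x y] t]; apply: (@cderiv_line _ _ (fun s => (B y * A x) * C s) _ _ t).
  by move=> u; rewrite /axis lineE /= !mulr0 !add0r mulr1 /sep /= mulrC.
by rewrite /sep /= [C' t * _]mulrC; exact: cderivZ.
Qed.

Lemma sep_continuous A A' B B' C C' : (forall s, cderiv A s (A' s)) -> (forall s, cderiv B s (B' s)) ->
  (forall s, cderiv C s (C' s)) -> ccontinuous (sep A B C).
Proof.
have cc D D' : (forall s, cderiv D s (D' s)) ->
    continuous (fun s : R => complex.Re (D s)) /\ continuous (fun s : R => complex.Im (D s)).
  by move=> dD; split=> s; have [dR dI] := dD s; [exact: der_continuous dR|exact: der_continuous dI].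
move=> /cc[A1 A2] /cc[B1 B2] /cc[C1 C2]; rewrite /sep.
apply: ccontinuousM; last apply: ccontinuousM.
- by split => p; [exact: (cvg_comp _ _ (@coord_t_continuous R p) (C1 p.2))|
    exact: (cvg_comp _ _ (@coord_t_continuous R p) (C2 p.2))].
- by split => p; [exact: (cvg_comp _ _ (@coord_y_continuous R p) (B1 p.1.2))|
    exact: (cvg_comp _ _ (@coord_y_continuous R p) (B2 p.1.2))].
by split => p; [exact: (cvg_comp _ _ (@coord_x_continuous R p) (A1 p.1.1))|
  exact: (cvg_comp _ _ (@coord_x_continuous R p) (A2 p.1.1))].
Qed.

Section Wave.
Variables (n : nat) (g r : R) (z a b : R[i]).

(** g is the damping factor and r the scale. The frequency r z in y is complex, so this factor may
    grow; the one in t has modulus g for g >= 0. *)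
Definition wave : space3 R -> R[i] :=
  sep (fun x => sol n a b z (r * x)) (cexpi (r%:C%C * z)) (fun t => g%:C%C * cexpi (r ^+ n.+1)%:C%C t).

Let dA s : cderiv (fun x => sol n a b z (r * x)) s (r%:C%C * dsol n a b z (r * s)).
Proof. by apply: cderiv_scale; exact: sol_deriv. Qed.

Let dC s : cderiv (fun t => g%:C%C * cexpi (r ^+ n.+1)%:C%C t) s
  (imag * (r ^+ n.+1)%:C%C * (g%:C%C * cexpi (r ^+ n.+1)%:C%C s)).
Proof. by rewrite mulrCA; apply: cderivZ; exact: cexpi_deriv. Qed.

Let ddA s : cderiv (fun x => r%:C%C * dsol n a b z (r * x)) s
  (r%:C%C * (r%:C%C * ((z - (n.+1%:R * (r * s) ^+ n)%:C%C) ^+ 2 * sol n a b z (r * s)))).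
Proof.
by apply: cderivZ; apply: cderiv_scale; exact: dsol_deriv.
Qed.

Lemma wave_continuous : ccontinuous wave.
Proof. exact: (sep_continuous dA (cexpi_deriv _) dC). Qed.

Lemma wave_annihilated f : test_function (ball 0 1) f ->
  Lop n.+1 (fun u => cintegral (fun p => wave p * u p)) f = 0.
Proof.
apply: (@Lop_annihilates R n.+1 imag (r%:C%C * z) (r ^+ n.+1)%:C%C wave
  (sep (fun x => r%:C%C * dsol n a b z (r * x)) (cexpi (r%:C%C * z))
    (fun t => g%:C%C * cexpi (r ^+ n.+1)%:C%C t)) imagE wave_continuous).
- exact: (sep_continuous ddA (cexpi_deriv _) dC).
- exact: sep_x.
- apply: eq_has_partial (sep_x _ _ ddA) _ => p; rewrite /wave /sep /Lcoef /=.
  move: (sol _ _ _ _ _) (cexpi _ _) (cexpi _ _) => F E1 E2.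
  (* Homogeneity: r^{n+1} x^n = r (r x)^n, which is why the frequency in t is r^{n+1}. *)
  have -> : r%:C%C * z - (r ^+ n.+1)%:C%C * (n.+1%:R * p.1.1 ^+ n)%:C%C =
      r%:C%C * (z - (n.+1%:R * (r * p.1.1) ^+ n)%:C%C).
    by rewrite mulrBr; congr (_ - _); rewrite -!rmorphM /=; congr (_%:C)%C; rewrite exprMn exprS; ring.
  move: (z - _) => w; ring.
- by apply: eq_has_partial (sep_y _ _ (cexpi_deriv _)) _ => p; rewrite /wave /sep; ring.
- by apply: eq_has_partial (sep_t _ _ dC) _ => p; rewrite /wave /sep; ring.
Qed.

Lemma wave_shift (x t h : R) : wave (x, 0, t + h) = expi (r ^+ n.+1 * h) * wave (x, 0, t).
Proof.
rewrite /wave /sep /= !cexpi_real mulrDr expiD; move: (expi _) (expi _) (cexpi _ _) (sol _ _ _ _ _) => *.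
ring.
Qed.

Lemma wave_at (x : R) : 0 <= g -> normc (wave (x, 0, 0)) = g * normc (sol n a b z (r * x)).
Proof.
move=> g0; rewrite -[wave _]/((g%:C%C * cexpi (r ^+ n.+1)%:C%C 0) *
  (cexpi (r%:C%C * z) 0 * sol n a b z (r * x))).
by rewrite !cexpi0 mulr1 mul1r normcM normc_real ger0_norm.
Qed.

(** On the unit cube |e^{i r z y}| <= e^{r |z|} <= e^{r^3}, and r x stays in [-r, r]. *)
Lemma wave_bound p (B : R) : 0 <= g -> 0 <= r -> normc z <= r ^+ 2 ->
  (forall s : R, `|s| <= r -> normc (sol n a b z s) <= expR B) -> in_box 1 p ->
  normc (wave p) <= g * (expR (r ^+ 3) * expR B).
Proof.
move=> g0 r0 zr sB [x1 y1 _]; rewrite /wave /sep normcM [normc (g%:C%C * _)]normcM [normc (_ * sol _ _ _ _ _)]normcM.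
rewrite normc_real ger0_norm// cexpi_real normc_expi mulr1; apply: ler_wpM2l => //.
apply: ler_pM; rewrite ?normc_ge0//.
  apply: le_trans (normc_cexpi _ _) _; rewrite ler_expR normcM normc_real ger0_norm//.
  apply: (@le_trans _ _ (r * normc z)); first by rewrite ler_piMr// mulr_ge0// normc_ge0.
  by rewrite exprS; exact: ler_wpM2l.
by apply: sB; rewrite normrM ger0_norm// ler_piMr.
Qed.

End Wave.
End Waves.

(** * The superposition of the waves *)

Section NonAnalyticSolution.
Context {R : realType}.
Variables (n : nat) (Q : nat -> nat) (G : nat -> space3 R -> R[i]).
Hypotheses (n3 : (3 <= n)%N) (Q0 : (0 < Q 0)%N) (QS : forall l, Q l.+1 = (2 ^ n * Q l)%N).
Hypothesis G_bound : forall l p, in_box 1 p -> normc (G l p) <= expR (- (Q l ^ 3)%:R).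
Hypothesis G_shift : forall l (x t h : R),
  G l (x, 0, t + h) = expi ((Q l)%:R ^+ n.+1 * h) * G l (x, 0, t).
Hypothesis G_peak : forall l, exists2 x : R, 0 <= x <= (Q l)%:R^-1 &
  expR (- (5 * Q l ^ 3)%:R) <= normc (G l (x, 0, 0)).
Hypothesis G_continuous : forall l, ccontinuous (G l).
Hypothesis G_annihilated : forall l f, test_function (ball 0 1) f ->
  Lop n.+1 (fun u => cintegral (fun p => G l p * u p)) f = 0.

Let head l p := G_head n3 Q0 QS G_bound l (p := p).

Let clamp_box p : in_box (1 : R) (clamp 1 p).
Proof. exact: clamp_bound. Qed.

Variable H : space3 R -> R[i].
Hypothesis G_cvg : forall p, ccvg (fun N => \sum_(l < N) G l (clamp 1 p)) (H p).

Let G_unif p N : normc (\sum_(l < N) G l (clamp 1 p) - H p) <= 2 * 1 * 2^-1 ^+ N.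
Proof.
exact: (@half_series_tail R (fun l => G l (clamp 1 p)) 1 (H p) N (G_cvg p)
  (fun l _ => head l (clamp_box p))).
Qed.

Let partial_continuous N : ccontinuous (fun p => \sum_(l < N) G l (clamp 1 p)).
Proof. by apply: (ccontinuous_sum N (F := fun l => G l \o clamp 1)) => l; exact: ccontinuous_clamp. Qed.

Let H_continuous : ccontinuous H.
Proof.
apply: (ccontinuous_uniform partial_continuous) => e e0.
have [N eN] := half_pow_cvg (2 * 1) e0.
by exists N => p; apply: le_trans (G_unif p N) eN.
Qed.

Let H_bound p : normc (H p) <= 2.
Proof. by have := G_unif p 0; rewrite big_ord0 sub0r normcN expr0 !mulr1. Qed.

Let u : functional R := fun f => cintegral (fun p => H p * f p).
Let u_ (N : nat) : functional R := fun f => \sum_(l < N) cintegral (fun p => G l p * f p).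

Let in_cube (p : space3 R) : cube p -> clamp 1 p = p.
Proof. by case: p => -[x y] t; rewrite cubeP => -[? ? ?]; exact: clamp_id. Qed.

(** The clamp is invisible to functions supported in the cube. *)
Let u_E N f : csupported f -> u_ N f = cintegral (fun p => (\sum_(l < N) G l (clamp 1 p)) * f p).
Proof.
move=> sf; rewrite /u_; elim: N => [|N IH].
  rewrite big_ord0 -[LHS](mul0r (cintegral f)) -cintegralZ//.
  by congr cintegral; apply/funext => p; rewrite big_ord0.
rewrite big_ord_recr /= IH -cintegralD; [|exact: csupportedM|exact: csupportedM].
congr cintegral; apply/funext => p; rewrite big_ord_recr /= mulrDl; congr (_ + _).
have [cp|ncp] := pselect (cube p); first by rewrite in_cube.
by rewrite (csupported0 sf ncp) !mulr0.
Qed.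

Let u_cvg f : csupported f -> ccvg (u_ ^~ f) (u f).
Proof.
move=> sf; have [f1 f2] := sf.
have [B1 hB1] := cube_supported_bounded f1; have [B2 hB2] := cube_supported_bounded f2.
have fB p : normc (f p) <= B1 + B2 by apply: le_trans (normc_le _) (lerD (hB1 p) (hB2 p)).
apply: (@ccvg_squeeze _ _ _ (fun N => 4 * (B1 + B2) * vol * 2^-1 ^+ N)); last exact: half_cvg0.
move=> N; rewrite (u_E N sf).
have cN : ccontinuous (fun p => - 1 * H p) by apply: ccontinuousM => //; exact: ccontinuous_cst.
have E : cintegral (fun p => (\sum_(l < N) G l (clamp 1 p)) * f p) - u f =
    cintegral (fun p => (\sum_(l < N) G l (clamp 1 p) + - 1 * H p) * f p).
  rewrite -[- u f]mulN1r /u -cintegralZ; last exact: csupportedM.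
  rewrite -cintegralD; last first.
  - by apply: csupportedM; [exact: ccontinuous_cst|exact: csupportedM].
  - exact: csupportedM.
  by congr cintegral; apply/funext => p; rewrite mulrDl mulrA.
rewrite E (_ : 4 * _ * _ * _ = 2 * ((2 * 1 * 2^-1 ^+ N) * (B1 + B2) * vol)); last by ring.
apply: cintegral_le; first by apply: csupportedM => //; exact: ccontinuousD.
move=> p; rewrite normcM mulN1r; apply: ler_pM; rewrite ?normc_ge0//; exact: G_unif.
Qed.

(** The partial sums are annihilated, and they converge to [u] at the five functions of
    [Lop_expand]; all derivatives stay on the test function, and only the uniform convergence of the
    series itself enters. *)
Let u_solution f : test_function (ball 0 1) f -> Lop n.+1 u f = 0.
Proof.
move=> tf; have sp := fun w => test_csupported w tf.
have sq w : csupported (fun p => Lcoef n.+1 p * partials w f p).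
  by apply: csupportedM => //; exact: Lcoef_continuous.
have sqq : csupported (fun p => Lcoef n.+1 p * (Lcoef n.+1 p * partials [:: it; it] f p)).
  by apply: csupportedM => //; exact: Lcoef_continuous.
have zero N : Lop n.+1 (u_ N) f = 0.
  elim: N => [|N IH].
    rewrite (_ : u_ 0 = fun=> 0); last by apply/funext => g; rewrite /u_ big_ord0.
    by rewrite (Lop_expand n.+1 (fun=> 0) tf) !subr0 addr0.
  rewrite (_ : u_ N.+1 = fun g => u_ N g + cintegral (fun p => G N p * g p)); last first.
    by apply/funext => g; rewrite /u_ big_ord_recr.
  by rewrite (Lop_additive n.+1 _ _ tf) IH G_annihilated// addr0.
apply: (@ccvg_uniq _ (fun N => Lop n.+1 (u_ N) f)); last first.
  by under eq_fun do rewrite zero; exact: ccvg_cst.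
have cB (v w : nat -> R[i]) a b : ccvg v a -> ccvg w b -> ccvg (fun N => v N - w N) (a - b).
  move=> va wb; rewrite -[- b]mulN1r; under eq_fun do rewrite -[- w _]mulN1r.
  by apply: ccvgD va _; exact: ccvgZ.
have E : (fun N => Lop n.+1 (u_ N) f) = _ := funext (fun N => Lop_expand n.+1 (u_ N) tf).
rewrite (Lop_expand n.+1 u tf) E.
exact: (ccvgD (u_cvg (sp [:: ix; ix])) (cB _ _ _ _
  (cB _ _ _ _ (u_cvg (sp [:: iy; iy])) (u_cvg (sq [:: it; iy])))
  (cB _ _ _ _ (u_cvg (sq [:: iy; it])) (u_cvg sqq)))).
Qed.

Lemma not_analytic_hypoelliptic : ~ analytic_hypoelliptic (@Lop R n.+1).
Proof.
move=> hyp.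
have Lu : is_analytic_on (ball 0 1) (Lop n.+1 u).
  exists (fun=> 0); last first.
    move=> f tf; rewrite u_solution//; apply/esym; rewrite /regular.
    have sf := test_csupported [::] tf.
    by rewrite (cintegralZ 0 sf) mul0r.
  move=> p _; exists (fun _ _ _ => 0), 1; split => // q _; split.
    rewrite (_ : psum_abs _ _ = (fun=> 0)); first exact: is_cvg_cst.
    apply/funext => N; rewrite /psum_abs big1// => a _; rewrite big1// => b _; rewrite big1// => d _.
    by rewrite mul0r normc0.
  rewrite (_ : (fun N => _) = (fun=> 0)); first exact: cvg_cst.
  apply/funext => N; rewrite subr0 /psum big1 ?normc0// => a _; rewrite big1// => b _.
  by rewrite big1// => d _; rewrite mul0r.
have op : open (ball (0 : space3 R) 1) by exact: ball_open.
have [g ag ug] := hyp _ _ op (ccontinuous_distribution H_continuous H_bound) Lu.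
have b0 : ball (0 : space3 R) 1 0 by exact: ballxx.
have [c [r [r0 conv]]] := ag 0 b0.
(* Half the minimum: the closed cube of radius rho lies in the ball of convergence and in the open
   unit ball. *)
pose rho := Num.min r 1 / 2.
have rho0 : 0 < rho by rewrite divr_gt0// lt_min r0 ltr01.
have [rhor rho1] : rho < r /\ rho < 1.
  have m1 : Num.min r 1 <= r by rewrite ge_min lexx.
  have m2 : Num.min r 1 <= 1 by rewrite ge_min lexx orbT.
  by move: rho0; rewrite /rho; move: (Num.min r 1) m1 m2 => m m1 m2 m0; split; lra.
clearbody rho.
have inr q : in_box rho q -> ball 0 r q.
  by case: q => -[x y] t [/= ? ? ?]; split; [split|]; rewrite /ball /= sub0r normrN; exact: le_lt_trans rhor.
have cv q : in_box rho q -> ccvg (psum c q) (g q).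
  by move=> /inr /conv [_]; rewrite subr0.
have cA : cvgn (psum_abs c (rho, rho, rho)).
  have /inr /conv [+ _] : in_box rho (rho, rho, rho) by split => /=; rewrite ger0_norm// ltW.
  by rewrite subr0.
have cg : ccontinuous (g \o clamp rho).
  by apply: (analytic_clamp_continuous (ltW rho0) cA) => p h1 h2 h3; exact: cv.
have Hg : forall p, `|p.1.1| < rho -> `|p.1.2| < rho -> `|p.2| < rho -> H p = (g \o clamp rho) p.
  apply: (fundamental_lemma H_continuous cg rho1) => f tf f0.
  apply: etrans (ug f tf) _; congr cintegral; apply/funext => p.
  have [[h1 h2 h3]|np] := pselect (in_box rho p); first by rewrite /= clamp_id.
  by rewrite f0// !mulr0.
apply: (@detection R n Q G n3 Q0 QS G_bound G_shift G_peak H c rho (limn (psum_abs c (rho, rho, rho)))) => //.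
- by move=> p [h1 h2 h3]; have := G_cvg p; rewrite clamp_id.
- by move=> N; apply: psum_abs_le_lim => //; exact: ltW.
move=> p h1 h2 h3; rewrite Hg//= clamp_id ?ltW//; apply: cv; split; exact: ltW.
Qed.

End NonAnalyticSolution.

(** * Choice of the scales *)

Section Assembly.
Context {R : realType}.

(** Turns the polynomial lower bound for f on [0, 1] into e^{-A_l}, through e^{q^3} >= (q^3 / 4)^4,
    of degree 12 in q against degree 4. *)
Let peak_arith (q : R) (n : nat) : 8 <= q -> n.+1%:R <= q ->
  5 + 2 * (q ^+ 2 + n.+1%:R) ^+ 2 <= expR (q ^+ 3).
Proof.
move=> q8 nq; have q1 : 1 <= q by lra.
have q0 : 0 <= q by lra.
have low : (q ^+ 3 / 4) ^+ 4 <= expR (q ^+ 3).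
  have [w w0 ->] : exists2 w, 0 <= w & q ^+ 3 = 4 * w.
    by exists (q ^+ 3 / 4); [rewrite divr_ge0// exprn_ge0|field].
  rewrite [4 * w]mulrC mulfK// expRM_natr lerXn2r ?nnegrE ?expR_ge0//.
  by apply: le_trans (expR_ge1Dx _); rewrite lerDr.
apply: le_trans low.
have n0 : 0 <= n.+1%:R :> R by [].
have s1 : q ^+ 2 + n.+1%:R <= 2 * q ^+ 2 by rewrite expr2; nra.
have s2 : (q ^+ 2 + n.+1%:R) ^+ 2 <= (2 * q ^+ 2) ^+ 2.
  by rewrite lerXn2r ?nnegrE ?addr_ge0 ?mulr_ge0 ?exprn_ge0.
have w0 : 8 * 8 <= q ^+ 4.
  by apply: (@le_trans _ _ (q ^+ 2)); [rewrite expr2; apply: ler_pM|exact: ler_weXn2l].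
have -> : (q ^+ 3 / 4) ^+ 4 = q ^+ 4 * (q ^+ 4 * q ^+ 4) / 256 by field.
have E : (2 * q ^+ 2) ^+ 2 = 4 * q ^+ 4 by ring.
rewrite E in s2; move: (q ^+ 4) w0 s2 => w w0 s2.
have a1 : 8 * 8 * w <= w * w by apply: ler_wpM2r => //; lra.
have a2 : 8 * 8 * (w * w) <= w * (w * w) by apply: ler_wpM2r => //; rewrite mulr_ge0//; lra.
by move: (w * (w * w)) (w * w) (_ ^+ 2) a1 a2 s2 => W3 W2 s a1 a2 s2; lra.
Qed.

Lemma Lop_not_analytic_hypoelliptic (n : nat) : (3 <= n)%N -> odd n ->
  ~ analytic_hypoelliptic (@Lop R n.+1).
Proof.
move=> n3 on; have [T0 eig] := @eigenfunction R n n3 on.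
(* Adding 2 ensures T_l >= 2, whence Q_l >= 2^n, which is at least 8 and exceeds n. *)
pose T l := ((T0 + 2) * 2 ^ l)%N; pose Q l := (T l ^ n)%N.
have T0le l : (T0 <= T l)%N.
  by apply: (@leq_trans (T0 + 2)); [exact: leq_addr|rewrite leq_pmulr// expn_gt0].
have T2 l : (2 <= T l)%N.
  by apply: (@leq_trans (T0 + 2)); [exact: leq_addl|rewrite leq_pmulr// expn_gt0].
pose P l (v : (R[i] * R[i] * R[i]) * R) := [/\ normc v.1.1.1 <= (T l)%:R ^+ n ^+ 2,
  (forall s : R, `|s| <= (T l)%:R ^+ n ->
    normc (sol n v.1.1.2 v.1.2 v.1.1.1 s) <= expR (2 * ((T l)%:R ^+ 2) ^+ n.+1)),
  0 <= v.2 <= 1 &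
  (5 + 2 * (((T l)%:R ^+ n) ^+ 2 + n.+1%:R) ^+ 2)^-1 <= normc (sol n v.1.1.2 v.1.2 v.1.1.1 v.2)].
have /choice[w hw] : forall l, exists v, P l v.
  by move=> l; have [z [a [b [h1 h2 [s h3 h4]]]]] := eig (T l) (T0le l); exists (z, a, b, s).
pose A l := (Q l ^ 3)%N.
pose G l := wave n (expR (- (4 * A l)%:R)) (Q l)%:R (w l).1.1.1 (w l).1.1.2 (w l).1.2.
have QE l : (Q l)%:R = (T l)%:R ^+ n :> R by rewrite natrX.
have AE l : (A l)%:R = (Q l)%:R ^+ 3 :> R by rewrite natrX.
have Q8 l : (8 <= Q l)%N.
  by apply: (@leq_trans (2 ^ n)); [rewrite -[8%N]/(2 ^ 3)%N leq_exp2l|rewrite leq_exp2r// (leq_trans _ n3)].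
have Qn l : (n < Q l)%N.
  by apply: (@leq_trans (2 ^ n)); [exact: ltn_expl|rewrite leq_exp2r// (leq_trans _ n3)].
have Q0 : (0 < Q 0)%N by exact: leq_trans (Q8 0).
have QS l : Q l.+1 = (2 ^ n * Q l)%N by rewrite /Q /T expnS mulnCA expnMn.
have g0 l : 0 <= expR (- (4 * A l)%:R) :> R by exact: expR_ge0.
have G_bound l p : in_box 1 p -> normc (G l p) <= expR (- (Q l ^ 3)%:R).
  have [zb sb _ _] := hw l => p1.
  have sb' s : `|s| <= (Q l)%:R -> normc (sol n (w l).1.1.2 (w l).1.2 (w l).1.1.1 s) <= expR (2 * (Q l)%:R ^+ 3).
    rewrite QE => /sb /le_trans; apply; rewrite ler_expR; apply: ler_wpM2l => //.
    (* 2 (n + 1) <= 3 n brings the growth of f below e^{2 Q_l^3}. *)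
    rewrite -!exprM; apply: ler_weXn2l; first by rewrite ler1n (leq_trans _ (T2 l)).
    by move: n3; lia.
  have zb' : normc (w l).1.1.1 <= (Q l)%:R ^+ 2 by rewrite QE.
  apply: le_trans (wave_bound (g0 l) (ler0n _ _) zb' sb' p1) _.
  (* The exponents of the damping, of the factor in y and of f add up to -4 A + A + 2 A = -A. *)
  rewrite -!expRD ler_expR -/(A l) natrM -AE; lra.
have G_peak l : exists2 x : R, 0 <= x <= (Q l)%:R^-1 &
    expR (- (5 * Q l ^ 3)%:R) <= normc (G l (x, 0, 0)).
  have [_ _ /andP[s0 s1] lo] := hw l.
  have q0 : 0 < (Q l)%:R :> R by rewrite ltr0n (leq_trans _ (Q8 l)).
  (* The point of [0, 1] where f is not small, rescaled. *)
  exists ((w l).2 / (Q l)%:R).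
    by rewrite divr_ge0 ?(ltW q0)//= ler_pdivrMr// mulVf// gt_eqF.
  rewrite /G wave_at//.
  have -> : (Q l)%:R * ((w l).2 / (Q l)%:R) = (w l).2 by rewrite mulrC divfK// gt_eqF.
  apply: le_trans (ler_wpM2l (g0 l) lo).
  have arith : 5 + 2 * ((Q l)%:R ^+ 2 + n.+1%:R) ^+ 2 <= expR (A l)%:R :> R.
    by rewrite AE; apply: peak_arith; rewrite ler_nat.
  rewrite -QE; apply: (@le_trans _ _ (expR (- (4 * A l)%:R) * expR (- (A l)%:R))).
    rewrite -expRD ler_expR -/(A l) !natrM; lra.
  have d0 : 0 < 5 + 2 * ((Q l)%:R ^+ 2 + n.+1%:R) ^+ 2 :> R by rewrite ltr_pwDl// mulr_ge0// sqr_ge0.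
  by apply: ler_wpM2l => //; rewrite expRN lef_pV2 ?posrE ?expR_gt0.
have G_shift l (x t h : R) : G l (x, 0, t + h) = expi ((Q l)%:R ^+ n.+1 * h) * G l (x, 0, t).
  exact: wave_shift.
have G_cont l : ccontinuous (G l) by exact: wave_continuous.
have G_ann l f : test_function (ball 0 1) f -> Lop n.+1 (fun u => cintegral (fun p => G l p * u p)) f = 0.
  exact: wave_annihilated.
have /choice[H HG] : forall p, exists L, ccvg (fun N => \sum_(l < N) G l (clamp 1 p)) L.
  move=> p; apply: (@half_series R (fun l => G l (clamp 1 p)) 1) => l; apply: (G_head n3 Q0 QS G_bound).
  exact: clamp_bound.
exact: (not_analytic_hypoelliptic n3 Q0 QS G_bound G_shift G_peak G_cont G_ann HG).
Qed.

End Assembly.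

Theorem theorem1 (R : realType) (m : nat) (m_ge4 : (4 <= m)%N)
    (m_even : ~~ odd m) : ~ analytic_hypoelliptic (@Lop R m).
Proof.
case: m m_ge4 m_even => // n n4; rewrite /= negbK => on.
exact: Lop_not_analytic_hypoelliptic.
Qed.
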